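(* Let $\tau^\circ_{\rm mark},\tau^{\circ\circ}_{\rm mark}$ be any marked tessellations and $\tau^\circ_{\rm dot},\tau^{\circ\circ}_{\rm dot}$ any dotted tessellations. Let $\mathcal{F}^\circ,\mathcal{F}^{\circ\circ}:Pt\to Pt_{\rm dot}$ be the unique functors which are equivariant under the $M$-actions on objects and satisfy $\mathcal{F}^\circ(\tau^\circ_{\rm mark})=\tau^\circ_{\rm dot}$ and $\mathcal{F}^{\circ\circ}(\tau^{\circ\circ}_{\rm mark})=\tau^{\circ\circ}_{\rm dot}$ respectively. Let ${\bf F}^\circ,{\bf F}^{\circ\circ}:T\to K$ be the group homomorphisms constructed respectively from $\mathcal{F}^\circ,\mathcal{F}^{\circ\circ}$. Then there is $h\in K$ such that $${\bf F}^{\circ\circ}(g)=h^{-1}\,{\bf F}^\circ(g)\,h,\qquad\forall g\in T.$$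
   Context: Let $\mathbb{D}\subset\mathbb{C}$ be the open unit disc, $S^1=\partial\mathbb{D}$, and $\mu(x)=\frac{x-i}{x+i}$, identifying $\mathbb{RP}^1=\mathbb{R}\cup\{\infty\}$ with $S^1$; rational points of $S^1$ are the $\mu(r)$, $r\in\mathbb{Q}\cup\{\infty\}$. Homotopies of $\mathbb{D}$ extend continuously to the closed disc and fix every point of $S^1$ at all times. An ideal arc is a homotopy class of unoriented paths in $\mathbb{D}$ joining two distinct points of $S^1$; an ideal triangle is the region bounded by the three ideal arcs (its sides) joining three distinct points of $S^1$. Rationals are written in reduced form $p/q$ ($q>0$, coprime), $0=0/1$, $\infty=1/0$ or $-1/0$. The Farey tessellation $\tau^*$ consists of the ideal arcs joining $\mu(a/b)$ and $\mu(c/d)$ with $|ad-bc|=1$. A *tessellation* means a countable locally finite collection of ideal arcs (edges) whose complement is a disjoint union of ideal triangles, whose vertices are all rational points of $S^1$, and all but finitely many of whose edges are edges of $\tau^*$. A *marked tessellation* is a tessellation with a distinguished oriented edge (d.o.e.). Each triangle of $\tau^*$ has vertices $\mu(\frac ab),\mu(\frac{a+c}{b+d}),\mu(\frac cd)$ (reduced, $\infty=1/0$ or $-1/0$ according to whether the other vertices are $\ge0$ or $\le0$), with middle vertex $\mu(\frac{a+c}{b+d})$. A *dotted tessellation* is a tessellation with a distinguished corner (dot) in each ideal triangle, which for all but finitely many triangles is the middle vertex of a triangle of $\tau^*$, and a bijection (labeling) from the set of ideal triangles to $\mathbb{Q}^\times$. $Pt$ (resp. $Pt_{\rm dot}$)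 is the category whose objects are the marked (resp. dotted) tessellations, with exactly one morphism $[x,y]$ from any object $x$ to any object $y$; $[y,z]\circ[x,y]=[x,z]$. $M$ is the group of homotopy classes $[\varphi]$ of homeomorphisms $\varphi:\mathbb{D}\to\mathbb{D}$ which extend continuously to $S^1$ and for which $\mu^{-1}\circ\varphi|_{S^1}\circ\mu$ is piecewise-${\rm PSL}(2,\mathbb{Z})$ with finitely many pieces whose endpoints are rational. $M$ acts on marked and dotted tessellations by transporting all the data. **Moves on marked tessellations.** $\alpha$: in the ideal quadrilateral formed by the two triangles adjacent to the d.o.e., replace the d.o.e. by the other diagonal, oriented as obtained by rotating the d.o.e. counterclockwise; this is the new d.o.e. $\beta$: if the triangle to the left of the d.o.e. has vertices $\tau_0,\tau_\infty,\tau_{-1}$ with the d.o.e. from $\tau_0$ to $\tau_\infty$, keep the tessellation and let the new d.o.e. run from $\tau_\infty$ to $\tau_{-1}$. $T=\langle\alpha,\beta\mid(\beta\alpha)^5,\alpha^4,\beta^3,[\beta\alpha\beta,\alpha^2\beta\alpha\beta\alpha^2],[\beta\alpha\beta,\alpha^2\beta\alpha^2\beta\alpha\beta\alpha^2\beta^2\alpha^2]\rangle$ acts on marked tessellations via these moves (words are read from the right); these relators generate all relations among the moves. $[\tau_{\rm mark},\tau'_{\rm mark}]\leadsto g$ means $\tau'_{\rm mark}=g.\tau_{\rm mark}$. **Moves on dotted tessellations** ($j\ne k$ in $\mathbb{Q}^\times$, $\gamma$ a permutation of $\mathbb{Q}^\times$). $A_{[j]}$ moves the dot of triangle $j$ counterclockwise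 to the next corner. $T_{[j][k]}$ applies when the triangles $j,k$ share exactly one side and, with $v_1,v_2,v_3,v_4$ the vertices of their union in counterclockwise order, triangle $j$ is $v_1v_2v_3$ with dot at $v_1$ and triangle $k$ is $v_1v_3v_4$ with dot at $v_4$; it replaces the edge $v_1v_3$ by $v_2v_4$, the new triangle $j$ being $v_1v_2v_4$ with dot at $v_1$ and the new triangle $k$ being $v_2v_3v_4$ with dot at $v_4$. $P_\gamma$ relabels triangle $j$ as $\gamma(j)$ for all $j$, keeping dots. All other data are unchanged. The Kashaev group $K$ has generators $A_{[j]},T_{[j][k]},P_\gamma$ and relations, for mutually distinct $j,k,\ell,m$: $A_{[j]}^3=1$, $T_{[k][\ell]}T_{[j][k]}=T_{[j][k]}T_{[j][\ell]}T_{[k][\ell]}$, $A_{[j]}T_{[j][k]}A_{[k]}=A_{[k]}T_{[k][j]}A_{[j]}$, $T_{[j][k]}A_{[j]}T_{[k][j]}=A_{[j]}A_{[k]}P_{(jk)}$, $P_{\rm id}=1$, $P_{\gamma_1}P_{\gamma_2}=P_{\gamma_1\circ\gamma_2}$, $P_\gamma A_{[j]}=A_{[\gamma(j)]}P_\gamma$, $P_\gamma T_{[j][k]}=T_{[\gamma(j)][\gamma(k)]}P_\gamma$, $T_{[j][k]}T_{[\ell][m]}=T_{[\ell][m]}T_{[j][k]}$, $T_{[j][k]}A_{[\ell]}=A_{[\ell]}T_{[j][k]}$, $A_{[j]}A_{[k]}=A_{[k]}A_{[j]}$. $[\tau_{\rm dot},\tau'_{\rm dot}]\leadsto h$ means $\tau'_{\rm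 dot}=h.\tau_{\rm dot}$, i.e. a word in the generators and inverses representing $h\in K$ can be applied (from the right) to $\tau_{\rm dot}$ with result $\tau'_{\rm dot}$. Every morphism of $Pt$ (resp. $Pt_{\rm dot}$) corresponds in this sense to a unique element of $T$ (resp. $K$). **From $\mathcal{F}$ to ${\bf F}$.** For an $M$-equivariant functor $\mathcal{F}:Pt\to Pt_{\rm dot}$ (one exists and is unique once the image of one object is prescribed), the homomorphism ${\bf F}:T\to K$ constructed from $\mathcal{F}$ is: ${\bf F}(g)=h$ whenever $[\tau_{\rm mark},\tau'_{\rm mark}]\leadsto g$ and $[\mathcal{F}(\tau_{\rm mark}),\mathcal{F}(\tau'_{\rm mark})]\leadsto h$; it is well defined. *)

(* Defs.v *)
From HB Require Import structures.
From mathcomp Require Import all_boot all_order all_algebra.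
From mathcomp Require Import generic_quotient.
From mathcomp Require Import all_classical all_reals all_analysis.
From mathcomp Require Import complex.

Set Implicit Arguments.
Unset Strict Implicit.
Unset Printing Implicit Defensive.

Import Order.TTheory GRing.Theory Num.Theory.
Import numFieldNormedType.Exports.

Local Open Scope classical_set_scope.
Local Open Scope ring_scope.

(* [(x, true)] stands for the generator [x], [(x, false)] for its inverse. *)
Definition word (X : choiceType) : choiceType := seq (X * bool).

Section Words.
Variable X : choiceType.
Implicit Types u v w : word X.

Definition letter (x : X) : word X := [:: (x, true)].
Definition winv w : word X := rev [seq (x.1, ~~ x.2) | x <- w].
Definition wpow w n : word X := flatten (nseq n w).
Definition wcomm u v : word X := u ++ v ++ winv u ++ winv v.

Variable rels : word X -> word X -> Prop.

Inductive pres_eq : word X -> word X -> Prop :=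
| pres_rel u v : rels u v -> pres_eq u v
| pres_cancel x b : pres_eq [:: (x, b); (x, ~~ b)] [::]
| pres_refl u : pres_eq u u
| pres_sym u v : pres_eq u v -> pres_eq v u
| pres_trans u v w : pres_eq u v -> pres_eq v w -> pres_eq u w
| pres_cat u u' v v' : pres_eq u u' -> pres_eq v v' ->
    pres_eq (u ++ v) (u' ++ v').

Lemma pres_winvl w : pres_eq (winv w ++ w) [::].
Proof.
elim: w => [|[x b] w IH]; first exact: pres_refl.
rewrite /winv /= rev_cons cat_rcons.
apply: pres_trans IH; apply: pres_cat; first exact: pres_refl.
have -> : [:: (x, ~~ b), (x, b) & w] = [:: (x, ~~ b); (x, ~~ ~~ b)] ++ w.
  by rewrite negbK.
by apply: (@pres_cat _ [::] w w);
  [exact: pres_cancel | exact: pres_refl].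
Qed.

Lemma winvK : involutive winv.
Proof.
move=> w; rewrite /winv map_rev revK -map_comp -[RHS]map_id.
by apply: eq_map => -[x b] /=; rewrite negbK.
Qed.

Lemma pres_winvr w : pres_eq (w ++ winv w) [::].
Proof. by rewrite -{1}[w]winvK; exact: pres_winvl. Qed.

Lemma pres_winv u v : pres_eq u v -> pres_eq (winv u) (winv v).
Proof.
move=> uv; have := pres_cat (pres_refl (winv u)) (pres_winvr v).
rewrite cats0 => /pres_sym /pres_trans; apply; rewrite catA.
apply: (@pres_trans _ ([::] ++ winv v)); last exact: pres_refl.
apply: pres_cat; last exact: pres_refl.
apply: pres_trans (pres_winvl u).
by apply: pres_cat; [exact: pres_refl | exact: pres_sym].
Qed.

Definition pres_eqb u v : bool := `[< pres_eq u v >].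

Lemma pres_eqb_refl : reflexive pres_eqb.
Proof. by move=> u; apply/asboolP; exact: pres_refl. Qed.

Lemma pres_eqb_sym : symmetric pres_eqb.
Proof. by move=> u v; apply/asboolP/asboolP; exact: pres_sym. Qed.

Lemma pres_eqb_trans : transitive pres_eqb.
Proof.
by move=> v u w /asboolP uv /asboolP vw; apply/asboolP; exact: pres_trans vw.
Qed.

Definition pres_equiv := EquivRel pres_eqb pres_eqb_refl pres_eqb_sym
  pres_eqb_trans.

End Words.

Local Open Scope quotient_scope.

Definition presented (X : choiceType) (rels : word X -> word X -> Prop) :=
  {eq_quot (pres_equiv rels)}.

Section PresentedGroup.
Variables (X : choiceType) (rels : word X -> word X -> Prop).
Local Notation G := (presented rels).

HB.instance Definition _ := Choice.on G.
HB.instance Definition _ := Quotient.on G.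

Definition word_class (w : word X) : G := \pi_G w.

Lemma word_classP u v : word_class u = word_class v <-> pres_eq rels u v.
Proof.
split; first by move/eqmodP/asboolP.
by move=> uv; apply/eqmodP/asboolP.
Qed.

Lemma repr_class (g : G) : word_class (repr g) = g.
Proof. exact: reprK. Qed.

Lemma class_repr w : pres_eq rels (repr (word_class w)) w.
Proof. by apply/word_classP; rewrite repr_class. Qed.

Definition pres_one : G := word_class [::].
Definition pres_mul (g h : G) : G := word_class (repr g ++ repr h).
Definition pres_inv (g : G) : G := word_class (winv (repr g)).

Lemma pres_mulE u v :
  pres_mul (word_class u) (word_class v) = word_class (u ++ v).
Proof. by apply/word_classP/pres_cat; exact: class_repr. Qed.

Lemma pres_invE u : pres_inv (word_class u) = word_class (winv u).
Proof. by apply/word_classP/pres_winv; exact: class_repr. Qed.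

Lemma pres_mulA : associative pres_mul.
Proof.
move=> x y z; rewrite -[x]repr_class -[y]repr_class -[z]repr_class.
by rewrite !pres_mulE catA.
Qed.

Lemma pres_mul1g : left_id pres_one pres_mul.
Proof. by move=> x; rewrite -[x]repr_class pres_mulE. Qed.

Lemma pres_mulg1 : right_id pres_one pres_mul.
Proof. by move=> x; rewrite -[x]repr_class pres_mulE cats0. Qed.

Lemma pres_mulVg : left_inverse pres_one pres_inv pres_mul.
Proof.
move=> x; rewrite -[x]repr_class pres_invE pres_mulE.
by apply/word_classP/pres_winvl.
Qed.

Lemma pres_mulgV : right_inverse pres_one pres_inv pres_mul.
Proof.
move=> x; rewrite -[x]repr_class pres_invE pres_mulE.
by apply/word_classP/pres_winvr.
Qed.

HB.instance Definition _ := isGroup.Build G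
  pres_mulA pres_mul1g pres_mulg1 pres_mulVg pres_mulgV.

End PresentedGroup.

(* [applies step w x y]: the word [w], read from the right, can be applied to
   [x] with result [y], where [step a x y] says that the (possibly partially
   defined) elementary move [a] turns [x] into [y]. *)
Fixpoint applies (X : choiceType) (S : Type) (step : X -> S -> S -> Prop)
    (w : word X) (x y : S) : Prop :=
  if w is (a, b) :: w' then
    exists2 z, applies step w' x z & if b then step a z y else step a y z
  else x = y.

Inductive T_gen := T_alpha | T_beta.
HB.instance Definition _ := gen_eqMixin T_gen.
HB.instance Definition _ := gen_choiceMixin T_gen.

Local Notation al := (letter T_alpha).
Local Notation be := (letter T_beta).

Inductive T_rel : word T_gen -> word T_gen -> Prop :=
| T_pentagon : T_rel (wpow (be ++ al) 5) [::]
| T_alpha4 : T_rel (wpow al 4) [::]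
| T_beta3 : T_rel (wpow be 3) [::]
| T_comm1 : T_rel
    (wcomm (be ++ al ++ be)
           (wpow al 2 ++ be ++ al ++ be ++ wpow al 2)) [::]
| T_comm2 : T_rel
    (wcomm (be ++ al ++ be)
           (wpow al 2 ++ be ++ wpow al 2 ++ be ++ al ++ be ++ wpow al 2 ++
            wpow be 2 ++ wpow al 2)) [::].

Definition groupT : groupType := presented T_rel.

Definition ratx : choiceType := {q : rat | q != 0}.

Definition ratx_perm := {f : ratx -> ratx | bijective f}.
Definition perm_fun (s : ratx_perm) : ratx -> ratx := proj1_sig s.
Coercion perm_fun : ratx_perm >-> Funclass.

Definition perm_id : ratx_perm :=
  exist _ id (@Bijective _ _ id id (fun=> erefl) (fun=> erefl)).

Definition perm_comp (s t : ratx_perm) : ratx_perm :=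
  exist _ (s \o t) (bij_comp (proj2_sig s) (proj2_sig t)).

Definition swap (j k i : ratx) : ratx :=
  if i == j then k else if i == k then j else i.

Lemma swapK j k : involutive (swap j k).
Proof.
rewrite /swap => i; case: (eqVneq i j) => [->|ij].
  by rewrite eqxx; case: eqVneq.
by case: (eqVneq i k) => [->|ik]; rewrite ?eqxx // (negbTE ij) (negbTE ik).
Qed.

Definition perm_swap (j k : ratx) : ratx_perm :=
  exist _ (swap j k) (Bijective (swapK j k) (swapK j k)).

Inductive K_gen :=
| K_A (j : ratx)
| K_T (j k : ratx) of j != k
| K_P (s : ratx_perm).
HB.instance Definition _ := gen_eqMixin K_gen.
HB.instance Definition _ := gen_choiceMixin K_gen.

Local Notation A_ j := (letter (K_A j)).
Local Notation T_ jk := (letter (K_T jk)).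
Local Notation P_ s := (letter (K_P s)).

Inductive K_rel : word K_gen -> word K_gen -> Prop :=
| K_A3 j : K_rel (wpow (A_ j) 3) [::]
| K_pentagon j k l (jk : j != k) (jl : j != l) (kl : k != l) :
    K_rel (T_ kl ++ T_ jk) (T_ jk ++ T_ jl ++ T_ kl)
| K_ATA j k (jk : j != k) (kj : k != j) :
    K_rel (A_ j ++ T_ jk ++ A_ k) (A_ k ++ T_ kj ++ A_ j)
| K_TAT j k (jk : j != k) (kj : k != j) :
    K_rel (T_ jk ++ A_ j ++ T_ kj) (A_ j ++ A_ k ++ P_ (perm_swap j k))
| K_P1 : K_rel (P_ perm_id) [::]
| K_PP (s t : ratx_perm) : K_rel (P_ s ++ P_ t) (P_ (perm_comp s t))
| K_PA (s : ratx_perm) j : K_rel (P_ s ++ A_ j) (A_ (s j) ++ P_ s)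
| K_PT (s : ratx_perm) j k (jk : j != k) (sjk : s j != s k) :
    K_rel (P_ s ++ T_ jk) (T_ sjk ++ P_ s)
| K_TT j k l m (jk : j != k) (lm : l != m) :
    j != l -> j != m -> k != l -> k != m ->
    K_rel (T_ jk ++ T_ lm) (T_ lm ++ T_ jk)
| K_TA j k l (jk : j != k) : j != l -> k != l ->
    K_rel (T_ jk ++ A_ l) (A_ l ++ T_ jk)
| K_AA j k : j != k -> K_rel (A_ j ++ A_ k) (A_ k ++ A_ j).

Definition groupK : groupType := presented K_rel.

(* [R[i]^o] is [R[i]] with the topology of its norm. *)
Local Notation C R := (R[i]^o).

Section Disc.
Variable R : realType.
Implicit Types (x y z : C R) (p q : R -> C R).

Definition disc : set (C R) := [set z | `|z| < 1].
Definition closed_disc : set (C R) := [set z | `|z| <= 1].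
Definition circle : set (C R) := [set z | `|z| = 1].

Definition cplx (a : R) : C R := Complex a 0.

(* [RP^1], with [None] for infinity *)
Definition RP1 := option R.

Definition mu (r : RP1) : C R :=
  if r is Some a then (cplx a - 'i%C) / (cplx a + 'i%C) else 1.

(* [mu (a / b)], with [a / 0] read as infinity *)
Definition mu_frac (a b : int) : C R :=
  mu (if b == 0 then None else Some (a%:~R / b%:~R)).

(* For [b = 0] this forces [a = 1] or [a = -1]. *)
Definition reduced (a b : int) : bool := (0 <= b) && coprimez a b.

Definition mu_rat (r : option rat) : C R := mu (omap ratr r).
Definition rational_points : set (C R) := range mu_rat.

(* [x], [y], [z] are the vertices of a counterclockwise triangle. *)
Definition ccw x y z : Prop := 0 < complex.Im ((z - x) * (y - x)^*).

Definition line_path x y : R -> C R :=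
  fun t => cplx (1 - t) * x + cplx t * y.

Definition chord x y : set (C R) :=
  [set z | exists t : R, 0 < t < 1 /\ z = line_path x y t].

Definition open_triangle x y z : set (C R) :=
  [set w | exists a b c : R, [/\ 0 < a, 0 < b, 0 < c, a + b + c = 1 &
     w = cplx a * x + cplx b * y + cplx c * z]].

(* Only the restriction of [p] to [[0, 1]] is meaningful. *)
Definition disc_path p : Prop :=
  [/\ {within `[0, 1], continuous p},
      circle (p 0), circle (p 1), p 0 <> p 1 &
      forall t, 0 < t < 1 -> disc (p t)].

(* Homotopies of the disc extended by the identity on the circle: the
   endpoints are fixed and the interior of the path stays in the open disc. *)
Definition path_homotopic p q : Prop :=
  exists H : R * R -> C R,
  [/\ {within (`[0, 1] `*` `[0, 1])%classic, continuous H},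
      forall t, 0 <= t <= 1 -> H (0, t) = p t /\ H (1, t) = q t,
      forall s, 0 <= s <= 1 -> H (s, 0) = p 0 /\ H (s, 1) = p 1 &
      forall s t, 0 <= s <= 1 -> 0 < t < 1 -> disc (H (s, t))].

(* [p] and [q] are compared as unoriented paths. *)
Definition arc_class p : set (R -> C R) :=
  [set q | disc_path q /\
     (path_homotopic p q \/ path_homotopic p (fun t => q (1 - t)))].

Definition arc := set (R -> C R).

Definition is_ideal_arc (A : arc) : Prop :=
  exists2 p, disc_path p & A = arc_class p.

Definition ideal_arc x y : arc := arc_class (line_path x y).

Definition endpoints (A : arc) : set (C R) :=
  [set x | exists2 p, A p & x = p 0 \/ x = p 1].

(* Intersections and complements of homotopy classes of paths are understood
   through their hyperbolic geodesics; in the Beltrami-Klein model the geodesic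
   in the class is the straight chord. *)
Definition geodesic (A : arc) : set (C R) :=
  [set z | exists x y, A (line_path x y) /\ chord x y z].

(* An ideal triangle is represented by its set of vertices. *)
Definition is_ideal_triangle (t : set (C R)) : Prop :=
  exists x y z, [/\ circle x, circle y & circle z] /\
    [/\ x <> y, y <> z, x <> z & t = [set x; y; z]].

Definition triangle_region (t : set (C R)) : set (C R) :=
  [set w | exists x y z, t = [set x; y; z] /\ open_triangle x y z w].

Definition edge_complement (E : set arc) : set (C R) :=
  disc `\` \bigcup_(A in E) geodesic A.

Definition triangles (E : set arc) : set (set (C R)) :=
  [set t | is_ideal_triangle t /\ triangle_region t `<=` edge_complement E].

Definition farey_edges : set arc :=
  [set A | exists a b c d : int, [/\ reduced a b, reduced c d,
     `|a * d - b * c| = 1 & A = ideal_arc (mu_frac a b) (mu_frac c d)]].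

(* [t] is a triangle of the Farey tessellation and [v] its middle vertex.  If
   [b = 0] (so [a = 1] or [a = -1] and [d = 1]) then [0 <= a * c] says that the
   sign of the representative [a / 0] of infinity is that of the other two
   vertices [c] and [a + c]. *)
Definition farey_middle (t : set (C R)) (v : C R) : Prop :=
  exists a b c d : int,
  [/\ reduced a b, reduced c d & `|a * d - b * c| = 1] /\
  [/\ b = 0 -> 0 <= a * c, d = 0 -> 0 <= a * c,
      v = mu_frac (a + c) (b + d) &
      t = [set mu_frac a b; v; mu_frac c d]].

Record tessellation (E : set arc) : Prop := {
  tess_arcs : E `<=` is_ideal_arc;
  tess_countable : countable E;
  tess_locally_finite : forall z, disc z -> exists2 U, nbhs z U &
    finite_set [set A | E A /\ geodesic A `&` U !=set0];
  tess_cover :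
    edge_complement E = \bigcup_(t in triangles E) triangle_region t;
  tess_disjoint : trivIset (triangles E) triangle_region;
  tess_vertices : \bigcup_(A in E) endpoints A = rational_points;
  tess_farey : finite_set (E `\` farey_edges)
}.

(* The oriented edge is given by its tail and its head. *)
Record marked_tessellation := MarkedTessellation {
  mt_edges : set arc;
  mt_tail : C R;
  mt_head : C R;
  mt_tess : tessellation mt_edges;
  mt_ends : [/\ circle mt_tail, circle mt_head & mt_tail <> mt_head];
  mt_doe : mt_edges (ideal_arc mt_tail mt_head)
}.

(* [dt_tri j] is the triangle labelled [j] (i.e. the labelling bijection is
   given by its inverse) and [dt_dot j] is its distinguished corner. *)
Record dotted_tessellation := DottedTessellation {
  dt_edges : set arc;
  dt_tri : ratx -> set (C R);
  dt_dot : ratx -> C R;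
  dt_tess : tessellation dt_edges;
  dt_tri_bij : set_bij [set: ratx] (triangles dt_edges) dt_tri;
  dt_dot_in : forall j, dt_tri j (dt_dot j);
  dt_farey : finite_set [set j | ~ farey_middle (dt_tri j) (dt_dot j)]
}.

(* [s], [v], [t], [u] are the vertices, in counterclockwise order, of the
   quadrilateral around the edge from [s] to [t]: rotating it counterclockwise
   brings its head from [t] to [u] and its tail from [s] to [v]. *)
Definition alpha_move (x y : marked_tessellation) : Prop :=
  let s := mt_tail x in
  let t := mt_head x in
  exists u v,
  [/\ triangles (mt_edges x) [set s; t; u], ccw s t u,
      triangles (mt_edges x) [set t; s; v] & ccw t s v] /\
  [/\ mt_edges y =
        (mt_edges x `\ ideal_arc s t) `|` [set ideal_arc v u],
      mt_tail y = v & mt_head y = u].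

Definition beta_move (x y : marked_tessellation) : Prop :=
  let s := mt_tail x in
  let t := mt_head x in
  exists u,
  [/\ triangles (mt_edges x) [set s; t; u], ccw s t u,
      mt_edges y = mt_edges x, mt_tail y = t & mt_head y = u].

Definition mark_move (a : T_gen) : marked_tessellation ->
    marked_tessellation -> Prop :=
  match a with T_alpha => alpha_move | T_beta => beta_move end.

Definition A_move (j : ratx) (x y : dotted_tessellation) : Prop :=
  [/\ dt_edges y = dt_edges x, dt_tri y = dt_tri x,
      forall i, i <> j -> dt_dot y i = dt_dot x i &
      exists a b c, [/\ dt_tri x j = [set a; b; c], ccw a b c,
        dt_dot x j = a & dt_dot y j = b]].

Definition T_move (j k : ratx) (x y : dotted_tessellation) : Prop :=
  exists v1 v2 v3 v4,
  [/\ ccw v1 v2 v3 /\ ccw v1 v3 v4,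
      dt_tri x j = [set v1; v2; v3] /\ dt_dot x j = v1,
      dt_tri x k = [set v1; v3; v4] /\ dt_dot x k = v4 &
      [/\ dt_edges y =
            (dt_edges x `\ ideal_arc v1 v3) `|` [set ideal_arc v2 v4],
          dt_tri y j = [set v1; v2; v4] /\ dt_dot y j = v1,
          dt_tri y k = [set v2; v3; v4] /\ dt_dot y k = v4 &
          forall i, i <> j -> i <> k ->
            dt_tri y i = dt_tri x i /\ dt_dot y i = dt_dot x i]].

Definition P_move (s : ratx_perm) (x y : dotted_tessellation) : Prop :=
  dt_edges y = dt_edges x /\
  forall j, dt_tri y (s j) = dt_tri x j /\ dt_dot y (s j) = dt_dot x j.

Definition dot_move (a : K_gen) : dotted_tessellation ->
    dotted_tessellation -> Prop :=
  match a with
  | K_A j => A_move j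
  | K_T j k _ => T_move j k
  | K_P s => P_move s
  end.

Definition moebius (g : 'M[int]_2) (r : RP1) : RP1 :=
  let a : R := (g 0 0)%:~R in let b : R := (g 0 1)%:~R in
  let c : R := (g 1 0)%:~R in let d : R := (g 1 1)%:~R in
  if r is Some x then
    if c * x + d == 0 then None else Some ((a * x + b) / (c * x + d))
  else if c == 0 then None else Some (a / c).

(* The closed counterclockwise arc of the circle from [x] to [y] *)
Definition circle_arc x y : set (C R) :=
  [set z | [\/ z = x, z = y | ccw x z y]].

(* Each entry of [s] is a piece: its two endpoints and an element of
   PSL(2, Z), given by a lift to SL(2, Z). *)
Definition piecewise_PSL2Z (phi : C R -> C R) : Prop :=
  exists s : seq (option rat * option rat * 'M[int]_2),
    (forall r : RP1, exists2 pc, pc \in s &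
       circle_arc (mu_rat pc.1.1) (mu_rat pc.1.2) (mu r)) /\
    (forall pc, pc \in s -> \det pc.2 = 1 /\
       forall r : RP1, circle_arc (mu_rat pc.1.1) (mu_rat pc.1.2) (mu r) ->
         phi (mu r) = mu (moebius pc.2 r)).

(* Only the restriction of [phi] to the closed disc is meaningful; it is the
   continuous extension of the homeomorphism. *)
Definition M_homeo (phi : C R -> C R) : Prop :=
  [/\ {within closed_disc, continuous phi},
      set_bij disc disc phi,
      exists2 psi : C R -> C R, {within disc, continuous psi} &
        {in disc, cancel phi psi} &
      piecewise_PSL2Z phi].

Definition disc_homotopic (phi psi : C R -> C R) : Prop :=
  exists H : R * C R -> C R,
  [/\ {within (`[0, 1] `*` closed_disc)%classic, continuous H},
      forall z, closed_disc z -> H (0, z) = phi z /\ H (1, z) = psi z,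
      forall s z, 0 <= s <= 1 -> disc z -> disc (H (s, z)) &
      forall s z, 0 <= s <= 1 -> circle z -> H (s, z) = phi z].

(* Only the underlying set of the group of homotopy classes is needed. *)
Definition M_group : set (set (C R -> C R)) :=
  [set m | exists2 phi, M_homeo phi &
     m = [set psi | M_homeo psi /\ disc_homotopic phi psi]].

Definition M_point (m : set (C R -> C R)) (x y : C R) : Prop :=
  exists2 phi, m phi & y = phi x.

Definition M_arc (m : set (C R -> C R)) (A : arc) : arc :=
  [set q | exists phi p, [/\ m phi, A p & arc_class (phi \o p) q]].

Definition M_triangle (m : set (C R -> C R)) (t : set (C R)) : set (C R) :=
  [set y | exists2 x, t x & M_point m x y].

(* [M_marked m x y] and [M_dotted m x y] say that [y = m . x]; stating the
   action as a relation avoids proving first that [m . x] is a tessellation. *)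
Definition M_marked (m : set (C R -> C R)) (x y : marked_tessellation) : Prop :=
  [/\ mt_edges y = M_arc m @` mt_edges x,
      M_point m (mt_tail x) (mt_tail y) & M_point m (mt_head x) (mt_head y)].

Definition M_dotted (m : set (C R -> C R)) (x y : dotted_tessellation) : Prop :=
  dt_edges y = M_arc m @` dt_edges x /\
  forall j, dt_tri y j = M_triangle m (dt_tri x j) /\
            M_point m (dt_dot x j) (dt_dot y j).

End Disc.

Record category := Category {
  ob : Type;
  hom : ob -> ob -> Type;
  idm : forall x, hom x x;
  compm : forall x y z, hom y z -> hom x y -> hom x z;
  compmA : forall w x y z (h : hom y z) (g : hom x y) (f : hom w x),
    compm h (compm g f) = compm (compm h g) f;
  comp1m : forall x y (f : hom x y), compm (idm y) f = f;
  compm1 : forall x y (f : hom x y), compm f (idm x) = f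
}.
Arguments hom {_} _ _.

Record functor (A B : category) := Functor {
  fob : ob A -> ob B;
  fhom : forall x y, hom x y -> hom (fob x) (fob y);
  fhom1 : forall x, fhom (idm x) = idm (fob x);
  fhom_comp : forall x y z (g : hom y z) (f : hom x y),
    fhom (compm g f) = compm (fhom g) (fhom f)
}.

Inductive arrow (S : Type) (x y : S) : Type := Arrow.

Lemma arrow_uniq (S : Type) (x y : S) (f g : arrow x y) : f = g.
Proof. by case: f; case: g. Qed.

Definition codiscrete (S : Type) : category :=
  @Category S (@arrow S) (fun x => Arrow x x) (fun x y z _ _ => Arrow x z)
    (fun _ _ _ _ _ _ _ => arrow_uniq _ _) (fun _ _ _ => arrow_uniq _ _)
    (fun _ _ _ => arrow_uniq _ _).

Definition Pt (R : realType) : category := codiscrete (marked_tessellation R).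
Definition Pt_dot (R : realType) : category :=
  codiscrete (dotted_tessellation R).

(* [[x, y]] leads to [g]: some word representing [g] transforms [x] into [y]. *)
Definition leadsto_T (R : realType) (x y : ob (Pt R)) (f : hom x y)
    (g : groupT) : Prop :=
  exists2 w, word_class T_rel w = g & applies (@mark_move R) w x y.

Definition leadsto_K (R : realType) (x y : ob (Pt_dot R)) (f : hom x y)
    (h : groupK) : Prop :=
  exists2 w, word_class K_rel w = h & applies (@dot_move R) w x y.

Definition M_equivariant (R : realType) (F : functor (Pt R) (Pt_dot R)) : Prop :=
  forall m, M_group m -> forall x y : ob (Pt R),
    M_marked m x y -> M_dotted m (fob F x) (fob F y).

Definition constructed_from (R : realType) (F : functor (Pt R) (Pt_dot R))
    (FF : groupT -> groupK) : Prop :=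
  forall (x y : ob (Pt R)) (f : hom x y) (g : groupT) (h : groupK),
    leadsto_T f g -> leadsto_K (fhom F f) h -> FF g = h.

(* Main.v *)
(* Let tau be the Farey tessellation marked by the edge from 0 to oo.  For each
   generator g of T there is m in M with m . tau = g . tau: for beta it is the
   homography x |-> -(x + 1) / x, and for alpha the map of RP^1 which on the arcs
   [0, 1], [1, oo], [oo, -1], [-1, 0] is the homography onto the next arc; both
   are extended radially to the disc.  Any two dotted tessellations are
   connected by a word in the moves, so some w leads from F2(tau) to F1(tau).
   The moves on dotted tessellations commute with M, so by equivariance w also
   leads from F2(g . tau) = m . F2(tau) to F1(g . tau) = m . F1(tau).  Going
   around the square F2(tau), F1(tau), F1(g . tau), F2(g . tau) gives
   FF2(g) = h^-1 FF1(g) h with h the class of w, for the generators and hence for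
   all g.

   Connectedness: an edge e of a tessellation E which is not a Farey edge is
   crossed by a Farey edge f = (s, t), since a pair of rationals of determinant
   at least 2 is separated by a Farey pair.  Only finitely many edges of E cross
   f, none of them Farey, and one of them is the side opposite to s in a triangle
   of E.  Flipping it lowers the number of edges crossing f; at the last flip f
   itself appears and the number of non-Farey edges has dropped.  Two
   tessellations supported on the Farey tessellation differ by a relabelling and
   by finitely many dots. *)

Require Import Defs.
From mathcomp Require Import all_boot all_order all_algebra.
From mathcomp Require Import all_classical all_reals all_analysis.
From mathcomp Require Import complex ring lra zify.
(* Imported again because mathcomp-analysis also defines [line_path]. *)
Require Import Defs.

Set Implicit Arguments.
Unset Strict Implicit.
Unset Printing Implicit Defensive.

Import Order.TTheory GRing.Theory Num.Theory.
Import numFieldNormedType.Exports.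

Local Open Scope classical_set_scope.
Local Open Scope ring_scope.

Local Notation C R := (R[i]^o).

(** * Orientation and cyclic order on the circle *)

Section Plane.
Variable R : realType.
Implicit Types (x y z w : C R) (s t : R).
Local Notation Re := (@complex.Re R).
Local Notation Im := (@complex.Im R).

(** In the Klein model geodesics are chords, so incidence and crossing are signs of the affine
    function [det3], and on the circle these signs are the cyclic order of the reals [theta]. A
    [tessellation] only asserts that triangle regions partition the complement of the edges; that
    edges do not cross, and that each side of an edge carries exactly one triangle, has to be
    extracted from local finiteness. That the Farey arcs form a tessellation is not checked
    directly: flips preserve tessellations, and some sequence of moves leads from the given dotted
    tessellation to one whose edges are exactly the Farey arcs. Equivariance provides [m . X] only
    for the values of [F1] and [F2], whereas a word of moves passes through other tessellations;
    their images are therefore constructed move by move along the word, in both directions of each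
    move. The same word [w] serves both generators, which is why a single [h] works. *)

Definition det3 x y z : R :=
  (Re y - Re x) * (Im z - Im x) - (Im y - Im x) * (Re z - Re x).

Lemma ccwE x y z : ccw x y z = (0 < det3 x y z).
Proof.
case: x y z => [x1 x2] [y1 y2] [z1 z2]; rewrite /ccw /det3 /=; congr (is_true (_ < _)).
by ring.
Qed.

Lemma det3C x y z : det3 x y z = det3 y z x.
Proof. by rewrite /det3; ring. Qed.

Lemma det3N x y z : det3 y x z = - det3 x y z.
Proof. by rewrite /det3; ring. Qed.

Lemma det3xx x y : (det3 x x y = 0) * (det3 x y x = 0) * (det3 y x x = 0).
Proof. by split; [split|]; rewrite /det3; ring. Qed.

(** Along a segment the orientation is an affine function of the parameter, so it has at most one
    zero unless it vanishes identically; the crossing arguments rest on this. *)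
Lemma det3_line a b x y t :
  det3 a b (line_path x y t) = (1 - t) * det3 a b x + t * det3 a b y.
Proof.
case: a b x y => [a1 a2] [b1 b2] [x1 x2] [y1 y2].
by rewrite /det3 /line_path /cplx /=; ring.
Qed.

Lemma line_path0 x y : line_path x y 0 = x.
Proof.
by case: x y => [x1 x2] [y1 y2]; apply/eqP; rewrite eq_complex /=; apply/andP; split;
  apply/eqP; ring.
Qed.

Lemma line_path1 x y : line_path x y 1 = y.
Proof.
by case: x y => [x1 x2] [y1 y2]; apply/eqP; rewrite eq_complex /=; apply/andP; split;
  apply/eqP; ring.
Qed.

Lemma line_pathC x y t : line_path x y t = line_path y x (1 - t).
Proof.
by case: x y => [x1 x2] [y1 y2]; apply/eqP; rewrite eq_complex /=; apply/andP; split;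
  apply/eqP; ring.
Qed.

Lemma normsqE z : `|z| ^+ 2 = (Re z ^+ 2 + Im z ^+ 2)%:C%C.
Proof.
by rewrite sqr_normc; case: z => a b; apply/eqP; rewrite eq_complex /=; apply/andP; split;
  apply/eqP; ring.
Qed.

Lemma circleE z : circle z <-> Re z ^+ 2 + Im z ^+ 2 = 1.
Proof.
rewrite /circle /=; split => [h|h].
  have := normsqE z; rewrite h expr1n => /eqP; rewrite eq_complex /= => /andP[/eqP + _]; by
    move=> <-.
have /eqP := normsqE z.
rewrite h (_ : 1%:C%C = 1 ^+ 2 :> R[i]); last by rewrite expr1n.
by rewrite eqrXn2 // => /eqP.
Qed.

Lemma discE z : disc z <-> Re z ^+ 2 + Im z ^+ 2 < 1.
Proof.
rewrite /disc /= -(@ltr_pXn2r _ 2) ?nnegrE // normsqE expr1n.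
by rewrite -[1 : R[i]]/(1%:C%C) ltcR.
Qed.

(* The stereographic parameter of a point of the circle other than [1]; it is
   inverse to [mu]. *)
Definition mu_slope s : C R := Complex ((s ^+ 2 - 1) / (s ^+ 2 + 1)) (- (2 * s) / (s ^+ 2 + 1)).

Lemma sqr_add1_gt0 s : 0 < s ^+ 2 + 1.
Proof. by apply: ltr_wpDl; rewrite ?sqr_ge0. Qed.

Lemma sqr_add1_neq0 s : s ^+ 2 + 1 != 0.
Proof. by rewrite gt_eqF ?sqr_add1_gt0. Qed.

Lemma muE (r : RP1 R) : mu r = if r is Some s then mu_slope s else 1.
Proof.
case: r => // s; rewrite /mu /cplx /mu_slope.
have n0 := sqr_add1_neq0 s.
have -> : 'i%C = (0 +i* 1)%C :> R[i] by [].
have e : (s%:C + (0 +i* 1))%C = (s +i* 1)%C :> R[i] by apply/eqP; rewrite eq_complex /= addr0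
  add0r !eqxx.
rewrite e; have d0 : (s +i* 1)%C != 0 :> R[i] by rewrite eq_complex /= oner_eq0 andbF.
apply: (mulIf d0); rewrite divfK //.
by apply/eqP; rewrite eq_complex /=; apply/andP; split; apply/eqP; field.
Qed.

Lemma circle_mu_slope s : circle (mu_slope s).
Proof. by apply/circleE; rewrite /mu_slope /=; field; exact: sqr_add1_neq0. Qed.

Lemma circle_mu (r : RP1 R) : circle (mu r).
Proof.
rewrite muE; case: r => [s|]; first exact: circle_mu_slope.
by apply/circleE => /=; ring.
Qed.

Lemma circleP z : circle z -> exists r : RP1 R, z = mu r.
Proof.
move/circleE => h; case: (eqVneq (Re z) 1) => [e|n].
  exists None; move: h; rewrite e expr1n => h.
  have : Im z = 0 by apply/eqP; rewrite -sqrf_eq0; apply/eqP; lra.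
  by case: z e {h} => a b /= -> ->.
exists (Some (- Im z / (1 - Re z))); rewrite muE /mu_slope.
have n0 : 1 - Re z != 0 by rewrite subr_eq0 eq_sym.
case: z h n n0 => a b /= h n n0.
have e : (- b / (1 - a)) ^+ 2 + 1 = 2 / (1 - a).
  apply: (mulIf n0); apply: (mulIf n0).
  rewrite exprMn sqrrN exprVn.
  have -> : b ^+ 2 = 1 - a ^+ 2 by lra.
  by field.
have e' : (- b / (1 - a)) ^+ 2 - 1 = 2 * a / (1 - a).
  rewrite (_ : (- b / (1 - a)) ^+ 2 - 1 = (- b / (1 - a)) ^+ 2 + 1 - 2); last by ring.
  by rewrite e; field.
rewrite e e'; congr Complex; field; rewrite n0 //=.
Qed.

(** The circle cut open at [1]: the stereographic parameter is squeezed into [(-1, 1)] by an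
    increasing map, and the value [2], beyond all others, stands for the point [1], the image of
    infinity. *)
Definition theta z : R :=
  if Re z == 1 then 2 else
  let s := - Im z / (1 - Re z) in s / (1 + `|s|).

Lemma theta_mu_slope s : theta (mu_slope s) = s / (1 + `|s|).
Proof.
rewrite /theta /mu_slope /=; have n0 := sqr_add1_neq0 s.
have -> : ((s ^+ 2 - 1) / (s ^+ 2 + 1) == 1) = false.
  apply/negP => /eqP /(congr1 ( *%R^~ (s ^+ 2 + 1))); rewrite divfK // => h; lra.
suff -> : - (- (2 * s) / (s ^+ 2 + 1)) / (1 - (s ^+ 2 - 1) / (s ^+ 2 + 1)) = s by [].
field; rewrite n0 /=.
by have -> : s ^+ 2 + 1 - (s ^+ 2 - 1) = 2 by ring.
Qed.

Lemma theta1 : theta 1 = 2.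
Proof. by rewrite /theta /= eqxx. Qed.

Definition cyc (a b c : R) : bool := [|| a < b < c, b < c < a | c < a < b].

Lemma theta_ratio_mono : {mono (fun s => s / (1 + `|s|)) : a b / a < b}.
Proof.
have pos (a : R) : 0 < 1 + `|a| by rewrite ltr_pwDl.
apply: leW_mono; apply: le_mono => a b ab.
rewrite ltr_pdivrMr // mulrAC ltr_pdivlMr //.
have [a0|a0] := lerP 0 a; have [b0|b0] := lerP 0 b; rewrite ?(ger0_norm a0) ?(ger0_norm b0)
  ?(ltr0_norm a0) ?(ltr0_norm b0); nra.
Qed.

Lemma theta_ratio_lt2 s : s / (1 + `|s|) < 2.
Proof.
have pos : 0 < 1 + `|s| by rewrite ltr_pwDl.
rewrite ltr_pdivrMr //; have := ler_norm s; have := normr_ge0 s; lra.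
Qed.

Lemma det3_mu_slope a b c : det3 (mu_slope a) (mu_slope b) (mu_slope c) =
  (4 / ((a ^+ 2 + 1) * (b ^+ 2 + 1) * (c ^+ 2 + 1))) * ((a - b) * (b - c) * (c - a)).
Proof. by rewrite /det3 /mu_slope /=; field; rewrite !sqr_add1_neq0. Qed.

Lemma det3_mu_slope1 b c : det3 1 (mu_slope b) (mu_slope c) =
  (4 / ((b ^+ 2 + 1) * (c ^+ 2 + 1))) * (c - b).
Proof. by rewrite /det3 /mu_slope /=; field; rewrite !sqr_add1_neq0. Qed.

Lemma prod_cyc (a b c : R) : (0 < (a - b) * (b - c) * (c - a)) = cyc a b c.
Proof.
have D (u v : R) : u < v -> 0 < v - u by rewrite subr_gt0.
rewrite /cyc; case: (ltrgtP a b) => ab; case: (ltrgtP b c) => bc;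
  case: (ltrgtP c a) => ca //=; subst;
  rewrite ?subrr ?mul0r ?mulr0 ?ltxx //; try (exfalso; lra).
all: try by apply/negbTE; rewrite -leNgt; nra.
all: have P := mulr_gt0 (mulr_gt0 (D _ _ ab) (D _ _ bc)) (D _ _ ca).
all: by [apply/idP; lra | apply/negbTE; rewrite -leNgt; lra].
Qed.

(** On the circle [det3] is a positive multiple of the product of the differences of the three
    stereographic parameters, or of a single difference if just one of the points is [1]; the sign
    of either expresses a cyclic order. *)
Lemma det3_theta x y z : circle x -> circle y -> circle z ->
  (0 < det3 x y z) = cyc (theta x) (theta y) (theta z).
Proof.
have c2 (a b : R) : (a < b) = cyc 2 (a / (1 + `|a|)) (b / (1 + `|b|)).
  rewrite /cyc theta_ratio_mono; case: ltrP => ab //=.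
    by rewrite theta_ratio_lt2 orbT.
  by rewrite (lt_gtF (theta_ratio_lt2 a)) !andbF.
have h1 b c : (0 < det3 1 (mu_slope b) (mu_slope c)) = cyc 2 (theta (mu_slope b)) (theta
  (mu_slope c)).
  rewrite det3_mu_slope1 !theta_mu_slope pmulr_rgt0; first by rewrite subr_gt0 c2.
  by rewrite divr_gt0 // mulr_gt0 ?sqr_add1_gt0.
have cC (a b c : R) : cyc a b c = cyc b c a by rewrite /cyc orbC -orbA.
move=> /circleP[[a|] ->] /circleP[[b|] ->] /circleP[[c|] ->].
all: rewrite !muE.
- rewrite det3_mu_slope !theta_mu_slope pmulr_rgt0; last first.
    by rewrite divr_gt0 // !mulr_gt0 ?sqr_add1_gt0.
  by rewrite prod_cyc /cyc !theta_ratio_mono.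
- by rewrite -det3C -cC theta1 h1.
- by rewrite det3C cC theta1 h1.
- by rewrite !det3xx theta1 theta_mu_slope /cyc !ltxx !andbF (lt_gtF (theta_ratio_lt2 a))
    !andbF.
- by rewrite theta1 h1.
- by rewrite !det3xx theta1 theta_mu_slope /cyc !ltxx !andbF (lt_gtF (theta_ratio_lt2 b))
    !andbF.
- by rewrite !det3xx theta1 theta_mu_slope /cyc !ltxx !andbF (lt_gtF (theta_ratio_lt2 c))
    !andbF.
- by rewrite !det3xx /cyc !ltxx.
Qed.

Lemma theta_inj x y : circle x -> circle y -> theta x = theta y -> x = y.
Proof.
have tn (a b : R) : a / (1 + `|a|) = b / (1 + `|b|) -> a = b.
  move=> e; case: (ltrgtP a b) => //; by rewrite -theta_ratio_mono e ltxx.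
move=> /circleP[[a|] ->] /circleP[[b|] ->]; rewrite !muE ?theta1 ?theta_mu_slope //.
- by move/tn ->.
- by move=> e; have := theta_ratio_lt2 a; rewrite e ltxx.
- by move=> e; have := theta_ratio_lt2 b; rewrite -e ltxx.
Qed.

End Plane.

(** * Ideal arcs *)

Section Arcs.
Variable R : realType.
Implicit Types (x y z w a b c d : C R) (s t : R).
Local Notation Re := (@complex.Re R).
Local Notation Im := (@complex.Im R).

Lemma line_pathxx x t : line_path x x t = x.
Proof.
by case: x => [x1 x2]; apply/eqP; rewrite eq_complex /=; apply/andP; split; apply/eqP; ring.
Qed.

Lemma line_disc x y t : circle x -> circle y -> x <> y -> 0 < t < 1 ->
  disc (line_path x y t).
Proof.
move=> /circleE cx /circleE cy nxy /andP[t0 t1]; apply/discE.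
have n : 0 < (Re x - Re y) ^+ 2 + (Im x - Im y) ^+ 2.
  rewrite lt_neqAle eq_sym paddr_eq0 ?sqr_ge0 ?addr_ge0 ?sqr_ge0 // andbT.
  rewrite !sqrf_eq0 !subr_eq0; apply/negP => /andP[/eqP e1 /eqP e2].
  by apply: nxy; case: x y e1 e2 {cx cy} => ? ? [? ?] /= -> ->.
case: x y cx cy n {nxy} => x1 x2 [y1 y2] /= cx cy n.
have -> : ((1 - t) * x1 - 0 * x2 + (t * y1 - 0 * y2)) ^+ 2 +
   ((1 - t) * x2 + 0 * x1 + (t * y2 + 0 * y1)) ^+ 2 =
   1 - t * (1 - t) * ((x1 - y1) ^+ 2 + (x2 - y2) ^+ 2) + (1 - t) * (x1 ^+ 2 + x2 ^+ 2 - 1) +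
     t * (y1 ^+ 2 + y2 ^+ 2 - 1) by ring.
have : 0 < t * (1 - t) * ((x1 - y1) ^+ 2 + (x2 - y2) ^+ 2) by rewrite !mulr_gt0 // subr_gt0.
by rewrite cx cy !subrr !mulr0 !addr0 => ?; lra.
Qed.

Lemma disc_convex x y t : disc x -> disc y -> 0 <= t <= 1 -> disc (line_path x y t).
Proof.
move=> /discE cx /discE cy /andP[t0 t1]; apply/discE.
case: x y cx cy => x1 x2 [y1 y2] /= cx cy.
have -> : ((1 - t) * x1 - 0 * x2 + (t * y1 - 0 * y2)) ^+ 2 +
   ((1 - t) * x2 + 0 * x1 + (t * y2 + 0 * y1)) ^+ 2 =
   1 - t * (1 - t) * ((x1 - y1) ^+ 2 + (x2 - y2) ^+ 2) - ((1 - t) * (1 - (x1 ^+ 2 + x2 ^+ 2))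
     + t * (1 - (y1 ^+ 2 + y2 ^+ 2))) by ring.
have : 0 <= t * (1 - t) * ((x1 - y1) ^+ 2 + (x2 - y2) ^+ 2).
  by rewrite !mulr_ge0 ?subr_ge0 ?addr_ge0 ?sqr_ge0.
have : 0 < (1 - t) * (1 - (x1 ^+ 2 + x2 ^+ 2)) + t * (1 - (y1 ^+ 2 + y2 ^+ 2)).
  have [->|t1'] := eqVneq t 1; first lra.
  have A : 0 < 1 - t by rewrite subr_gt0 lt_neqAle t1'.
  apply: ltr_pwDl; first by rewrite mulr_gt0 // subr_gt0.
  by rewrite mulr_ge0 // subr_ge0 ltW.
lra.
Qed.

Lemma cplx_continuous : continuous (@cplx R).
Proof.
move=> u; apply/cvgrPdist_lt => e e0.
have e1 : 0 < Re e by move: e0; rewrite ltcE /= => /andP[].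
have eE : e = (Re e)%:C%C.
  by move: e0; rewrite ltcE /= => /andP[/eqP + _]; case: e {e1} => ? ? /= ->.
near=> v.
have -> : cplx u - cplx v = (u - v)%:C%C :> R[i].
  by apply/eqP; rewrite eq_complex /= subrr !eqxx.
rewrite normc_def /= expr0n addr0 sqrtr_sqr eE ltcR.
by near: v; apply: (cvgrPdist_lt (fun v => v) _).1 => //; exact: cvg_id.
Unshelve. all: by end_near. Qed.

Lemma line_path_cvg (T : Type) (F : set_system T) (FF : Filter F) (f g : T -> C R) (h : T ->
  R) x y t :
  f @ F --> x -> g @ F --> y -> h @ F --> t ->
  (fun v => line_path (f v) (g v) (h v)) @ F --> line_path x y t.
Proof.
move=> cf cg ch.
have c2 : (fun v => cplx (h v)) @ F --> cplx t.
  exact: (@cvg_comp T R (C R) h (@cplx R) F (nbhs t) _ ch (@cplx_continuous t)).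
have c1' : (fun v => 1 - h v) @ F --> 1 - t by apply: cvgB; [exact: cvg_cst | exact: ch].
have c1 : (fun v => cplx (1 - h v)) @ F --> cplx (1 - t).
  exact: (@cvg_comp T R (C R) (fun v => 1 - h v) (@cplx R) F (nbhs (1 - t)) _ c1'
    (@cplx_continuous _)).
apply: (@cvgD _ (C R) T F FF (fun v => cplx (1 - h v) * f v) (fun v => cplx (h v) * g v)).
  exact: (@cvgM _ T F FF (fun v => cplx (1 - h v)) f _ _ c1 cf).
exact: (@cvgM _ T F FF (fun v => cplx (h v)) g _ _ c2 cg).
Qed.

Lemma line_path_continuous x y : continuous (line_path x y).
Proof.
by move=> t; apply: (@line_path_cvg R _ _ (fun=> x) (fun=> y) id); [exact: cvg_cst| exact:
  cvg_cst | exact: cvg_id].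
Qed.

Lemma disc_path_line x y : circle x -> circle y -> x <> y ->
  disc_path (line_path x y).
Proof.
move=> cx cy xy; split; rewrite ?line_path0 ?line_path1 //.
  exact/continuous_subspaceT/line_path_continuous.
by move=> t t01; exact: line_disc.
Qed.

Lemma within_comp (S T U : topologicalType) (A : set S) (B : set T) (f : S -> T) (g : T -> U) :
  {within A, continuous f} -> {within B, continuous g} ->
  (forall v, A v -> B (f v)) -> {within A, continuous (g \o f)}.
Proof.
move=> /subspace_continuousP cf /subspace_continuousP cg AB.
apply/subspace_continuousP => x Ax P /(cg _ (AB _ Ax)).
move=> /(cf x Ax); rewrite /nbhs /= /within /=.
by apply: filterS => y + Ay; apply => //; exact: AB.
Qed.

Lemma itv01 t : `[0, 1]%classic t = (0 <= t <= 1) :> Prop.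
Proof. by rewrite /= in_itv. Qed.

Definition rev_path (q : R -> C R) : R -> C R := fun t => q (1 - t).

Lemma disc_path_rev (q : R -> C R) : disc_path q -> disc_path (rev_path q).
Proof.
move=> [cq q0 q1 q01 qd].
have r0 : rev_path q 0 = q 1 by rewrite /rev_path subr0.
have r1 : rev_path q 1 = q 0 by rewrite /rev_path subrr.
split; rewrite ?r0 ?r1; [ | exact: q1 | exact: q0 | exact: nesym | ]; last first.
  by move=> t /andP[t0 t1]; apply: qd; apply/andP; split; lra.
have c : {within `[0, 1]%classic, continuous (fun t : R => 1 - t)}.
  apply: continuous_subspaceT => t; (apply: cvgB; [exact: cvg_cst | exact: cvg_id]).
apply: (@within_comp R R (C R) (`[0, 1]%classic) (`[0, 1]%classic) (fun t => 1 - t) q c cq).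
by move=> t; rewrite !itv01 => /andP[t0 t1]; apply/andP; split; lra.
Qed.

(** The disc is convex, so the straight-line homotopy stays inside it. *)
Lemma line_homotopic (p q : R -> C R) : disc_path p -> disc_path q -> p 0 = q 0 ->
  p 1 = q 1 -> path_homotopic p q.
Proof.
move=> [cp p0 p1 p01 pd] [cq q0 q1 q01 qd] e0 e1.
have c2 (r : R -> C R) : {within `[0, 1]%classic, continuous r} ->
    {within (`[0, 1] `*` `[0, 1])%classic, continuous (r \o (@snd R R))}.
  move=> cr; apply: (@within_comp (R * R)%type R (C R) (`[0, 1] `*` `[0, 1])%classic (`[0,
    1]%classic) snd r _ cr).
    by apply: continuous_subspaceT => v; exact: cvg_snd.
  by move=> v [].
exists (fun st => line_path (p st.2) (q st.2) st.1); split.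
- apply/subspace_continuousP => -[s t] st01.
  apply: (@line_path_cvg _ _ _ (p \o snd) (q \o snd) fst).
  + by move/subspace_continuousP: (c2 _ cp); exact.
  + by move/subspace_continuousP: (c2 _ cq); exact.
  + by apply: cvg_within_filter; exact: cvg_fst.
- by move=> t _ /=; rewrite line_path0 line_path1.
- move=> s _ /=; rewrite -e0 -e1.
  by rewrite !line_pathxx.
- by move=> s t s01 t01; apply: disc_convex => //; [exact: pd | exact: qd].
Qed.

(** Explicit form of a homotopy class: convexity of the disc leaves the unordered pair of end points
    as its only invariant. *)
Definition arc_of x y : set (R -> C R) :=
  [set q | disc_path q /\ (q 0 = x /\ q 1 = y \/ q 0 = y /\ q 1 = x)].

Lemma arc_ofC x y : arc_of x y = arc_of y x.
Proof. by apply/seteqP; split => q [dq [h|h]]; split; auto. Qed.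

Lemma arc_classE (p : R -> C R) : disc_path p -> arc_class p = arc_of (p 0) (p 1).
Proof.
move=> dp; apply/seteqP; split => q [dq].
  have key q' : path_homotopic p q' -> p 0 = q' 0 /\ p 1 = q' 1.
    move=> [H [_ H0 H1 _]].
    have z01 : 0 <= (0 : R) <= 1 by apply/andP; split; lra.
    have o01 : 0 <= (1 : R) <= 1 by apply/andP; split; lra.
    have [_ <-] := H0 0 z01; have [_ <-] := H0 1 o01.
    by have [-> ->] := H1 1 o01.
  move=> H; split=> //; case: H => /key [] /=; rewrite ?subr0 ?subrr => -> ->; auto.
case=> -[e0 e1]; split => //; [left|right]; apply: line_homotopic => //.
- exact: disc_path_rev.
- by rewrite subr0.
- by rewrite subrr.
Qed.

Lemma ideal_arcE x y : circle x -> circle y -> x <> y ->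
  ideal_arc x y = arc_of x y.
Proof.
move=> cx cy xy; rewrite /ideal_arc arc_classE ?line_path0 ?line_path1 //.
exact: disc_path_line.
Qed.

Lemma ideal_arcC x y : circle x -> circle y -> x <> y -> ideal_arc x y = ideal_arc y x.
Proof. by move=> cx cy xy; rewrite !ideal_arcE // 1?arc_ofC // => /esym. Qed.

Lemma ideal_arc_inj a b x y : circle a -> circle b -> a <> b ->
  circle x -> circle y -> x <> y ->
  ideal_arc a b = ideal_arc x y -> (a = x /\ b = y) \/ (a = y /\ b = x).
Proof.
move=> ca cb ab cx cy xy; rewrite !ideal_arcE // => e.
have : arc_of a b (line_path a b) by split; [exact: disc_path_line | rewrite line_path0
  line_path1; left].
by rewrite e => -[_]; rewrite line_path0 line_path1.
Qed.

Lemma is_ideal_arcP (A : arc R) : is_ideal_arc A -> exists x y,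
  [/\ circle x, circle y, x <> y & A = ideal_arc x y].
Proof.
move=> [p dp ->]; have [_ p0 p1 p01 _] := dp.
by exists (p 0), (p 1); rewrite arc_classE // ideal_arcE.
Qed.

Lemma is_ideal_arc_ideal x y : circle x -> circle y -> x <> y -> is_ideal_arc (ideal_arc x y).
Proof. by move=> *; exists (line_path x y) => //; exact: disc_path_line. Qed.

Lemma endpointsE x y : circle x -> circle y -> x <> y ->
  endpoints (ideal_arc x y) = [set x; y].
Proof.
move=> cx cy xy; apply/seteqP; split => z; rewrite ideal_arcE //=.
  by move=> [p [dp [[<- <-]|[<- <-]]] [|] ->]; auto.
move=> h; exists (line_path x y).
  by split; [exact: disc_path_line | rewrite line_path0 line_path1; left].
by rewrite line_path0 line_path1.
Qed.

Lemma chordC x y : chord x y = chord y x.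
Proof.
apply/seteqP; split => z [t [/andP[t0 t1] ->]]; exists (1 - t); rewrite line_pathC; split => //;
by apply/andP; split; lra.
Qed.

Lemma geodesicE x y : circle x -> circle y -> x <> y ->
  geodesic (ideal_arc x y) = chord x y.
Proof.
move=> cx cy xy; apply/seteqP; split => z; last first.
  move=> cz; exists x, y; split => //; rewrite ideal_arcE //.
  by split; [exact: disc_path_line | rewrite line_path0 line_path1; left].
move=> [a [b []]]; rewrite ideal_arcE // => -[_].
by rewrite line_path0 line_path1 => -[[-> ->]|[-> ->]] //; rewrite chordC.
Qed.

Lemma chord_disc x y : circle x -> circle y -> x <> y -> chord x y `<=` @disc R.
Proof. by move=> cx cy xy z [t [t01 ->]]; exact: line_disc. Qed.

Lemma chord_det x y z : chord x y z -> det3 x y z = 0.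
Proof. by move=> [t [_ ->]]; rewrite det3_line !det3xx !mulr0 addr0. Qed.

End Arcs.

(** * Cyclic order of points of the circle *)

Section CyclicOrder.
Variable R : realType.
Implicit Types x y z w u v a b c d : C R.

(* A decidable form of [ccw]; the two agree on the circle. *)
Definition cc x y z : bool := cyc (theta x) (theta y) (theta z).

Lemma ccwcc x y z : circle x -> circle y -> circle z -> ccw x y z = cc x y z.
Proof. by move=> cx cy cz; rewrite ccwE det3_theta. Qed.

Lemma ccC x y z : cc x y z = cc y z x.
Proof. by rewrite /cc /cyc orbC -orbA. Qed.

Lemma cc_neq x y z : cc x y z -> [/\ x <> y, y <> z & x <> z].
Proof.
by move=> h; split => e; move: h; rewrite e /cc /cyc {e} => /or3P[]/andP[h1 h2]; lra.
Qed.

Lemma cc_total x y z : circle x -> circle y -> circle z -> x <> y -> y <> z ->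
  x <> z -> cc x y z \/ cc x z y.
Proof.
move=> cx cy cz xy yz xz; rewrite /cc /cyc.
case: (ltrgtP (theta x) (theta y)) => [h1|h1|/(theta_inj cx cy)] /=; last by [].
all: case: (ltrgtP (theta y) (theta z)) => [h2|h2|/(theta_inj cy cz)] /=; last by [].
all: case: (ltrgtP (theta x) (theta z)) => [h3|h3|/(theta_inj cx cz)] /=; last by [].
all: clear xy yz xz; rewrite ?orbT; auto; exfalso; lra.
Qed.

Lemma cyc_trans (a b c d : R) : cyc a b c -> cyc a c d -> cyc a b d && cyc b c d.
Proof.
move=> /or3P[]/andP[h1 h2] /or3P[]/andP[h3 h4]; try (exfalso; lra); apply/andP; split;
  apply/or3P;
solve [apply: Or31; apply/andP; split; lra | apply: Or32; apply/andP; split; lra | apply: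
  Or33; apply/andP; split; lra].
Qed.

(** Two triangles on opposite sides of the diagonal [x z] form a convex quadrilateral; the
    conclusion is its division by the other diagonal [y w]. *)
Lemma cc_trans x y z w : cc x y z -> cc x z w -> cc x y w /\ cc y z w.
Proof. by move=> h1 h2; apply/andP; exact: cyc_trans. Qed.

End CyclicOrder.

(* Cyclic order facts are decided by comparing the values of [theta]. *)
Ltac cyc_lra :=
  unfold cc in *; repeat match goal with H : is_true (cyc _ _ _) |- _ =>
    move: H => /or3P[]/andP[? ?] end;
  try (exfalso; lra);
  try (apply/or3P; solve [apply: Or31; apply/andP; split; lra
     | apply: Or32; apply/andP; split; lra
     | apply: Or33; apply/andP; split; lra]).

(** * Straight triangles as intersections of half-planes *)

Section Triangles.
Variable R : realType.
Implicit Types (x y z w u v a b c d : C R) (s t : R).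
Local Notation Re := (@complex.Re R).
Local Notation Im := (@complex.Im R).

Lemma complex_ext x y : Re x = Re y -> Im x = Im y -> x = y.
Proof. by case: x y => ? ? [? ?] /= -> ->. Qed.

Lemma chordP x y z : circle x -> circle y -> x <> y -> disc z -> det3 x y z = 0 -> chord x y z.
Proof.
move=> /circleE cx /circleE cy nxy /discE dz h.
have n : 0 < (Re y - Re x) ^+ 2 + (Im y - Im x) ^+ 2.
  rewrite lt_neqAle eq_sym paddr_eq0 ?sqr_ge0 ?addr_ge0 ?sqr_ge0 // andbT.
  rewrite !sqrf_eq0 !subr_eq0; apply/negP => /andP[/eqP e1 /eqP e2].
  by apply: nxy; exact: complex_ext.
have n' := lt0r_neq0 n; move: h; rewrite /det3 => h.
(* The parameter of the orthogonal projection of [z] to the line through [x] and [y]; collinearity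
   makes [z] equal to its projection. *)
pose t := ((Re z - Re x) * (Re y - Re x) + (Im z - Im x) * (Im y - Im x)) /
  ((Re y - Re x) ^+ 2 + (Im y - Im x) ^+ 2).
have tE : t * ((Re y - Re x) ^+ 2 + (Im y - Im x) ^+ 2) = ((Re z - Re x) * (Re y - Re x) +
  (Im z - Im x) * (Im y - Im x)) by rewrite divfK.
have e1 : Re z = Re x + t * (Re y - Re x).
  apply: (mulIf n'); rewrite mulrDl mulrAC tE; move/(congr1 ( *%R (Im y - Im x))): h; lra.
have e2 : Im z = Im x + t * (Im y - Im x).
  apply: (mulIf n'); rewrite mulrDl mulrAC tE; move/(congr1 ( *%R (Re y - Re x))): h; lra.
(* Both ends have norm [1], so lying inside the disc amounts to [0 < t * (1 - t)]. *)
have e3 : Re z ^+ 2 + Im z ^+ 2 = 1 - (t * (1 - t)) * ((Re y - Re x) ^+ 2 + (Im y - Im x) ^+ 2).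
  have -> : Re z ^+ 2 + Im z ^+ 2 = (1 - t) * (Re x ^+ 2 + Im x ^+ 2) + t * (Re y ^+ 2 + Im y
    ^+ 2) - (t * (1 - t)) * ((Re y - Re x) ^+ 2 + (Im y - Im x) ^+ 2).
    by rewrite e1 e2; ring.
  by rewrite cx cy; ring.
have : 0 < t * (1 - t) by rewrite -(pmulr_lgt0 _ n); lra.
move=> tt; exists t; split.
  by apply/andP; split; nra.
by apply: complex_ext; rewrite /line_path /cplx; [rewrite e1|rewrite e2]; case: (x) (y) => ?
  ? [? ?] /=; ring.
Qed.

Lemma det3_bary (p q r : R) a b x y z : p + q + r = 1 ->
  det3 a b (cplx p * x + cplx q * y + cplx r * z) = p * det3 a b x + q * det3 a b y + r *
    det3 a b z.
Proof.
move=> h; have -> : p = 1 - q - r by lra.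
by case: a b x y z => [? ?] [? ?] [? ?] [? ?] [? ?]; rewrite /det3 /cplx /=; ring.
Qed.

Lemma det3_sum x y z w : det3 x y w + det3 y z w + det3 z x w = det3 x y z.
Proof. by rewrite /det3; ring. Qed.

(** The barycentric coordinates of [w] are the ratios of the three signed areas spanned with [w] to
    the area of the whole triangle. *)
Lemma open_triangleP x y z w : 0 < det3 x y z ->
  open_triangle x y z w <-> [/\ 0 < det3 x y w, 0 < det3 y z w & 0 < det3 z x w].
Proof.
move=> D; have d1 : det3 y z x = det3 x y z by rewrite [RHS]det3C.
have d2 : det3 z x y = det3 x y z by rewrite det3C.
split.
  move=> [p [q [r [p0 q0 r0 e ->]]]]; rewrite !det3_bary // !det3xx !(mulr0, add0r, addr0) d1
    d2.
  by split; exact: mulr_gt0.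
move=> [h1 h2 h3]; have s := det3_sum x y z w; have n := lt0r_neq0 D.
exists (det3 y z w / det3 x y z), (det3 z x w / det3 x y z), (det3 x y w / det3 x y z).
split; rewrite ?divr_gt0 //.
  by rewrite -!mulrDl (_ : _ + _ = det3 x y z) ?divff // -s; ring.
have r : Re w = det3 y z w / det3 x y z * Re x + det3 z x w / det3 x y z * Re y + det3 x y w
  / det3 x y z * Re z.
  rewrite ![_ / _ * _]mulrAC -!mulrDl; apply: (mulIf n); rewrite divfK //; rewrite /det3; ring.
have i : Im w = det3 y z w / det3 x y z * Im x + det3 z x w / det3 x y z * Im y + det3 x y w
  / det3 x y z * Im z.
  rewrite ![_ / _ * _]mulrAC -!mulrDl; apply: (mulIf n); rewrite divfK //; rewrite /det3; ring.
move: r i; move: (_ / _) (_ / _) (_ / _) => p q k r i.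
by apply: complex_ext; rewrite ?r ?i /cplx; case: x y z {D h1 h2 h3 s n d1 d2 r i} => [? ?]
  [? ?] [? ?] /=; ring.
Qed.

Lemma open_triangleC x y z : open_triangle x y z = open_triangle y z x.
Proof.
by apply/seteqP; split => w [p [q [r [p0 q0 r0 e ->]]]]; [exists q, r, p | exists r, p, q];
  split => //; rewrite -?e; ring.
Qed.

Lemma open_triangleS x y z : open_triangle x y z = open_triangle y x z.
Proof.
by apply/seteqP; split => w [p [q [r [p0 q0 r0 e ->]]]]; exists q, p, r; split => //; rewrite
  -?e; ring.
Qed.

Lemma set3C x y z : [set x; y; z] = [set y; z; x].
Proof. by apply/seteqP; split => v /= [[]|] ->; auto. Qed.

Lemma set3S x y z : [set x; y; z] = [set y; x; z].
Proof. by apply/seteqP; split => v /= [[]|] ->; auto. Qed.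

(** Two enumerations of a three-element set differ by a permutation, and a rotation and a
    transposition generate them all. *)
Lemma set3_perm (P : C R -> C R -> C R -> Prop) a b c x y z :
  x <> y -> y <> z -> x <> z ->
  a <> b -> b <> c -> a <> c -> [set a; b; c] = [set x; y; z] ->
  (forall u v w, P u v w -> P v w u) -> (forall u v w, P u v w -> P v u w) ->
  P a b c -> P x y z.
Proof.
move=> xy yz xz ab bc ac e PC PS P0.
have P1 := PC _ _ _ P0; have P2 := PC _ _ _ P1.
have Q0 := PS _ _ _ P0; have Q1 := PC _ _ _ Q0; have Q2 := PC _ _ _ Q1.
have : [set x; y; z] a by rewrite -e /=; auto.
have : [set x; y; z] b by rewrite -e /=; auto.
have : [set x; y; z] c by rewrite -e /=; auto.
case=> [[]|] /= ec; case=> [[]|] /= eb; case=> [[]|] /= ea; clear e; subst; first [assumption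
  | by case: ab | by case: bc | by case: ac].
Qed.

Lemma triangle_regionE x y z : x <> y -> y <> z -> x <> z ->
  triangle_region [set x; y; z] = open_triangle x y z.
Proof.
move=> xy yz xz; apply/seteqP; split => w; last by move=> h; exists x, y, z.
move=> [a [b [c [e h]]]].
have [ab|ab] := EM (a = b).
  exfalso; subst b; have : [set a; a; c] x by rewrite -e /=; auto.
  have : [set a; a; c] y by rewrite -e /=; auto.
  have : [set a; a; c] z by rewrite -e /=; auto.
  by case=> [[]|] /= ez; case=> [[]|] /= ey; case=> [[]|] /= ex; congruence.
have [bc|bc] := EM (b = c).
  exfalso; subst b; have : [set a; c; c] x by rewrite -e /=; auto.
  have : [set a; c; c] y by rewrite -e /=; auto.
  have : [set a; c; c] z by rewrite -e /=; auto.
  by case=> [[]|] /= ez; case=> [[]|] /= ey; case=> [[]|] /= ex; congruence.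
have [ac|ac] := EM (a = c).
  exfalso; subst c; have : [set a; b; a] x by rewrite -e /=; auto.
  have : [set a; b; a] y by rewrite -e /=; auto.
  have : [set a; b; a] z by rewrite -e /=; auto.
  by case=> [[]|] /= ez; case=> [[]|] /= ey; case=> [[]|] /= ex; congruence.
apply: (@set3_perm (fun x y z => open_triangle x y z w) a b c) => //.
- by move=> ? ? ?; rewrite open_triangleC.
- by move=> ? ? ?; rewrite open_triangleS.
Qed.

End Triangles.

(** * Tessellations *)

Section Tess.
Variable R : realType.
Implicit Types (x y z w u v a b c d p q n : C R) (s t e : R).
Local Notation Re := (@complex.Re R).
Local Notation Im := (@complex.Im R).

(** Used to move slightly from one point towards another without leaving finitely many open
    half-planes. *)
Lemma small_affine (s : seq (R * R)) (d : R) : 0 < d -> all (fun pq => 0 < pq.1) s ->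
  exists2 e, 0 < e < d & all (fun pq => 0 < (1 - e) * pq.1 + e * pq.2) s.
Proof.
move=> d0 h.
suff [e [e0 ed H]] : exists e, [/\ 0 < e, e < d & forall e', 0 < e' <= e ->
    all (fun pq => 0 < (1 - e') * pq.1 + e' * pq.2) s].
  by exists e; [apply/andP | apply: H; apply/andP].
elim: s h => [|[p q] s IH] /= => [_|/andP[p0 /IH [e [e0 ed H]]]].
  by exists (d / 2); split => //; lra.
(* For [e'] at most [k] the value [p - e' * p - e' * |q|] is still at least [e'], hence positive. *)
pose k := p / (p + `|q| + 1).
have D : 0 < p + `|q| + 1 by have := normr_ge0 q; lra.
have k0 : 0 < k by rewrite divr_gt0.
have k1 : k * (p + `|q| + 1) = p by rewrite divfK ?gt_eqF.
exists (Num.min e k); split; rewrite ?lt_min ?e0 ?k0 ?gt_min ?ed //.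
move=> e'; rewrite le_min => /and3P[e1 e2 e3]; rewrite H ?e1 ?e2 // andbT.
have l1 : e' * (p + `|q| + 1) <= p by rewrite -[leRHS]k1 ler_pM2r.
have l2 : e' * - q <= e' * `|q| by rewrite ler_pM2l // -normrN ler_norm.
lra.
Qed.

Lemma affine_between (e e' p q : R) : 0 <= e' < e -> 0 < p ->
  0 < (1 - e) * p + e * q -> 0 < (1 - e') * p + e' * q.
Proof.
move=> /andP[e0 ee'] p0 h; have e1 : 0 < e by exact: le_lt_trans ee'.
rewrite -(pmulr_rgt0 _ e1).
have -> : e * ((1 - e') * p + e' * q) = (e - e') * p + e' * ((1 - e) * p + e * q) by ring.
by apply: ltr_pwDl; [rewrite mulr_gt0 // subr_gt0 | rewrite mulr_ge0 // ltW].
Qed.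

Lemma line_path_sub x y s t :
  line_path (line_path x y s) y t = line_path x y (s + t * (1 - s)).
Proof. by apply: complex_ext; case: x y => [? ?] [? ?] /=; ring. Qed.

Lemma line_path_tri x y z s t : 0 < s < 1 -> 0 < t < 1 ->
  open_triangle x y z (line_path (line_path x y s) z t).
Proof.
move=> /andP[s0 s1] /andP[t0 t1].
exists ((1 - t) * (1 - s)), ((1 - t) * s), t; split => //; rewrite ?mulr_gt0 ?subr_gt0 //;
  first by ring.
by apply: complex_ext; case: x y z => [? ?] [? ?] [? ?] /=; ring.
Qed.

Lemma near_line w n (U : set (C R)) : nbhs w U ->
  exists2 d : R, 0 < d & forall e, 0 <= e < d -> U (line_path w n e).
Proof.
move=> wU; have := @line_path_continuous R w n 0 U; rewrite line_path0 => /(_ wU).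
rewrite /= => /nbhs_ballP[d /= d0 h]; exists d => // e /andP[e0 ed]; apply: h.
by rewrite /ball /= sub0r normrN ger0_norm.
Qed.

Lemma exists_left x y : circle x -> circle y -> x <> y ->
  exists2 u, circle u & cc x y u.
Proof.
move=> /circleP[[a|] ->] /circleP[[b|] ->]; rewrite !muE => ab.
- case: (ltrgtP a b) => [h|h|h]; last by rewrite h in ab.
    exists 1; first by rewrite -(muE None); exact: circle_mu.
    by rewrite /cc /cyc theta1 !theta_mu_slope !theta_ratio_mono h theta_ratio_lt2.
  exists (mu_slope ((a + b) / 2)); first exact: circle_mu_slope.
  by rewrite /cc /cyc !theta_mu_slope !theta_ratio_mono; apply/or3P; apply: Or32; apply/andP;
    split; lra.
- exists (mu_slope (a - 1)); first exact: circle_mu_slope.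
  rewrite /cc /cyc theta1 !theta_mu_slope !theta_ratio_mono !theta_ratio_lt2 (_ : a - 1 < a)
    ?orbT //; lra.
- exists (mu_slope (b + 1)); first exact: circle_mu_slope.
  rewrite /cc /cyc theta1 !theta_mu_slope !theta_ratio_mono !theta_ratio_lt2 (_ : b < b + 1)
    ?orbT //; lra.
- by [].
Qed.

Lemma det3_neq0 x y z : circle x -> circle y -> circle z -> x <> y -> y <> z -> x <> z ->
  det3 x y z != 0.
Proof.
move=> cx cy cz xy yz xz; case: (cc_total cx cy cz xy yz xz); rewrite -ccwcc // ccwE => h.
  by rewrite gt_eqF.
by rewrite det3C det3N oppr_eq0 -det3C gt_eqF.
Qed.

Definition edge (E : set (arc R)) x y :=
  [/\ circle x, circle y, x <> y & E (ideal_arc x y)].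

Lemma edgeC E x y : edge E x y -> edge E y x.
Proof. by move=> [cx cy xy e]; split => //; [exact: nesym | rewrite -ideal_arcC]. Qed.

Lemma chord_inter x y a b s t : circle x -> circle y -> x <> y ->
  circle a -> circle b -> a <> b -> s <> t ->
  chord a b (line_path x y s) -> chord a b (line_path x y t) ->
  ideal_arc a b = ideal_arc x y.
Proof.
move=> cx cy xy ca cb ab st /chord_det + /chord_det; rewrite !det3_line => h1 h2.
have st' : s - t != 0 by rewrite subr_eq0; apply/eqP.
have e1 : det3 a b x = 0.
  apply: (mulfI st'); rewrite mulr0; move/(congr1 ( *%R s)): h2; move/(congr1 ( *%R t)): h1;
    lra.
have e2 : det3 a b y = 0.
  apply: (mulfI st'); rewrite mulr0; move/(congr1 ( *%R (1 - s))): h2; move/(congr1 ( *%R (1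
    - t))): h1; lra.
have key v : circle v -> det3 a b v = 0 -> v = a \/ v = b.
  move=> cv h; have [->|va] := EM (v = a); first by left.
  have [->|vb] := EM (v = b); first by right.
  by have := det3_neq0 ca cb cv ab (nesym vb) (nesym va); rewrite h eqxx.
case: (key x cx e1) => ex; case: (key y cy e2) => ey; subst; [by case: xy | by [] | by
  rewrite ideal_arcC // | by case: xy].
Qed.

Section Tessellation.
Variable E : set (arc R).
Hypothesis tE : tessellation E.

(** Near the midpoint of the chord only finitely many edges occur, and each of them other than the
    chord itself meets it in at most one point. Hence some point [w] of the chord avoids them, and
    so does a short segment from [w] in any direction. *)
Lemma tess_generic x y : circle x -> circle y -> x <> y ->
  exists w, [/\ chord x y w, forall A, E A -> geodesic A w -> A = ideal_arc x y &
   forall n, disc n -> exists2 d : R, 0 < d & forall e, 0 <= e < d ->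
     forall A, E A -> geodesic A (line_path w n e) -> A = ideal_arc x y].
Proof.
move=> cx cy xy.
have half : 0 < (2^-1 : R) < 1 by apply/andP; split; lra.
have dm := line_disc cx cy xy half; set m := line_path x y 2^-1 in dm.
have [U mU /finite_seqP[S eS]] := tess_locally_finite tE dm.
have [V [oV Vm VU]] : exists V : set (C R), [/\ open V, V m & V `<=` U].
  by exists (interior U); split; [exact: open_interior | exact: nbhs_singleton (nbhs_interior
    mU) | exact: interior_subset].
have [d d0 dV] := @near_line m y V (open_nbhs_nbhs (conj oV Vm)).
(* The interval is halved once for each nearby edge: an edge meets the chord at most once, so one of
   the two open halves is free of it. *)
have [l [r [h0l lr r1 H]]] : exists l r, [/\ 2^-1 < l, l < r, r < 1 /\ r < 2^-1 + d / 2 &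
   forall A, A \in S -> A <> ideal_arc x y -> forall t, l < t < r -> ~ geodesic A (line_path
     x y t)].
  have : forall A, A \in S -> is_ideal_arc A.
    move=> A AS; have : [set` S] A by [].
    by rewrite -eS => -[/(tess_arcs tE)].
  elim: (S) => [|A S' IH] hS.
    exists (2^-1 + Num.min 1 d / 8), (2^-1 + Num.min 1 d / 4).
    have : 0 < Num.min 1 d by rewrite lt_min ltr01.
    have : Num.min 1 d <= 1 by rewrite ge_min lexx.
    have : Num.min 1 d <= d by rewrite ge_min lexx orbT.
    by split => //; [lra | lra | split; lra].
  case: IH => [A' h|l [r [h0l lr [r1 r2] H]]]; first by apply: hS; rewrite in_cons h orbT.
  have [AE|AE] := EM (A = ideal_arc x y).
    exists l, r; split => // A'; rewrite in_cons => /orP[/eqP ->|]; [by [] | exact: H].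
  have [k lk kr] : exists2 k, l < k & k < r by exists ((l + r) / 2); lra.
  have [a [b [ca cb ab eA]]] := is_ideal_arcP (hS A (mem_head _ _)).
  have [[t [tl tr]]|no] := EM (exists t, (l < t < k) /\ geodesic A (line_path x y t)).
    exists k, r; split => //; first exact: lt_trans lk.
    move=> A'; rewrite in_cons => /orP[/eqP -> _ t' kt' g|/H h n t' /andP[t1 t2]]; last first.
      by apply: h => //; rewrite t2 (lt_trans lk).
    apply: AE; move: tr g; rewrite eA geodesicE // => tr g.
    apply: (@chord_inter x y a b t t') => //.
    move=> ett; move: tl kt'; rewrite ett => /andP[_ h1] /andP[h2 _].
    by have := lt_trans h1 h2; rewrite ltxx.
  exists l, k; split => //; first by split; apply: lt_trans kr _.
  move=> A'; rewrite in_cons => /orP[/eqP -> _ t' kt' g|/H h n t' /andP[t1 t2]].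
    by apply: no; exists t'.
  by apply: h => //; rewrite t1 (lt_trans t2).
case: r1 => r1 r2; pose t := (l + r) / 2; have tlr : l < t < r by rewrite /t; apply/andP;
  split; lra.
have t01 : 0 < t < 1 by rewrite /t; apply/andP; split; lra.
pose w := line_path x y t.
have Vw : V w.
  have -> : w = line_path m y (2 * (t - 2^-1)).
    by rewrite /w /m line_path_sub; congr line_path; field.
  by apply: dV; rewrite /t; apply/andP; split; lra.
have cw : chord x y w by exists t.
(* An edge that misses [w] has [w] strictly on one side of its line, and this persists for a while
   on the way to [n]. *)
have P n : disc n -> exists2 d : R, 0 < d & forall e, 0 <= e < d ->
     forall A, E A -> geodesic A (line_path w n e) -> A = ideal_arc x y.
  move=> dn.
  have [d1 d10 d1V] := @near_line w n V (open_nbhs_nbhs (conj oV Vw)).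
  have [d2 d20 d2V] : exists2 d : R, 0 < d & forall e, 0 <= e < d ->
     forall A, A \in S -> geodesic A (line_path w n e) -> A = ideal_arc x y.
    have : forall A, A \in S -> is_ideal_arc A.
      move=> A AS; have : [set` S] A by [].
      by rewrite -eS => -[/(tess_arcs tE)].
    elim: (S) H => [|A S' IH] H hS; first by exists 1.
    case: IH => [A' h|A' h|d2 d20 d2V]; [by apply: H; rewrite in_cons h orbT | by apply: hS;
      rewrite in_cons h orbT |].
    have [AE|AE] := EM (A = ideal_arc x y).
      by exists d2 => // e h A'; rewrite in_cons => /orP[/eqP ->|]; [by [] | exact: d2V].
    have [a [b [ca cb ab eA]]] := is_ideal_arcP (hS A (mem_head _ _)).
    have nz : det3 a b w != 0.
      apply/eqP => z; apply: (H A (mem_head _ _) AE t tlr).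
      rewrite eA geodesicE //; apply: chordP => //; exact: line_disc.
    have [e /andP[e0 ed2] He] : exists2 e, 0 < e < d2 & forall e', 0 <= e' < e -> det3 a b
      (line_path w n e') != 0.
      move: nz; rewrite neq_lt => /orP[] nz.
        have [//|e h /=] := @small_affine [:: (- det3 a b w, - det3 a b n)] d2 d20; first by
          rewrite /= oppr_gt0 nz.
        rewrite andbT => h2; exists e => // e' e1'; rewrite det3_line lt_eqF // -oppr_gt0
          opprD -!mulrN.
        by apply: (affine_between e1') => //; rewrite oppr_gt0.
      have [//|e h /=] := @small_affine [:: (det3 a b w, det3 a b n)] d2 d20; first by
        rewrite /= nz.
      rewrite andbT => h2; exists e => // e' e1'; rewrite det3_line gt_eqF //.
      exact: (affine_between e1').
    exists e => // e' he A'; rewrite in_cons => /orP[/eqP ->|A'S].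
      by rewrite eA geodesicE // => /chord_det /eqP; rewrite (negbTE (He _ he)).
    by apply: d2V => //; move: he => /andP[? ?]; apply/andP; split; lra.
  exists (Num.min d1 d2); first by rewrite lt_min d10.
  move=> e /andP[e0]; rewrite lt_min => /andP[e1 e2] A EA gA.
  apply: (d2V e) => //; first by apply/andP.
  have : [set` S] A; last by [].
  rewrite -eS; split => //; exists (line_path w n e); split => //.
  by apply: VU; apply: d1V; apply/andP.
exists w; split => // A EA gA.
have [d' d'0 h] := P m dm.
by apply: (h 0) => //; rewrite ?line_path0 // lexx.
Qed.

End Tessellation.
End Tess.

(** * Edges and triangles of a tessellation *)

Section TessTheory.
Variable R : realType.
Implicit Types (x y z w u v a b c d p q n : C R) (s t e : R).
Local Notation Re := (@complex.Re R).
Local Notation Im := (@complex.Im R).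

Lemma cc_ccw x y z : circle x -> circle y -> circle z -> cc x y z = (0 < det3 x y z).
Proof. by move=> cx cy cz; rewrite /cc -det3_theta. Qed.

Lemma triP (T : set (C R)) : is_ideal_triangle T ->
  exists a b c, [/\ circle a, circle b & circle c] /\ T = [set a; b; c] /\ cc a b c.
Proof.
move=> [x [y [z [[cx cy cz] [xy yz xz ->]]]]].
case: (cc_total cx cy cz xy yz xz) => h; first by exists x, y, z.
by exists y, x, z; split => //; rewrite set3S ccC.
Qed.

Lemma ideal_triangle_cc x y z : circle x -> circle y -> circle z -> cc x y z ->
  is_ideal_triangle [set x; y; z].
Proof. by move=> cx cy cz /cc_neq[xy yz xz]; exists x, y, z. Qed.

Lemma region_cc x y z w : circle x -> circle y -> circle z -> cc x y z ->
  triangle_region [set x; y; z] w <-> [/\ 0 < det3 x y w, 0 < det3 y z w & 0 < det3 z x w].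
Proof.
move=> cx cy cz h; have [xy yz xz] := cc_neq h.
by rewrite triangle_regionE // open_triangleP // -cc_ccw.
Qed.

Lemma left_point x y : circle x -> circle y -> x <> y ->
  exists n, disc n /\ 0 < det3 x y n.
Proof.
move=> cx cy xy; have [u cu h] := exists_left cx cy xy; have [_ yu xu] := cc_neq h.
have half : 0 < (2^-1 : R) < 1 by apply/andP; split; lra.
exists (line_path x u 2^-1); split; first exact: line_disc.
by rewrite det3_line !det3xx mulr0 add0r mulr_gt0 ?invr_gt0 // -cc_ccw.
Qed.

Lemma affine_zero (e P Q : R) : 0 <= e -> P <= 0 -> 0 < (1 - e) * P + e * Q ->
  exists2 f, 0 <= f <= e & (1 - f) * P + f * Q = 0.
Proof.
move=> e0 P0; have -> : (1 - e) * P + e * Q = P + e * (Q - P) by ring.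
move=> h; have eD : 0 < e * (Q - P) by lra.
have D : 0 < Q - P by rewrite ltNge; apply/negP => h'; move: eD; rewrite ltNge mulr_ge0_le0.
have D' := lt0r_neq0 D; exists (- P / (Q - P)).
  apply/andP; split; first by rewrite divr_ge0 ?oppr_ge0 // ltW.
  by rewrite ler_pdivrMr //; lra.
rewrite (_ : (1 - - P / (Q - P)) * P + - P / (Q - P) * Q = P + - P / (Q - P) * (Q - P)); last
  by ring.
by rewrite divfK // subrr.
Qed.

Section Tessellation.
Variable E : set (arc R).
Hypothesis tE : tessellation E.

Lemma open_meet a b c w n : circle a -> circle b -> circle c -> cc a b c ->
  triangle_region [set a; b; c] w ->
  exists2 e, 0 < e < 1 & triangle_region [set a; b; c] (line_path w n e).
Proof.
move=> ca cb ccc h /region_cc[] // h1 h2 h3.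
have [|e e01] := @small_affine R [:: (det3 a b w, det3 a b n); (det3 b c w, det3 b c n);
  (det3 c a w, det3 c a n)] 1 ltr01.
  by rewrite /= h1 h2 h3.
rewrite /= andbT => /and3P[k1 k2 k3]; exists e => //.
by apply/region_cc => //; rewrite !det3_line.
Qed.

Lemma compl_region w : edge_complement E w -> exists a b c,
  [/\ circle a, circle b & circle c] /\
  [/\ cc a b c, triangles E [set a; b; c] & triangle_region [set a; b; c] w].
Proof.
rewrite (tess_cover tE) => -[T tT rT]; have [iT _] := tT.
by have [a [b [c [ca [e h]]]]] := triP iT; exists a, b, c; subst T.
Qed.

(** If the side [x y] were not an edge, a generic point of it would lie in the open region of some
    triangle. A small step towards [z] enters the region of [x y z] without leaving the other one,
    so the two triangles coincide; but a point of a side is not in the open region. *)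
Lemma triangle_edge x y z : circle x -> circle y -> circle z ->
  x <> y -> y <> z -> x <> z -> triangles E [set x; y; z] -> edge E x y.
Proof.
move=> cx cy cz xy yz xz tT; split => //; apply: contrapT => nE.
have [w [cw gw _]] := tess_generic tE cx cy xy.
have dw : disc w by exact: (chord_disc cx cy xy).
have : edge_complement E w.
  split => // -[A EA gA]; apply: nE; by rewrite -(gw A EA gA).
move=> /compl_region[a [b [c [[ca cb ccc] [h tT' rw]]]]].
case: cw => s [s01 ew].
have [e e01 re] := open_meet z ca cb ccc h rw.
have rz : triangle_region [set x; y; z] (line_path w z e).
  by rewrite triangle_regionE // ew; exact: line_path_tri.
have eT : [set x; y; z] = [set a; b; c].
  by apply: (tess_disjoint tE) => //; exists (line_path w z e).
move: rw; rewrite -eT triangle_regionE // => -[k [l [m [k0 l0 m0 e1 ew']]]].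
have := @det3_bary R k l m x y x y z e1; rewrite -ew' ew det3_line !det3xx !mulr0 !add0r.
by move=> /esym/eqP; rewrite mulf_eq0 gt_eqF //= (negbTE (det3_neq0 _ _ _ _ _ _)).
Qed.

Lemma triangle_edges x y z : circle x -> circle y -> circle z -> cc x y z ->
  triangles E [set x; y; z] -> [/\ edge E x y, edge E y z & edge E z x].
Proof.
move=> cx cy cz /cc_neq[xy yz xz] tT; split.
- exact: (triangle_edge cx cy cz).
- by apply: (triangle_edge cy cz cx) => //; [exact: nesym | exact: nesym | rewrite -set3C].
- by apply: (triangle_edge cz cx cy) => //; [exact: nesym | exact: nesym | rewrite set3C].
Qed.

(** A short step to the left of a generic point [w] of the edge ends in the region of some triangle.
    As [w] is on an edge, it is not in that region, so the step meets a side of the triangle; that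
    side is an edge, hence is [x y] by genericity, and the left direction fixes its orientation. *)
Lemma left_triangle x y : edge E x y ->
  exists u, [/\ circle u, cc x y u & triangles E [set x; y; u]].
Proof.
move=> [cx cy xy Exy].
have [w [cw _ gw]] := tess_generic tE cx cy xy.
have dw : disc w by exact: (chord_disc cx cy xy).
have [n [dn ln]] := left_point cx cy xy.
have [d d0 hd] := gw n dn.
have [e e0 ed] : exists2 e, 0 < e < 1 & e < d.
  exists (Num.min 1 d / 2).
    have : 0 < Num.min 1 d by rewrite lt_min ltr01.
    have : Num.min 1 d <= 1 by rewrite ge_min lexx.
    by move=> ? ?; apply/andP; split; lra.
  have : 0 < Num.min 1 d by rewrite lt_min ltr01.
  have : Num.min 1 d <= d by rewrite ge_min lexx orbT.
  by move=> ? ?; lra.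
have [e0' e1'] := andP e0.
have dl e' : 0 <= e' <= e -> disc (line_path w n e').
  move=> /andP[h1 h2]; apply: disc_convex => //; apply/andP; split => //.
  by apply: le_trans (ltW e1').
have lv : det3 x y (line_path w n e) = e * det3 x y n by rewrite det3_line (chord_det cw)
  mulr0 add0r.
have cv : edge_complement E (line_path w n e).
  split; first by apply: dl; rewrite lexx ltW.
  move=> [A EA gA]; have eA : A = ideal_arc x y.
    by apply: (hd e) gA => //; rewrite ltW.
  move: gA; rewrite eA geodesicE // => /chord_det; rewrite lv => /eqP.
  by rewrite mulf_eq0 !gt_eqF.
have [a [b [c [[ca cb ccc] [h tT rv]]]]] := compl_region cv.
have key a' b' c' : circle a' -> circle b' -> circle c' -> cc a' b' c' ->
    triangles E [set a'; b'; c'] -> triangle_region [set a'; b'; c'] (line_path w n e) ->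
    det3 a' b' w <= 0 -> exists u, [/\ circle u, cc x y u & triangles E [set x; y; u]].
  move=> ca' cb' cc' h' tT' /region_cc[] // k1 _ _ k2.
  have [eab _ _] := triangle_edges ca' cb' cc' h' tT'; have [_ _ ab Eab] := eab.
  have [f f0 fe] : exists2 f, 0 <= f <= e & det3 a' b' (line_path w n f) = 0.
    move: k1 k2; rewrite det3_line => k1 k2.
    suff [f f0 fe] : exists2 f, 0 <= f <= e & (1 - f) * det3 a' b' w + f * det3 a' b' n = 0.
      by exists f => //; rewrite det3_line.
    by apply: affine_zero k2 k1; rewrite ltW.
  have ga : geodesic (ideal_arc a' b') (line_path w n f).
    by rewrite geodesicE //; apply: chordP => //; exact: dl.
  have eA : ideal_arc a' b' = ideal_arc x y.
    apply: (hd f) ga => //; case/andP: f0 => -> /= ?; exact: le_lt_trans ed.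
  case: (ideal_arc_inj ca' cb' ab cx cy xy eA) => -[ea eb]; subst a' b'.
    by exists c'.
  move: k1; rewrite det3N lv oppr_gt0 => k1.
  by have := mulr_gt0 e0' ln; rewrite ltNge (ltW k1).
case: (lerP (det3 a b w) 0) => h1; first exact: (key a b c).
case: (lerP (det3 b c w) 0) => h2.
  by apply: (key b c a) => //; [rewrite -ccC | rewrite -set3C | rewrite -set3C].
case: (lerP (det3 c a w) 0) => h3.
  by apply: (key c a b) => //; [rewrite ccC | rewrite set3C | rewrite set3C].
(* In the remaining case the point [w] of the edge would be interior to a triangle of the
   tessellation. *)
have rw : triangle_region [set a; b; c] w by apply/region_cc.
case: tT => _ /(_ _ rw)[_ []]; exists (ideal_arc x y) => //.
by rewrite geodesicE.
Qed.

(** From the crossing point on, the chord towards [q] enters the triangle to the left of [x y],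
    whose region contains no point of an edge. *)
Lemma edges_nocross x y p q : edge E x y -> edge E p q -> cc y x p -> cc x y q -> False.
Proof.
move=> exy [cp cq pq Epq] hp hq; have [cx cy xy _] := exy.
have [u [cu hu tu]] := left_triangle exy.
move: (hp) (hq); rewrite !cc_ccw // det3N oppr_gt0 => P0 Q0.
pose P := det3 x y p; pose Q := det3 x y q.
have D : 0 < Q - P by rewrite subr_gt0; exact: lt_trans Q0.
have t01 : 0 < - P / (Q - P) < 1.
  apply/andP; split; first by rewrite divr_gt0 ?oppr_gt0.
  by rewrite ltr_pdivrMr // mul1r addrC ltrDl.
set t := - P / (Q - P) in t01; pose w := line_path p q t.
have w0 : det3 x y w = 0 by rewrite /w det3_line -/P -/Q /t; field; rewrite gt_eqF.
have dw : disc w by exact: line_disc.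
have [s [/andP[s0 s1] ew]] := chordP cx cy xy dw w0.
have hu' : 0 < det3 x y u by rewrite -cc_ccw.
have w1 : 0 < det3 y u w.
  by rewrite ew det3_line !det3xx mulr0 addr0 -det3C mulr_gt0 // subr_gt0.
have w2 : 0 < det3 u x w.
  by rewrite ew det3_line !det3xx mulr0 add0r det3C mulr_gt0.
have [|e e01] := @small_affine R [:: (det3 y u w, det3 y u q); (det3 u x w, det3 u x q)] 1
  ltr01.
  by rewrite /= w1 w2.
rewrite /= andbT => /andP[k1 k2]; have [e0 e1] := andP e01.
have rv : triangle_region [set x; y; u] (line_path w q e).
  by apply/region_cc => //; rewrite !(det3_line _ _ w) w0 mulr0 add0r mulr_gt0.
case: tu => _ /(_ _ rv)[_ []]; exists (ideal_arc p q) => //.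
rewrite geodesicE // /w line_path_sub; exists (t + e * (1 - t)); split => //.
case/andP: t01 => t0 t1; have t1' : 0 < 1 - t by rewrite subr_gt0.
have e1' : 0 < 1 - e by rewrite subr_gt0.
apply/andP; split; first by rewrite addr_gt0 // mulr_gt0.
by rewrite -subr_gt0 (_ : _ - _ = (1 - e) * (1 - t)) ?mulr_gt0 //; ring.
Qed.

(** With two distinct apexes over the same oriented edge, a side of one triangle would cross a side
    of the other. *)
Lemma triangle_unique x y u v : circle x -> circle y -> circle u -> circle v ->
  cc x y u -> cc x y v ->
  triangles E [set x; y; u] -> triangles E [set x; y; v] -> u = v.
Proof.
move=> cx cy cu cv hu hv tu tv; apply: contrapT => uv.
have [xy yu xu] := cc_neq hu; have [_ yv xv] := cc_neq hv.
have [_ eyu eux] := triangle_edges cx cy cu hu tu.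
have [_ eyv evx] := triangle_edges cx cy cv hv tv.
case: (cc_total cx cu cv xu uv xv) => h.
  by apply: (@edges_nocross x u y v) => //; [exact: edgeC | rewrite ccC ].
by apply: (@edges_nocross x v y u) => //; [exact: edgeC | rewrite ccC ].
Qed.

(** The apex of the triangle to the left of [x y] can only be [z], by non-crossing. This recognises
    the Farey triangles at the edge from 0 to infinity from their sides alone. *)
Lemma triangle_of_edges x y z : edge E x y -> edge E y z -> edge E z x -> cc x y z ->
  triangles E [set x; y; z].
Proof.
move=> exy eyz ezx h; have [u [cu hu tu]] := left_triangle exy.
have [cx cy xy _] := exy; have [_ cz yz _] := eyz.
have [_ eyu eux] := triangle_edges cx cy cu hu tu.
have [_ yu xu] := cc_neq hu; have [_ _ xz] := cc_neq h.
have [<- //|uz] := EM (u = z).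
exfalso; case: (cc_total cx cu cz xu uz xz) => h'.
  by apply: (@edges_nocross x u y z) => //; [exact: edgeC | rewrite ccC].
by apply: (@edges_nocross x z y u) => //; [exact: edgeC | rewrite ccC].
Qed.

Lemma vertex_or_out a b c p : circle a -> circle b -> circle c -> cc a b c -> circle p ->
  (p = a \/ p = b \/ p = c) \/ (cc b a p \/ cc c b p \/ cc a c p).
Proof.
move=> ca cb ccc h cp; have [ab bc ac] := cc_neq h.
have [->|pa] := EM (p = a); first by auto.
have [->|pb] := EM (p = b); first by auto.
have [->|pc] := EM (p = c); first by auto.
right; case: (cc_total ca cb cp ab (nesym pb) (nesym pa)) => h1; last first.
  by left; rewrite ccC.
case: (cc_total cb ccc cp bc (nesym pc) (nesym pb)) => h2; last first.
  by right; left; rewrite ccC.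
right; right; case: (cc_total ccc ca cp (nesym ac) (nesym pa) (nesym pc)) => h3; last first.
  by rewrite ccC.
by exfalso; clear -h h1 h2 h3; cyc_lra.
Qed.

(** An effective form of the maximality of the edge set. A generic point [w] of the chord is
    interior to a triangle; [p] and [q] are not both vertices of it, or [w] would lie on a side. The
    one that is not a vertex lies beyond some side, and since [w] is within that side, the other one
    is too. *)
Lemma tess_maximal p q : circle p -> circle q -> p <> q -> ~ E (ideal_arc p q) ->
  exists a b, [/\ edge E a b, cc b a p & cc a b q].
Proof.
move=> cp cq pq nE.
have [w [cw gw _]] := tess_generic tE cp cq pq.
have dw : disc w by exact: (chord_disc cp cq pq).
have : edge_complement E w.
  split => // -[A EA gA]; apply: nE; by rewrite -(gw A EA gA).
move=> /compl_region[a [b [c [[ca cb ccc] [h tT rw]]]]].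
have [eab ebc eca] := triangle_edges ca cb ccc h tT.
have [h1 h2 h3] := (region_cc w ca cb ccc h).1 rw.
have [ab bc ac] := cc_neq h.
have key p' q' a' b' : circle p' -> circle q' -> chord p' q' w -> edge E a' b' ->
    0 < det3 a' b' w -> cc b' a' p' -> cc b' a' p' /\ cc a' b' q'.
  move=> cp' cq' [s [/andP[s0 s1] ew]] [ca' cb' _ _] k hp; split => //; move: hp k.
  rewrite !cc_ccw // det3N oppr_gt0 ew det3_line => k2 k.
  have s1' : 0 < 1 - s by rewrite subr_gt0.
  rewrite -(pmulr_rgt0 _ s0); have : (1 - s) * det3 a' b' p' < 0 by rewrite pmulr_rlt0.
  lra.
have fin1 a' b' : edge E a' b' -> 0 < det3 a' b' w -> cc b' a' p ->
    exists a b, [/\ edge E a b, cc b a p & cc a b q].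
  by move=> e k1 k2; exists a', b'; have [] := key p q a' b' cp cq cw e k1 k2.
have fin2 a' b' : edge E a' b' -> 0 < det3 a' b' w -> cc b' a' q ->
    exists a b, [/\ edge E a b, cc b a p & cc a b q].
  move=> e k1 k2; exists b', a'; rewrite chordC in cw.
  by have [? ?] := key q p a' b' cq cp cw e k1 k2; split => //; exact: edgeC.
case: (vertex_or_out ca cb ccc h cp) => [vp|[|[|]]]; [|exact: fin1..].
case: (vertex_or_out ca cb ccc h cq) => [vq|[|[|]]]; [|exact: fin2..].
exfalso; have z := chord_det cw; have z' : det3 q p w = 0 by rewrite det3N z oppr0.
move: h1 h2 h3.
by case: vp => [|[|]] ?; case: vq => [|[|]] ?; subst p q => //; rewrite ?z ?z' ?ltxx.
Qed.

Lemma edges_meet a b x y w : edge E a b -> edge E x y -> chord a b w -> chord x y w ->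
  ideal_arc a b = ideal_arc x y.
Proof.
move=> eab exy /chord_det + [s [/andP[s0 s1] ew]]; rewrite ew det3_line => h.
have [ca cb ab _] := eab; have [cx cy xy _] := exy.
have s1' : 0 < 1 - s by rewrite subr_gt0.
have key v : circle v -> det3 a b v = 0 -> v = a \/ v = b.
  move=> cv hv; have [->|va] := EM (v = a); first by left.
  have [->|vb] := EM (v = b); first by right.
  by have := det3_neq0 ca cb cv ab (nesym vb) (nesym va); rewrite hv eqxx.
case: (ltrgtP (det3 a b x) 0) => hx.
- exfalso; apply: (edges_nocross eab exy); rewrite cc_ccw //; first by rewrite det3N oppr_gt0.
  rewrite -(pmulr_rgt0 _ s0) -(addrK ((1 - s) * det3 a b x) (s * _)) [_ + (1 - s) * _]addrC h.
  by rewrite sub0r oppr_gt0 pmulr_rlt0.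
- exfalso; apply: (edges_nocross eab (edgeC exy)); rewrite cc_ccw // det3N oppr_gt0.
  rewrite -(pmulr_rlt0 _ s0) -(addrK ((1 - s) * det3 a b x) (s * _)) [_ + (1 - s) * _]addrC h.
  by rewrite sub0r oppr_lt0 pmulr_rgt0.
- move: h; rewrite hx mulr0 add0r => /eqP; rewrite mulf_eq0 gt_eqF //= => /eqP hy.
  case: (key x cx hx) => ex; case: (key y cy hy) => ey; subst; [by case: xy | by [] | by
    rewrite ideal_arcC // | by case: xy].
Qed.

End Tessellation.

End TessTheory.

(** * Overlapping triangle regions coincide *)

Section Flip.
Variable R : realType.
Implicit Types (x y z w u v a b c d p q n : C R) (s t e : R).
Local Notation Re := (@complex.Re R).
Local Notation Im := (@complex.Im R).

Lemma conv_pos (P Q f : R) : 0 < P -> 0 < Q -> 0 <= f <= 1 -> 0 < (1 - f) * P + f * Q.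
Proof.
move=> P0 Q0 /andP[f0 f1]; have [->|nf] := eqVneq f 0.
  by rewrite subr0 mul0r addr0 mul1r.
have f0' : 0 < f by rewrite lt_neqAle eq_sym nf.
by rewrite ltr_wpDl ?mulr_ge0 ?mulr_gt0 ?subr_ge0 // ltW.
Qed.

Lemma centroid x y z : circle x -> circle y -> circle z -> cc x y z ->
  exists w, triangle_region [set x; y; z] w.
Proof.
move=> cx cy cz /cc_neq[xy yz xz]; rewrite triangle_regionE //.
have half : 0 < (2^-1 : R) < 1 by apply/andP; split; lra.
by exists (line_path (line_path x y 2^-1) z 2^-1); exact: line_path_tri.
Qed.

Lemma region_disc x y z w : circle x -> circle y -> circle z -> cc x y z ->
  triangle_region [set x; y; z] w -> disc w.
Proof.
move=> cx cy cz h; have [xy yz xz] := cc_neq h; rewrite triangle_regionE //.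
move=> [p [q [r [p0 q0 r0 e1 ew]]]]; apply/discE.
have n : 0 < (Re x - Re y) ^+ 2 + (Im x - Im y) ^+ 2.
  rewrite lt_neqAle eq_sym paddr_eq0 ?sqr_ge0 ?addr_ge0 ?sqr_ge0 // andbT.
  rewrite !sqrf_eq0 !subr_eq0; apply/negP => /andP[/eqP k1 /eqP k2].
  by apply: xy; exact: complex_ext.
move/circleE: cx => cx; move/circleE: cy => cy; move/circleE: cz => cz.
(* Lagrange's identity: the square norm of a weighted mean is the mean of the square norms less the
   weighted mutual square distances. *)
have -> : Re w ^+ 2 + Im w ^+ 2 = (p + q + r) * (p * (Re x ^+ 2 + Im x ^+ 2) + q * (Re y ^+ 2
  + Im y ^+ 2) + r * (Re z ^+ 2 + Im z ^+ 2))
    - (p * q * ((Re x - Re y) ^+ 2 + (Im x - Im y) ^+ 2) + q * r * ((Re y - Re z) ^+ 2 + (Im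
        y - Im z) ^+ 2)
    + r * p * ((Re z - Re x) ^+ 2 + (Im z - Im x) ^+ 2)).
  have -> : Re w = p * Re x + q * Re y + r * Re z.
    by rewrite ew /cplx; case: (x) (y) (z) => [? ?] [? ?] [? ?] /=; ring.
  have -> : Im w = p * Im x + q * Im y + r * Im z.
    by rewrite ew /cplx; case: (x) (y) (z) => [? ?] [? ?] [? ?] /=; ring.
  by ring.
rewrite cx cy cz e1 !mulr1 e1 mul1r ltrBlDr ltrDl.
have k1 := mulr_gt0 (mulr_gt0 p0 q0) n.
have k2 : 0 <= q * r * ((Re y - Re z) ^+ 2 + (Im y - Im z) ^+ 2).
  by rewrite !mulr_ge0 ?addr_ge0 ?sqr_ge0 // ltW.
have k3 : 0 <= r * p * ((Re z - Re x) ^+ 2 + (Im z - Im x) ^+ 2).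
  by rewrite !mulr_ge0 ?addr_ge0 ?sqr_ge0 // ltW.
by rewrite ltr_wpDr // ltr_wpDr.
Qed.

(* A sign change of a side of [xyz] inside the convex region [abc] would put a
   point of that side in the region. *)
Lemma region_side a b c x y w w' : circle a -> circle b -> circle c -> cc a b c ->
  triangle_region [set a; b; c] w -> triangle_region [set a; b; c] w' ->
  (forall v, triangle_region [set a; b; c] v -> det3 x y v <> 0) ->
  0 < det3 x y w -> 0 < det3 x y w'.
Proof.
move=> ca cb ccc h rw rw' nz h0; rewrite ltNge; apply/negP => h1.
have [|f /andP[f0 f1] hf] := affine_zero (@ler01 R) h1 (_ : 0 < (1 - 1) * det3 x y w' + 1 *
  det3 x y w).
  by rewrite subrr mul0r add0r mul1r.
apply: (nz (line_path w' w f)); last by rewrite det3_line.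
move/(region_cc _ ca cb ccc h): rw => [? ? ?]; move/(region_cc _ ca cb ccc h): rw' => [? ? ?].
by apply/region_cc => //; rewrite !det3_line; split; apply: conv_pos => //; apply/andP.
Qed.

(** The vertex [a] is a limit of points of the region, and a negative value at [a] would persist
    nearby. *)
Lemma region_vertex a b c x y w : circle a -> circle b -> circle c -> cc a b c ->
  triangle_region [set a; b; c] w ->
  (forall v, triangle_region [set a; b; c] v -> 0 < det3 x y v) -> 0 <= det3 x y a.
Proof.
move=> ca cb ccc h rw hv; rewrite leNgt; apply/negP => na.
have [|e /andP[e0 e1]] := @small_affine R [:: (- det3 x y a, - det3 x y w)] 1 ltr01.
  by rewrite /= oppr_gt0 na.
rewrite /= andbT !mulrN -opprD oppr_gt0 -det3_line => k.
suff : 0 < det3 x y (line_path a w e) by rewrite ltNge (ltW k).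
apply: hv; move/(region_cc _ ca cb ccc h): rw => [k1 k2 k3].
have D : 0 < det3 b c a by rewrite -det3C -cc_ccw.
apply/region_cc => //; rewrite !det3_line !det3xx !mulr0 !add0r; split; rewrite ?mulr_gt0 //.
by apply: conv_pos => //; rewrite !ltW.
Qed.

(** The region of [a b c] crosses no side of [x y z], so one common point places all of it, and its
    vertices in the limit, within the three half-planes of [x y z]. A point of the circle in the
    closed triangle is one of its vertices. *)
Lemma triangle_meet (E : set (arc R)) x y z w a b c :
  circle a -> circle b -> circle c -> cc a b c -> cc x y z ->
  edge E x y -> edge E y z -> edge E z x ->
  triangle_region [set a; b; c] `<=` edge_complement E ->
  triangle_region [set x; y; z] w -> triangle_region [set a; b; c] w ->
  [set a; b; c] = [set x; y; z].
Proof.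
move=> ca cb ccc h hx exy eyz ezx sub rx ra.
have [cx cy xy _] := exy; have [_ cz yz _] := eyz; have [_ _ zx _] := ezx.
have key x' y' : edge E x' y' -> 0 < det3 x' y' w ->
    forall v, v = a \/ v = b \/ v = c -> 0 <= det3 x' y' v.
  move=> [cx' cy' xy' E'] h0.
  have nz v : triangle_region [set a; b; c] v -> det3 x' y' v <> 0.
    move=> rv z0; have [dv []] := sub _ rv; exists (ideal_arc x' y') => //.
    by rewrite geodesicE //; exact: chordP.
  have pos v rv := region_side ca cb ccc h ra rv nz h0.
  have pos' v : triangle_region [set a; b; c] v -> 0 < det3 x' y' v by move=> rv; exact: pos.
  move=> v [|[]] ->.
  - exact: (region_vertex ca cb ccc h ra pos').
  - rewrite set3C in ra pos'; apply: (@region_vertex b c a x' y' w) => //.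
    by rewrite -ccC.
  - rewrite -set3C in ra pos'; apply: (@region_vertex c a b x' y' w) => //.
    by rewrite ccC.
have [k1 k2 k3] := (region_cc w cx cy cz hx).1 rx.
have vert v : v = a \/ v = b \/ v = c -> v = x \/ v = y \/ v = z.
  move=> hv; have cv : circle v by case: hv => [|[]] ->.
  case: (vertex_or_out cx cy cz hx cv) => // o; exfalso.
  have := key _ _ exy k1 v hv; have := key _ _ eyz k2 v hv; have := key _ _ ezx k3 v hv.
  by case: o => [|[]]; rewrite cc_ccw // det3N oppr_gt0 ltNge => /negbTE ->.
have [ab bc ac] := cc_neq h.
have [va vb vc] := And3 (vert a (or_introl erefl)) (vert b (or_intror (or_introl erefl)))
  (vert c (or_intror (or_intror erefl))).
by case: va => [|[|]] ?; case: vb => [|[|]] ?; case: vc => [|[|]] ?; subst a b c; try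
  congruence; apply/seteqP; split => v /= [[]|] ->; auto.
Qed.

End Flip.

(** * Flips *)

Section Quad.
Variable R : realType.
Implicit Types (x y z w u v a b c d p q n : C R) (s t e : R).

(** The open convex quadrilateral, described by its sides alone so that it serves both diagonals. *)
Definition quad a b c d w := [/\ 0 < det3 a b w, 0 < det3 b c w, 0 < det3 c d w & 0 < det3 d
  a w].

Lemma region_quad a b c d w : circle a -> circle b -> circle c -> circle d ->
  cc a b c -> cc a c d -> triangle_region [set a; b; c] w -> quad a b c d w.
Proof.
move=> ca cb ccc cd h1 h2 rw; have [k1 k2 _] := (region_cc w ca cb ccc h1).1 rw.
have [h3 h4] := cc_trans h1 h2; have [ab bc ac] := cc_neq h1.
move: rw; rewrite triangle_regionE // => -[p [q [r [p0 q0 r0 e1 ew]]]].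
split => //; rewrite ew det3_bary // !det3xx ?mulr0 ?addr0 ?add0r addr_gt0 // mulr_gt0 //
  -cc_ccw //.
- by rewrite -ccC.
- by rewrite -ccC.
- by rewrite ccC.
- by rewrite ccC.
Qed.

Lemma quad_split a b c d w : circle a -> circle b -> circle c -> circle d ->
  cc a b c -> cc a c d -> disc w -> quad a b c d w ->
  [\/ triangle_region [set a; b; c] w, chord a c w | triangle_region [set a; c; d] w].
Proof.
move=> ca cb ccc cd h1 h2 dw [q1 q2 q3 q4]; have [ab bc ac] := cc_neq h1.
case: (ltrgtP (det3 a c w) 0) => h.
- by apply: Or31; apply/region_cc => //; split => //; rewrite det3N oppr_gt0.
- by apply: Or33; apply/region_cc.
- by apply: Or32; apply: chordP.
Qed.

Lemma chord_quad a b c d w : circle a -> circle b -> circle c -> circle d ->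
  cc a b c -> cc a c d -> chord a c w -> quad a b c d w.
Proof.
move=> ca cb ccc cd h1 h2 [t [/andP[t0 t1] ->]]; have t1' : 0 < 1 - t by rewrite subr_gt0.
split; rewrite det3_line !det3xx mulr0 ?addr0 ?add0r mulr_gt0 // -cc_ccw //.
- by rewrite -ccC.
- by rewrite -ccC.
- by rewrite ccC.
Qed.

Lemma quadC a b c d w : quad a b c d w -> quad b c d a w.
Proof. by case. Qed.
End Quad.

Section Flip.
Variable R : realType.
Implicit Types (x y z w u v a b c d p q n : C R) (s t e : R).
Variables (E : set (arc R)) (v1 v2 v3 v4 : C R).
Hypotheses (tE : tessellation E) (c1 : circle v1) (c2 : circle v2) (c3 : circle v3) (c4 :
  circle v4).
Hypotheses (h1 : cc v1 v2 v3) (h2 : cc v1 v3 v4).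
Hypotheses (tT1 : triangles E [set v1; v2; v3]) (tT2 : triangles E [set v1; v3; v4]).

Definition flip_edges : set (arc R) :=
  (E `\ ideal_arc v1 v3) `|` [set ideal_arc v2 v4].

Definition flip_triangle (T : set (C R)) : Prop :=
  [\/ T = [set v1; v2; v4], T = [set v2; v3; v4] |
     [/\ triangles E T, T <> [set v1; v2; v3] & T <> [set v1; v3; v4]]].

Let h3 : cc v1 v2 v4. Proof. by have [] := cc_trans h1 h2. Qed.
Let h4 : cc v2 v3 v4. Proof. by have [] := cc_trans h1 h2. Qed.
Let h4' : cc v2 v4 v1. Proof. by rewrite -ccC. Qed.

Let e12 : edge E v1 v2. Proof. by have [] := triangle_edges tE c1 c2 c3 h1 tT1. Qed.
Let e23 : edge E v2 v3. Proof. by have [] := triangle_edges tE c1 c2 c3 h1 tT1. Qed.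
Let e13 : edge E v1 v3. Proof. by have [] := triangle_edges tE c1 c2 c3 h1 tT1 => _ _ /edgeC.
  Qed.
Let e34 : edge E v3 v4. Proof. by have [] := triangle_edges tE c1 c3 c4 h2 tT2. Qed.
Let e41 : edge E v4 v1. Proof. by have [] := triangle_edges tE c1 c3 c4 h2 tT2. Qed.

Let quad_disc w : quad v1 v2 v3 v4 w -> triangle_region [set v1; v2; v4] w \/ triangle_region
  [set v2; v3; v4] w ->
  edge_complement flip_edges w.
Proof.
move=> Q r.
have dw : disc w by case: r => r; apply: (region_disc _ _ _ _ r).
split => // -[A [[EA /= nA]|/= eA] gA]; last first.
  subst A; move: gA; rewrite geodesicE //; last by have [_ ? _] := cc_neq h3.
  move=> /chord_det z; case: r => /region_cc[] // k1 k2 k3; first by rewrite z ltxx in k2.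
  by rewrite det3N z oppr0 ltxx in k3.
case: (quad_split c1 c2 c3 c4 h1 h2 dw Q) => [rw|cw|rw].
- by case: tT1 => _ /(_ _ rw)[_ []]; exists A.
- have [a [b [ca cb ab eA]]] := is_ideal_arcP (tess_arcs tE EA); subst A.
  apply: nA; apply: (edges_meet tE _ e13 _ cw); first by [].
  by move: gA; rewrite geodesicE.
- by case: tT2 => _ /(_ _ rw)[_ []]; exists A.
Qed.

Let region1 w : triangle_region [set v1; v2; v4] w -> quad v1 v2 v3 v4 w.
Proof.
move=> rw; apply: quadC; apply: (@region_quad _ v4 v1 v2 v3) => //.
- by rewrite ccC.
- by rewrite ccC.
- by rewrite set3C.
Qed.

Let region2 w : triangle_region [set v2; v3; v4] w -> quad v1 v2 v3 v4 w.
Proof. by move=> rw; apply/quadC/quadC/quadC; apply: region_quad. Qed.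

Let regionT w : quad v1 v2 v3 v4 w -> disc w -> ~ chord v2 v4 w ->
  triangle_region [set v1; v2; v4] w \/ triangle_region [set v2; v3; v4] w.
Proof.
move=> /quadC Q dw nc; case: (quad_split c2 c3 c4 c1 h4 h4' dw Q) => //; first by right.
by rewrite -set3C; left.
Qed.

Let chord24 w : chord v2 v4 w -> quad v1 v2 v3 v4 w.
Proof. by move=> cw; apply/quadC/quadC/quadC; apply: chord_quad. Qed.

(** The new diagonal runs inside the quadrilateral, which is filled by the two old triangles and the
    old diagonal; a surviving triangle is disjoint from all of these. *)
Lemma flip_region T : flip_triangle T -> triangle_region T `<=` edge_complement flip_edges.
Proof.
case=> [->|->|[tT n1 n2]] w rw.
- by apply: quad_disc; [exact: region1 | left].
- by apply: quad_disc; [exact: region2 | right].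
- have [_ /(_ _ rw)[dw ng]] := tT; split => // -[A [[EA _]|/= eA] gA].
    by apply: ng; exists A.
  subst A; move: gA; rewrite geodesicE //; last by have [_ ? _] := cc_neq h3.
  move=> /chord24 Q; case: (quad_split c1 c2 c3 c4 h1 h2 dw Q) => [rw'|cw|rw'].
  + by apply: n1; apply: (tess_disjoint tE) => //; exists w.
  + by apply: ng; exists (ideal_arc v1 v3); rewrite ?geodesicE //; case: e13.
  + by apply: n2; apply: (tess_disjoint tE) => //; exists w.
Qed.

Lemma flip_cover w : edge_complement flip_edges w -> exists2 T, flip_triangle T &
  triangle_region T w.
Proof.
move=> [dw ng].
have n24 : ~ chord v2 v4 w.
  move=> cw; apply: ng; exists (ideal_arc v2 v4); first by right.
  by rewrite geodesicE //; have [_ ? _] := cc_neq h3.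
have fin (Q : quad v1 v2 v3 v4 w) : exists2 T, flip_triangle T & triangle_region T w.
  case: (regionT Q dw n24) => r; first by exists [set v1; v2; v4] => //; apply: Or31.
  by exists [set v2; v3; v4] => //; apply: Or32.
have [cw|nc] := EM (chord v1 v3 w).
  by apply: fin; exact: chord_quad.
have : edge_complement E w.
  split => // -[A EA gA]; have [eA|nA] := EM (A = ideal_arc v1 v3).
    by apply: nc; move: gA; rewrite eA geodesicE //; have [] := cc_neq h1.
  by apply: ng; exists A => //; left.
rewrite (tess_cover tE) => -[T tT rT].
have [eT|n1] := EM (T = [set v1; v2; v3]).
  by apply: fin; apply: region_quad => //; rewrite -eT.
have [eT|n2] := EM (T = [set v1; v3; v4]).
  apply: fin; apply/quadC/quadC; apply: region_quad => //; [| |by rewrite -set3C -eT].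
  - by rewrite -ccC.
  - by rewrite ccC.
by exists T => //; apply: Or33.
Qed.

Let flip_edge x y : edge E x y -> ideal_arc x y <> ideal_arc v1 v3 -> edge flip_edges x y.
Proof. by move=> [cx cy xy Exy] n; split => //; left. Qed.

(** The triangles on the two sides of the removed diagonal are unique, so no surviving triangle has
    it as a side. *)
Let other_side x y z : circle x -> circle y -> circle z -> cc x y z ->
  triangles E [set x; y; z] -> [set x; y; z] <> [set v1; v2; v3] -> [set x; y; z] <> [set v1;
    v3; v4] ->
  ideal_arc x y <> ideal_arc v1 v3.
Proof.
move=> cx cy cz h tT n1 n2 e; have [xy yz xz] := cc_neq h; have [_ _ v13 _] := e13.
case: (ideal_arc_inj cx cy xy c1 c3 v13 e) => -[ex ey]; subst x y.
  by apply: n2; rewrite (triangle_unique tE c1 c3 cz c4 h h2 tT tT2).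
apply: n1; have h1' : cc v3 v1 v2 by rewrite ccC.
have tT1' : triangles E [set v3; v1; v2] by rewrite set3C.
by rewrite (triangle_unique tE c3 c1 cz c2 h h1' tT tT1') set3C.
Qed.

Lemma flip_sides T : flip_triangle T -> exists x y z, [/\ T = [set x; y; z], cc x y z,
  edge flip_edges x y, edge flip_edges y z & edge flip_edges z x].
Proof.
have [v12 v23 v13] := cc_neq h1; have [_ v34 v14] := cc_neq h2; have [_ v24 _] := cc_neq h3.
have e24 : edge flip_edges v2 v4 by split => //; right.
have ne a b : circle a -> circle b -> a <> b -> (a <> v1 /\ b <> v1) \/ (a <> v3 /\ b <> v3) ->
  ideal_arc a b <> ideal_arc v1 v3.
  move=> ca cb ab n /ideal_arc_inj h; case: (h ca cb ab c1 c3 v13) => -[ea eb]; subst; tauto.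
case=> [->|->|[tT n1 n2]].
- exists v1, v2, v4; split => //; last by apply: flip_edge => //; apply: ne => //; [exact:
    nesym| right; split => //; exact: nesym].
  by apply: flip_edge => //; apply: ne => //; right.
- exists v2, v3, v4; split => //; last exact: edgeC.
  + by apply: flip_edge => //; apply: ne => //; left; split; exact: nesym.
  + by apply: flip_edge => //; apply: ne => //; left; split; exact: nesym.
- have [iT _] := tT; have [a [b [c [[ca cb ccc] [eT h]]]]] := triP iT; subst T.
  have [ab bc ac] := triangle_edges tE ca cb ccc h tT.
  exists a, b, c; split => //; apply: flip_edge => //.
  + exact: (@other_side a b c).
  + by apply: (@other_side b c a) => //; [rewrite -ccC | rewrite -set3C..].
  + by apply: (@other_side c a b) => //; [rewrite ccC | rewrite set3C..].
Qed.

Lemma flip_meet T T' w : flip_triangle T -> is_ideal_triangle T' ->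
  triangle_region T' `<=` edge_complement flip_edges ->
  triangle_region T w -> triangle_region T' w -> T' = T.
Proof.
move=> fT iT' sub r r'; have [x [y [z [eT h exy eyz ezx]]]] := flip_sides fT.
have [a [b [c [[ca cb ccc] [eT' h']]]]] := triP iT'; subst T T'.
exact: (triangle_meet ca cb ccc h' h exy eyz ezx sub r r').
Qed.

(** The expected triangles avoid the new edges and their regions cover the complement. Any triangle
    avoiding the new edges therefore overlaps an expected one, and overlapping forces equality. *)
Lemma flip_trianglesE T : triangles flip_edges T <-> flip_triangle T.
Proof.
split=> [[iT sub]|fT].
  have [a [b [c [[ca cb ccc] [eT h]]]]] := triP iT.
  have [w rw] := centroid ca cb ccc h; rewrite -eT in rw.
  have [T' fT' rT'] := flip_cover (sub w rw).
  by rewrite (flip_meet fT' iT sub rT' rw).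
split; last exact: flip_region.
have [x [y [z [eT h [cx cy xy _] [_ cz yz _] [_ _ zx _]]]]] := flip_sides fT.
by rewrite eT; exact: ideal_triangle_cc.
Qed.

Lemma flip_tess : tessellation flip_edges.
Proof.
have [v12 v23 v13] := cc_neq h1; have [_ v34 v14] := cc_neq h2; have [_ v24 _] := cc_neq h3.
split.
- by move=> A [[EA _]|->]; [exact: (tess_arcs tE) | exact: is_ideal_arc_ideal].
- apply: (@sub_countable _ _ _ (\bigcup_(i in [set: bool]) if i then E else [set ideal_arc v2
    v4])).
    by apply: subset_card_le => A [[EA _]|->]; [exists true | exists false].
  apply: bigcup_countable => // -[] _; [exact: tess_countable tE | exact: countable1].
- move=> z dz; have [U Uz fU] := tess_locally_finite tE dz; exists U => //.
  apply: (@sub_finite_set _ _ ([set A | E A /\ geodesic A `&` U !=set0] `|` [set ideal_arc v2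
    v4])).
    by move=> A [[[EA _]|->] g]; [left | right].
  by rewrite finite_setU; split => //; exact: finite_set1.
- apply/seteqP; split => w.
    by move=> /flip_cover[T fT rT]; exists T => //; apply/flip_trianglesE.
  by move=> [T /flip_trianglesE fT rT]; exact: (flip_region fT).
- move=> T T' /flip_trianglesE fT [iT' sub] [w [r r']].
  by rewrite (flip_meet fT iT' sub r r').
- rewrite -(tess_vertices tE); apply/seteqP; split => z.
    move=> [A [[EA _]|->]]; first by exists A.
    rewrite endpointsE // => -[|] /= ->.
      by exists (ideal_arc v1 v2); [case: e12 | rewrite endpointsE //; right].
    by exists (ideal_arc v3 v4); [case: e34 | rewrite endpointsE //; right].
  (* The ends of the removed diagonal remain vertices through the sides [v1 v2] and [v2 v3]. *)
  move=> [A EA eA]; have [e|n] := EM (A = ideal_arc v1 v3); last by exists A => //; left.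
  move: eA; rewrite e endpointsE // => -[|] /= ->.
    exists (ideal_arc v1 v2); last by rewrite endpointsE //; left.
    left; split; first by case: e12.
    by move=> /= /ideal_arc_inj h; case: (h c1 c2 v12 c1 c3 v13) => -[]; congruence.
  exists (ideal_arc v2 v3); last by rewrite endpointsE //; right.
  left; split; first by case: e23.
  by move=> /= /ideal_arc_inj h; case: (h c2 c3 v23 c1 c3 v13) => -[]; congruence.
- apply: (@sub_finite_set _ _ ((E `\` @farey_edges R) `|` [set ideal_arc v2 v4])).
    by move=> A [[[EA _]|->] nf]; [left | right].
  by rewrite finite_setU; split; [exact: tess_farey tE | exact: finite_set1].
Qed.

End Flip.

(** * Farey arithmetic *)

Section Homogeneous.
Variable R : realType.
Implicit Types (x y z w u v p q : C R).

(* [mu_hom a b] is [mu] at the point of the projective line with homogeneous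
   coordinates [a : b]. *)
Definition mu_hom (a b : R) : C R :=
  Complex ((a ^+ 2 - b ^+ 2) / (a ^+ 2 + b ^+ 2)) (- (2 * a * b) / (a ^+ 2 + b ^+ 2)).

Lemma sqD_neq0 (a b : R) : (a != 0) || (b != 0) -> a ^+ 2 + b ^+ 2 != 0.
Proof. by rewrite paddr_eq0 ?sqr_ge0 // !sqrf_eq0 negb_and. Qed.

Lemma sqD_gt0 (a b : R) : (a != 0) || (b != 0) -> 0 < a ^+ 2 + b ^+ 2.
Proof. by move/sqD_neq0 => h; rewrite lt_neqAle eq_sym h addr_ge0 ?sqr_ge0. Qed.

Lemma mu_hom_mu (r : RP1 R) : mu r = if r is Some s then mu_hom s 1 else mu_hom 1 0.
Proof.
rewrite muE; case: r => [s|]; rewrite /mu_slope /mu_hom expr1n ?mulr1 //.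
by rewrite expr0n /= subr0 addr0 divr1 mulr0 oppr0 mul0r.
Qed.

Lemma circle_mu_hom (a b : R) : (a != 0) || (b != 0) -> circle (mu_hom a b).
Proof. by move=> /sqD_neq0 h; apply/circleE; rewrite /mu_hom /=; field. Qed.

Lemma mu_homZ (k a b : R) : k != 0 -> mu_hom (k * a) (k * b) = mu_hom a b.
Proof.
move=> k0; rewrite /mu_hom; have k2 : k ^+ 2 != 0 by rewrite sqrf_eq0.
have -> : (k * a) ^+ 2 + (k * b) ^+ 2 = k ^+ 2 * (a ^+ 2 + b ^+ 2) by ring.
have -> : (k * a) ^+ 2 - (k * b) ^+ 2 = k ^+ 2 * (a ^+ 2 - b ^+ 2) by ring.
have -> : - (2 * (k * a) * (k * b)) = k ^+ 2 * (- (2 * a * b)) by ring.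
by rewrite -!mulf_div divff // !mul1r.
Qed.

Lemma mu_hom_frac (a b : R) : b != 0 -> mu_hom a b = mu_hom (a / b) 1.
Proof. by move=> b0; rewrite -(mu_homZ (a / b) 1 b0) mulr1 mulrCA divff // mulr1. Qed.

Lemma mu_hom_inf (a : R) : a != 0 -> mu_hom a 0 = mu_hom 1 0.
Proof. by move=> a0; rewrite -(mu_homZ 1 0 a0) mulr1 mulr0. Qed.

Lemma det3_mu_hom (a b c d e f : R) : (a != 0) || (b != 0) -> (c != 0) || (d != 0) -> (e !=
  0) || (f != 0) ->
  det3 (mu_hom a b) (mu_hom c d) (mu_hom e f) =
  4 / ((a ^+ 2 + b ^+ 2) * (c ^+ 2 + d ^+ 2) * (e ^+ 2 + f ^+ 2)) *
  ((a * d - b * c) * (c * f - d * e) * (e * b - f * a)).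
Proof.
move=> /sqD_neq0 h1 /sqD_neq0 h2 /sqD_neq0 h3; rewrite /det3 /mu_hom /=; field.
by rewrite h1 h2 h3.
Qed.

(** Each vector occurs in two of the three brackets, so the sign does not depend on the choice of
    homogeneous coordinates. *)
Lemma cc_mu_hom (a b c d e f : R) : (a != 0) || (b != 0) -> (c != 0) || (d != 0) -> (e != 0)
  || (f != 0) ->
  cc (mu_hom a b) (mu_hom c d) (mu_hom e f) = (0 < (a * d - b * c) * (c * f - d * e) * (e * b
    - f * a)).
Proof.
move=> h1 h2 h3; rewrite cc_ccw; try exact: circle_mu_hom.
rewrite det3_mu_hom // pmulr_rgt0 // divr_gt0 // !mulr_gt0 // sqD_gt0 //.
Qed.

(** For vectors that are not proportional, their sum gives a third point and the three points have
    nonzero [det3]; equal points would make it vanish. *)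
Lemma mu_hom_inj (a b c d : R) : (a != 0) || (b != 0) -> (c != 0) || (d != 0) ->
  mu_hom a b = mu_hom c d -> a * d - b * c = 0.
Proof.
move=> h1 h2 e; apply/eqP; apply/negPn/negP => n.
have n' : c * (b + d) - d * (a + c) != 0.
  by rewrite (_ : _ - _ = - (a * d - b * c)) ?oppr_eq0 //; ring.
have n'' : (a + c) * b - (b + d) * a != 0.
  by rewrite (_ : _ - _ = - (a * d - b * c)) ?oppr_eq0 //; ring.
have h3 : (a + c != 0) || (b + d != 0).
  by rewrite -negb_and; apply: contra n' => /andP[/eqP -> /eqP ->]; rewrite !mulr0 subrr.
have := det3_mu_hom h1 h2 h3; rewrite e det3xx => /esym/eqP.
rewrite mulf_eq0 !mulf_eq0 invr_eq0 !mulf_eq0 (negbTE n) (negbTE n') (negbTE n'').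
by rewrite !(negbTE (sqD_neq0 _)) // orbF pnatr_eq0.
Qed.

Lemma mu_hom_eq (a b c d : R) : (a != 0) || (b != 0) -> (c != 0) || (d != 0) ->
  a * d - b * c = 0 -> mu_hom a b = mu_hom c d.
Proof.
move=> h1 h2 h; have [b0|b0] := eqVneq b 0.
  subst b; rewrite eqxx orbF in h1; have d0 : d = 0.
    by apply: (mulfI h1); rewrite mulr0 -h mul0r subr0.
  by subst d; rewrite eqxx orbF in h2; rewrite !mu_hom_inf.
have d0 : d != 0.
  apply: contraTneq h2 => d0; subst d; rewrite eqxx orbF negbK.
  by move: h => /eqP; rewrite mulr0 sub0r oppr_eq0 mulf_eq0 (negbTE b0).
rewrite (mu_hom_frac a b0) (mu_hom_frac c d0); congr mu_hom; apply: (mulIf b0); apply: (mulIf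
  d0).
by rewrite divfK // mulrAC divfK // -[RHS]addr0 -h; ring.
Qed.

End Homogeneous.

Section Farey.
Variable R : realType.
Implicit Types (x y z w u v p q : C R) (a b c d e f g h k m n : int).

Definition nzv a b : bool := (a != 0) || (b != 0).

Lemma nzvR a b : nzv a b -> ((a%:~R : R) != 0) || ((b%:~R : R) != 0).
Proof. by rewrite !intr_eq0. Qed.

Lemma mu_fracE a b : nzv a b -> mu_frac R a b = mu_hom a%:~R b%:~R.
Proof.
rewrite /nzv /mu_frac mu_hom_mu; case: (eqVneq b 0) => [->|b0] /=.
  by rewrite orbF => a0; rewrite mu_hom_inf // intr_eq0.
by move=> _; rewrite (mu_hom_frac _ (_ : b%:~R != 0)) // intr_eq0.
Qed.

Lemma circle_frac a b : circle (mu_frac R a b).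
Proof. exact: circle_mu. Qed.

Lemma cc_frac a b c d e f : nzv a b -> nzv c d -> nzv e f ->
  cc (mu_frac R a b) (mu_frac R c d) (mu_frac R e f) =
  (0 < (a * d - b * c) * (c * f - d * e) * (e * b - f * a)).
Proof.
move=> h1 h2 h3; rewrite !mu_fracE // cc_mu_hom ?nzvR //.
by rewrite -!intrM -!intrB -!intrM ltr0z.
Qed.

Lemma frac_eq a b c d : nzv a b -> nzv c d ->
  mu_frac R a b = mu_frac R c d <-> a * d - b * c = 0.
Proof.
move=> h1 h2; rewrite !mu_fracE //; split => e.
  have := mu_hom_inj (nzvR h1) (nzvR h2) e; rewrite -!intrM -intrB => /eqP.
  by rewrite intr_eq0 => /eqP.
by apply: mu_hom_eq; rewrite ?nzvR // -!intrM -intrB e.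
Qed.

Lemma frac_opp a b : nzv a b -> mu_frac R (- a) (- b) = mu_frac R a b.
Proof. by move=> h; apply/frac_eq => //; [rewrite /nzv !oppr_eq0 | ring]. Qed.

Lemma det_nzv a b c d : `|a * d - b * c| = 1 -> nzv a b /\ nzv c d.
Proof.
rewrite /nzv => h; split; apply/negPn; rewrite negb_or !negbK; apply/negP => /andP[/eqP e1
  /eqP e2]; move: h; rewrite e1 e2; lia.
Qed.

Lemma det_coprime a b c d : `|a * d - b * c| = 1 -> coprimez a b /\ coprimez c d.
Proof.
move=> h; have h' : a * d - b * c = 1 \/ a * d - b * c = - 1 by lia.
split; apply/coprimezP; case: h' => h'.
- by exists (d, - c) => /=; lia.
- by exists (- d, c) => /=; lia.
- by exists (- b, a) => /=; lia.
- by exists (b, - a) => /=; lia.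
Qed.

Lemma coprime_nzv a b : coprimez a b -> nzv a b.
Proof.
by rewrite /nzv -negb_and; apply: contraL => /andP[/eqP -> /eqP ->].
Qed.

(** No sign condition on the vectors: the absolute value of the determinant ignores signs, and this
    keeps the form stable under integral matrices. [farey_edgeP] restores nonnegative
    denominators. *)
Definition farey_pair x y := exists a b c d,
  [/\ `|a * d - b * c| = 1, x = mu_frac R a b & y = mu_frac R c d].

Lemma farey_pairC x y : farey_pair x y -> farey_pair y x.
Proof. by move=> [a [b [c [d [h -> ->]]]]]; exists c, d, a, b; split => //; lia. Qed.

Lemma farey_pair_circle x y : farey_pair x y -> [/\ circle x, circle y & x <> y].
Proof.
move=> [a [b [c [d [h -> ->]]]]]; split; try exact: circle_frac.
have [n1 n2] := det_nzv h; move=> /frac_eq => /(_ n1 n2) e; move: h; rewrite e; lia.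
Qed.

Lemma reduced_frac a b : coprimez a b -> exists a' b', reduced a' b' /\ mu_frac R a b =
  mu_frac R a' b' /\ ((a' = a /\ b' = b) \/ (a' = - a /\ b' = - b)).
Proof.
move=> h; case: (lerP 0 b) => b0; first by exists a, b; rewrite /reduced b0 h; auto.
exists (- a), (- b); rewrite frac_opp ?coprime_nzv // /reduced coprimezN coprimeNz h andbT;
  split; first lia.
by auto.
Qed.

Lemma farey_edgeP x y : circle x -> circle y -> x <> y ->
  farey_edges (ideal_arc x y) <-> farey_pair x y.
Proof.
move=> cx cy xy; split.
  move=> [a [b [c [d [ra rc h /ideal_arc_inj e]]]]].
  have F : farey_pair (mu_frac R a b) (mu_frac R c d) by exists a, b, c, d.
  have [? ? ?] := farey_pair_circle F.
  by case: e => // -[-> ->] //; exact: farey_pairC.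
move=> [a [b [c [d [h ex ey]]]]]; have [k1 k2] := det_coprime h.
have [a' [b' [r1 [e1 o1]]]] := reduced_frac k1; have [c' [d' [r2 [e2 o2]]]] := reduced_frac k2.
exists a', b', c', d'; split => //; last by rewrite ex ey e1 e2.
by case: o1 => -[-> ->]; case: o2 => -[-> ->]; lia.
Qed.

(** By the Plücker relation the product of the two determinants is [P1 * Q1 - P2 * Q2]. Crossing
    gives these two integers opposite nonzero signs, so the difference is at least [2] in absolute
    value, while the product has absolute value [1]. *)
Lemma farey_pair_nocross x y p q : farey_pair x y -> farey_pair p q -> cc y x p -> cc x y q
  -> False.
Proof.
move=> [a [b [c [d [h -> ->]]]]] [e [f [g [k [h' -> ->]]]]].
have [n1 n2] := det_nzv h; have [n3 n4] := det_nzv h'.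
rewrite !cc_frac //.
pose P1 := a * f - b * e; pose P2 := e * d - f * c.
pose Q1 := c * k - d * g; pose Q2 := g * b - k * a.
have E : (a * d - b * c) * (e * k - f * g) = P1 * Q1 - P2 * Q2 by rewrite /P1 /P2 /Q1 /Q2; ring.
have -> : (c * b - d * a) * (a * f - b * e) * (e * d - f * c) = - ((a * d - b * c) * (P1 *
  P2)) by rewrite /P1 /P2; ring.
have -> : (a * d - b * c) * (c * k - d * g) * (g * b - k * a) = (a * d - b * c) * (Q1 * Q2)
  by rewrite /Q1 /Q2; ring.
move: h h' E; move: (a * d - b * c) (e * k - f * g) P1 P2 Q1 Q2 => D D' P1 P2 Q1 Q2 h h' E l1
  l2.
have l3 : (P1 * P2) * (Q1 * Q2) < 0 by have [hD|hD] : D = 1 \/ D = -1 by [lia]; move: l1 l2;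
  rewrite hD; nia.
have l4 : (P1 * Q1) * (P2 * Q2) < 0 by rewrite (_ : _ * _ = (P1 * P2) * (Q1 * Q2)) //; ring.
have l5 : `|P1 * Q1 - P2 * Q2| = 1 by rewrite -E normrM h h'.
by move: l4 l5; move: (P1 * Q1) (P2 * Q2) => m n; nia.
Qed.

Lemma rational_frac z : rational_points z -> exists a b, coprimez a b /\ z = mu_frac R a b.
Proof.
move=> [[q|] _ <-]; last by exists 1, 0.
exists (numq q), (denq q); split; first by have := coprime_num_den q; rewrite coprimezE.
by rewrite /mu_rat /mu_frac /= (negbTE (denq_neq0 q)).
Qed.

Lemma gt1_mul_neq1 (k m : int) : 1 < k -> k * m = 1 -> False.
Proof. by case: (lerP m 0); nia. Qed.

(* In the basis [(x, v)] of determinant [1] the second endpoint is [k x + D v];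
   with [n] the integral part of [k / D] the Farey edge from [n x + v] to
   [(n + 1) x + v] separates the two points. *)
Lemma farey_pair_separates x y : rational_points x -> rational_points y -> x <> y -> ~
  farey_pair x y ->
  exists p q, [/\ farey_pair p q, cc q p x & cc p q y].
Proof.
move=> /rational_frac[a [b [k1 ->]]] /rational_frac[c0 [d0 [k2 ->]]] xy nf.
have [n1 n2] := (coprime_nzv k1, coprime_nzv k2).
have [c [d [k3 ey Dpos]]] : exists c d, [/\ coprimez c d, mu_frac R c0 d0 = mu_frac R c d & 0
  < a * d - b * c].
  case: (ltrgtP 0 (a * d0 - b * c0)) => D.
  - by exists c0, d0.
  - exists (- c0), (- d0); rewrite coprimezN coprimeNz frac_opp //; split => //.
    by rewrite (_ : _ - _ = - (a * d0 - b * c0)) ?oppr_gt0 //; ring.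
  - by case: xy; apply/frac_eq.
rewrite ey in xy nf *; have n3 := coprime_nzv k3.
have D2 : 1 < a * d - b * c.
  rewrite lt_neqAle; apply/andP; split; last by lia.
  by apply/eqP => e; apply: nf; exists a, b, c, d; split => //; rewrite -e.
have [e [f ef]] : exists e f, a * f - b * e = 1.
  by have /coprimezP[[r s] /= rs] := k1; exists (- s), r; lia.
pose D := a * d - b * c; pose k := c * f - d * e; pose n := (k %/ D)%Z; pose r := (k %% D)%Z.
have kE : k = n * D + r by exact: divz_eq.
have D0 : D != 0 by rewrite gt_eqF.
have r0 : 0 <= r by exact: modz_ge0.
have rD : r < D by rewrite /r -[X in _ < X]gtr0_norm // ltz_mod.
have cE : c = k * a + D * e by rewrite /k /D -[LHS]mulr1 -ef; ring.
have dE : d = k * b + D * f by rewrite /k /D -[LHS]mulr1 -ef; ring.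
(* If [D] divided [k], it would divide both coordinates [c] and [d], which are coprime. *)
have rn0 : r != 0.
  apply/eqP => r00; rewrite r00 addr0 in kE.
  have /coprimezP[[s t] /= st] := k3.
  have : D * (s * (n * a + e) + t * (n * b + f)) = 1 by rewrite -st cE dE kE; ring.
  exact: gt1_mul_neq1 D2.
pose q1 := n * a + e; pose q2 := n * b + f; pose p1 := (n + 1) * a + e; pose p2 := (n + 1) *
  b + f.
have qp : q1 * p2 - q2 * p1 = - 1.
  have -> : q1 * p2 - q2 * p1 = - (a * f - b * e) by rewrite /p1 /p2 /q1 /q2; ring.
  by rewrite ef.
have pq : p1 * q2 - p2 * q1 = 1.
  by move: qp; rewrite (mulrC q1) (mulrC q2); lia.
have hpq : `|p1 * q2 - p2 * q1| = 1 by rewrite pq.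
have [m1 m2] := det_nzv hpq.
exists (mu_frac R p1 p2), (mu_frac R q1 q2).
split; first by exists p1, p2, q1, q2.
  rewrite cc_frac // qp.
  have -> : p1 * b - p2 * a = - (a * f - b * e) by rewrite /p1 /p2; ring.
  have -> : a * q2 - b * q1 = a * f - b * e by rewrite /q1 /q2; ring.
  by rewrite ef.
rewrite cc_frac // pq.
have -> : q1 * d - q2 * c = - r.
  have -> : r = k - n * D by rewrite kE; ring.
  by rewrite /q1 /q2 /k /D; ring.
have -> : c * p2 - d * p1 = r - D.
  have -> : r = k - n * D by rewrite kE; ring.
  by rewrite /p1 /p2 /k /D; ring.
have rp : 0 < r by rewrite lt_neqAle eq_sym rn0.
by rewrite mul1r mulNr -mulrN opprB mulr_gt0 // subr_gt0.
Qed.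

(* The middle vertex of a Farey triangle is its vertex of greatest height. *)
Definition height z h := exists a b, [/\ coprimez a b, z = mu_frac R a b & h = `|a| + `|b|].

Lemma mul_eq1 k m : k * m = 1 -> k = 1 \/ k = - 1.
Proof.
case: (ltrgtP k 0) => [k0|k0|->]; last by rewrite mul0r.
  by case: (lerP 0 m) => m0 h; right; nia.
by case: (lerP m 0) => m0 h; left; nia.
Qed.

Lemma det0_coprime a b c d : coprimez a b -> coprimez c d -> a * d - b * c = 0 ->
  (a = c /\ b = d) \/ (a = - c /\ b = - d).
Proof.
move=> /coprimezP[[s t] /= st] /coprimezP[[u v] /= uv] e.
have e' : a * d = b * c by lia.
(* The ratio of the two vectors, read off with the Bezout coefficients of the first; it divides [1],
   so it is a sign. *)
pose m := s * c + t * d.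
have cE : c = m * a.
  rewrite -[LHS]mul1r -st mulrDl /m mulrDl -!mulrA [d * a]mulrC e' [c * a]mulrC.
  by rewrite [b * c]mulrC; ring.
have dE : d = m * b.
  rewrite -[LHS]mul1r -st mulrDl /m mulrDl -!mulrA e' [b * d]mulrC; ring.
have : m * (u * a + v * b) = 1 by rewrite -uv [in RHS]cE [in RHS]dE; ring.
move: (u * a + v * b) => k mk.
case: (mul_eq1 mk) => m1; [left | right].
  by rewrite cE dE m1 !mul1r.
by rewrite cE dE m1 !mulN1r !opprK.
Qed.

Lemma height_uniq z h h' : height z h -> height z h' -> h = h'.
Proof.
move=> [a [b [k1 -> ->]]] [c [d [k2 e ->]]].
move/(frac_eq (coprime_nzv k1) (coprime_nzv k2)): e.
by case/(det0_coprime k1 k2) => -[-> ->]; rewrite ?normrN.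
Qed.

Lemma farey_middle_height t v : farey_middle t v -> exists x y h1 h2,
  [/\ t = [set x; v; y], height x h1, height y h2, height v (h1 + h2) & (0 < h1) && (0 < h2)].
Proof.
move=> [a [b [c [d [[rab rcd h] [hb hd -> ->]]]]]].
have /andP[b0 kab] := rab; have /andP[d0 kcd] := rcd.
(* If both denominators are positive, numerators of opposite signs would give a determinant of
   absolute value at least [2]; otherwise this is the sign convention for infinity. It makes the
   heights add up. *)
have ac0 : 0 <= a * c by nia.
exists (mu_frac R a b), (mu_frac R c d), (`|a| + `|b|), (`|c| + `|d|); split => //.
- by exists a, b.
- by exists c, d.
- exists (a + c), (b + d); split => //; last first.
    have -> : `|a + c| = `|a| + `|c| by nia.
    by lia.
  have [] := @det_coprime a b (a + c) (b + d) => //.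
  by rewrite (_ : _ - _ = a * d - b * c) //; ring.
- by have := coprime_nzv kab; have := coprime_nzv kcd; rewrite /nzv => ? ?; apply/andP;
    split; lia.
Qed.

Lemma farey_middle_uniq t v v' : farey_middle t v -> farey_middle t v' -> v = v'.
Proof.
move=> /farey_middle_height[x [y [h1 [h2 [tE hx hy hv /andP[p1 p2]]]]]].
move=> /farey_middle_height[x' [y' [h1' [h2' [tE' hx' hy' hv' /andP[p1' p2']]]]]].
have : t v' by rewrite tE' /=; auto.
have : t v by rewrite tE /=; auto.
rewrite {1}tE' tE => -[[]|] /= e -[[]|] /= e' //; exfalso; subst.
all: repeat match goal with
  | H : height ?z ?h, H' : height ?z ?h' |- _ =>
     have := height_uniq H H'; clear H' end; lia.
Qed.

End Farey.

(** * Connectedness of dotted tessellations *)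

Section Applies.
Variables (X : choiceType) (S : Type) (step : X -> S -> S -> Prop).
Implicit Types (u v w : word X) (x y z : S).

Lemma applies_cat u v x y : applies step (u ++ v) x y <->
  exists2 z, applies step v x z & applies step u z y.
Proof.
elim: u y => [|[a b] u IH] y /=; first by split => [h|[z h <-]] //; exists y.
split=> [[z /IH[z' h1 h2] h3]|[z' h1 [z h2 h3]]].
  by exists z' => //; exists z.
by exists z => //; apply/IH; exists z'.
Qed.

Lemma applies_winv w x y : applies step w x y -> applies step (winv w) y x.
Proof.
elim: w y => [|[a b] w IH] y /=; first by move=> ->.
move=> [z /IH h1 h2]; rewrite /winv /= rev_cons -cats1; apply/applies_cat; exists z => //=.
by exists y => //; move: h2; case: b.
Qed.
End Applies.

(** * Moves on dotted tessellations *)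

Section Dotted.
Variable R : realType.
Implicit Types (X Y Z : dotted_tessellation R) (a b c d s t u v p q : C R) (i j k : ratx).

Definition reach X Y := exists w, applies (@dot_move R) w X Y.

Lemma reach_refl X : reach X X. Proof. by exists [::]. Qed.

Lemma reach_trans Y X Z : reach X Y -> reach Y Z -> reach X Z.
Proof. by move=> [w h] [w' h']; exists (w' ++ w); apply/applies_cat; exists Y. Qed.

Lemma reach_sym X Y : reach X Y -> reach Y X.
Proof. by move=> [w h]; exists (winv w); exact: applies_winv. Qed.

Lemma reach_step g X Y : dot_move g X Y -> reach X Y.
Proof. by move=> h; exists [:: (g, true)]; exists X. Qed.

Lemma dotted_eq X Y : dt_edges X = dt_edges Y -> dt_tri X = dt_tri Y ->
  dt_dot X = dt_dot Y -> X = Y.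
Proof.
case: X Y => E T D h1 h2 h3 h4 [E' T' D' h1' h2' h3' h4'] /= e1 e2 e3; subst.
by congr DottedTessellation; exact: Prop_irrelevance.
Qed.

Lemma dt_triangle X j : triangles (dt_edges X) (dt_tri X j).
Proof. by have [h _ _] := dt_tri_bij X; exact: h. Qed.

Lemma dt_label X T : triangles (dt_edges X) T -> exists j, dt_tri X j = T.
Proof. by have [_ _ h] := dt_tri_bij X; move=> /h[j _ <-]; exists j. Qed.

Lemma dt_tri_inj X i j : dt_tri X i = dt_tri X j -> i = j.
Proof. by have [_ h _] := dt_tri_bij X; apply: h; rewrite inE. Qed.

Lemma dt_dotP X j : exists a b c, [/\ circle a, circle b & circle c] /\
  [/\ dt_tri X j = [set a; b; c], cc a b c & dt_dot X j = a].
Proof.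
have [/triP[a [b [c [[ca cb ccc] [e h]]]]] _] := dt_triangle X j.
have := dt_dot_in X j; rewrite e => -[[]|] /= ->.
- by exists a, b, c.
- by exists b, c, a; split => //; split => //; [rewrite set3C | rewrite -ccC].
- by exists c, a, b; split => //; split => //; [rewrite -set3C | rewrite ccC].
Qed.

Lemma set_dot X j v : dt_tri X j v -> exists Y, [/\ dt_edges Y = dt_edges X,
  dt_tri Y = dt_tri X & forall i, dt_dot Y i = if i == j then v else dt_dot X i].
Proof.
move=> hv; have h i : dt_tri X i (if i == j then v else dt_dot X i).
  by case: eqP => [->|_] //; exact: dt_dot_in.
have f : finite_set [set i | ~ farey_middle (dt_tri X i) (if i == j then v else dt_dot X i)].
  apply: (@sub_finite_set _ _ ([set i | ~ farey_middle (dt_tri X i) (dt_dot X i)] `|` [set j])).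
    by move=> i /=; case: eqP => [->|_]; [right | left].
  by rewrite finite_setU; split; [exact: dt_farey | exact: finite_set1].
by exists (DottedTessellation (dt_tess X) (dt_tri_bij X) h f).
Qed.

(** A dot has three positions, reached by turning it zero, one or two times. *)
Lemma reach_dot X Y j : dt_edges Y = dt_edges X -> dt_tri Y = dt_tri X ->
  (forall i, i <> j -> dt_dot Y i = dt_dot X i) -> reach X Y.
Proof.
move=> eE eT eD; have [a [b [c [[ca cb ccc] [e h da]]]]] := dt_dotP X j.
have := dt_dot_in Y j; rewrite eT e => -[[]|] /= dv.
- suff -> : Y = X by exact: reach_refl.
  apply: dotted_eq => //; apply/funext => i.
  by have [->|/eD] := EM (i = j); rewrite ?dv ?da.
- apply: (@reach_step (K_A j)); split => //.
  by exists a, b, c; split => //; rewrite ccwcc.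
- have [|Z [zE zT zD]] := @set_dot X j b; first by rewrite e /=; auto.
  apply: (@reach_trans Z).
    apply: (@reach_step (K_A j)); split => //; first by move=> i /eqP/negbTE n; rewrite zD n.
    by exists a, b, c; rewrite zD eqxx ccwcc.
  apply: (@reach_step (K_A j)); split; [by rewrite eE zE | by rewrite eT zT | |].
    by move=> i n; rewrite eD // zD; move/eqP/negbTE: n => ->.
  exists b, c, a; rewrite zT zD eqxx ccwcc // -ccC; split => //.
  by rewrite -set3C.
Qed.

Lemma relabel X (s : ratx_perm) : exists Y, dt_edges Y = dt_edges X /\
  forall j, dt_tri Y (s j) = dt_tri X j /\ dt_dot Y (s j) = dt_dot X j.
Proof.
have [g sK gK] := proj2_sig s.
have hb : set_bij [set: ratx] (triangles (dt_edges X)) (dt_tri X \o g).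
  split.
  - by move=> i _; exact: dt_triangle.
  - by move=> i j _ _ /= /dt_tri_inj /(congr1 s); rewrite /perm_fun !gK.
  - by move=> T /dt_label[j <-]; exists (s j) => //=; rewrite /perm_fun sK.
have hd j : (dt_tri X \o g) j (dt_dot X (g j)) by exact: dt_dot_in.
have hf : finite_set [set j | ~ farey_middle ((dt_tri X \o g) j) (dt_dot X (g j))].
  apply: (@sub_finite_set _ _ (s @` [set i | ~ farey_middle (dt_tri X i) (dt_dot X i)])).
    by move=> i h; exists (g i) => //; rewrite /perm_fun gK.
  exact/finite_image/dt_farey.
exists (DottedTessellation (dt_tess X) hb hd hf); split => // j /=.
by rewrite /perm_fun sK.
Qed.

Section FlipDotted.
Variables (X : dotted_tessellation R) (j k : ratx) (v1 v2 v3 v4 : C R).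
Hypotheses (c1 : circle v1) (c2 : circle v2) (c3 : circle v3) (c4 : circle v4).
Hypotheses (h1 : cc v1 v2 v3) (h2 : cc v1 v3 v4).
Hypotheses (tj : dt_tri X j = [set v1; v2; v3]) (tk : dt_tri X k = [set v1; v3; v4]).

(** The new dots are arbitrary, since the same construction later provides images of tessellations
    under a flip and under its inverse, whose dots are prescribed differently. *)
Lemma flip_dotted d1 d2 : [set v1; v2; v4] d1 -> [set v2; v3; v4] d2 ->
  exists Y, [/\ dt_edges Y = flip_edges (dt_edges X) v1 v2 v3 v4,
    dt_tri Y j = [set v1; v2; v4] /\ dt_dot Y j = d1,
    dt_tri Y k = [set v2; v3; v4] /\ dt_dot Y k = d2 &
    forall i, i <> j -> i <> k -> dt_tri Y i = dt_tri X i /\ dt_dot Y i = dt_dot X i].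
Proof.
move=> hd1 hd2; have tE := dt_tess X.
have tT1 := dt_triangle X j; rewrite tj in tT1.
have tT2 := dt_triangle X k; rewrite tk in tT2.
have [v12 v23 v13] := cc_neq h1; have [_ v34 v14] := cc_neq h2.
have [h3 h4] := cc_trans h1 h2; have [_ v24 _] := cc_neq h3.
have jk : k <> j.
  move=> e; have : [set v1; v2; v3] v4 by rewrite -tj -e tk /=; auto.
  by case=> [[]|] /= /esym.
have e13 : edge (dt_edges X) v1 v3.
  by apply: edgeC; have [] := triangle_edges tE c1 c2 c3 h1 tT1.
(* The new diagonal crosses the old one, so neither new triangle occurred before and the labelling
   stays injective. *)
have n24 : ~ edge (dt_edges X) v2 v4.
  move=> e24; apply: (edges_nocross tE e13 e24) => //; by rewrite ccC.
have nT1 i : dt_tri X i <> [set v1; v2; v4].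
  move=> e; have := dt_triangle X i; rewrite e => t.
  by have [_ /n24] := triangle_edges tE c1 c2 c4 h3 t.
have nT2 i : dt_tri X i <> [set v2; v3; v4].
  move=> e; have := dt_triangle X i; rewrite e => t.
  by have [_ _ /edgeC/n24] := triangle_edges tE c2 c3 c4 h4 t.
have T12 : [set v1; v2; v4] <> [set v2; v3; v4].
  move=> e; have : [set v2; v3; v4] v1 by rewrite -e /=; auto.
  by case=> [[]|].
pose f i := if i == j then [set v1; v2; v4] else if i == k then [set v2; v3; v4] else dt_tri
  X i.
pose g i := if i == j then d1 else if i == k then d2 else dt_dot X i.
have FE := flip_trianglesE tE c1 c2 c3 c4 h1 h2 tT1 tT2.
have hb : set_bij [set: ratx] (triangles (flip_edges (dt_edges X) v1 v2 v3 v4)) f.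
  split.
  - move=> i _; apply/FE; rewrite /f; case: eqP => [_|ij]; first exact: Or31.
    case: eqP => [_|ik]; first exact: Or32.
    apply: Or33; split; first exact: dt_triangle.
      by rewrite -tj => /dt_tri_inj.
    by rewrite -tk => /dt_tri_inj.
  - move=> i i' _ _; rewrite /f.
    case: (eqVneq i j) => [e1|_]; case: (eqVneq i' j) => [e2|_];
      case: (eqVneq i k) => [e3|_]; case: (eqVneq i' k) => [e4|_] e.
    all: try congruence.
    exact: dt_tri_inj e.
  - move=> T /FE[->|->|[/dt_label[i <-] n1 n2]].
    + by exists j => //; rewrite /f eqxx.
    + by exists k => //; rewrite /f eqxx; move/eqP/negbTE: jk => ->.
    + exists i => //; rewrite /f; case: eqP => [e|_]; first by case: n1; rewrite e.
      by case: eqP => [e|_] //; case: n2; rewrite e.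
have hd i : f i (g i).
  by rewrite /f /g; case: eqP => // _; case: eqP => // _; exact: dt_dot_in.
have hf : finite_set [set i | ~ farey_middle (f i) (g i)].
  apply: (@sub_finite_set _ _ ([set i | ~ farey_middle (dt_tri X i) (dt_dot X i)] `|` [set j;
    k])).
    move=> i /=; rewrite /f /g; case: eqP => [->|_]; first by right; left.
    by case: eqP => [->|_]; [right; right | left].
  by rewrite finite_setU; split; [exact: dt_farey | exact: finite_set2].
exists (DottedTessellation (flip_tess tE c1 c2 c3 c4 h1 h2 tT1 tT2) hb hd hf); split => //=.
- by rewrite /f /g eqxx.
- by rewrite /f /g eqxx; move/eqP/negbTE: jk => ->.
- by move=> i /eqP/negbTE n1 /eqP/negbTE n2; rewrite /f /g n1 n2.
Qed.
End FlipDotted.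

(** The move [T] requires the dots at [v1] and [v4], so they are first turned there; this makes
    every edge flippable. *)
Lemma reach_flip X v1 v2 v3 v4 : circle v1 -> circle v2 -> circle v3 -> circle v4 ->
  cc v1 v2 v3 -> cc v1 v3 v4 ->
  triangles (dt_edges X) [set v1; v2; v3] -> triangles (dt_edges X) [set v1; v3; v4] ->
  exists2 Y, reach X Y & dt_edges Y = flip_edges (dt_edges X) v1 v2 v3 v4.
Proof.
move=> c1 c2 c3 c4 h1 h2 /dt_label[j tj] /dt_label[k tk].
have [v12 v23 v13] := cc_neq h1; have [_ v34 v14] := cc_neq h2.
have [h3 h4] := cc_trans h1 h2; have [_ v24 _] := cc_neq h3.
have jk : j != k.
  apply/eqP => e; have : [set v1; v2; v3] v4 by rewrite -tj e tk /=; auto.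
  by case=> [[]|] /= /esym.
have [|Y [yE yT yD]] := @set_dot X j v1; first by rewrite tj /=; auto.
have [|Z [zE zT zD]] := @set_dot Y k v4; first by rewrite yT tk /=; auto.
have rXZ : reach X Z.
  apply: (@reach_trans Y); first by apply: (@reach_dot X Y j) => // i /eqP/negbTE n; rewrite
    yD n.
  by apply: (@reach_dot Y Z k) => // i /eqP/negbTE n; rewrite zD n.
have zj : dt_tri Z j = [set v1; v2; v3] by rewrite zT yT.
have zk : dt_tri Z k = [set v1; v3; v4] by rewrite zT yT.
have [||W [wE [wj wdj] [wk wdk] wi]] := @flip_dotted Z j k v1 v2 v3 v4 c1 c2 c3 c4 h1 h2 zj
  zk v1 v4; [by left; left | by right |].
exists W; last by rewrite wE zE yE.
apply: reach_trans rXZ _; apply: (@reach_step (K_T jk)).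
exists v1, v2, v3, v4; rewrite !ccwcc //; split => //.
- by rewrite zj zD yD eqxx (negbTE jk).
- by rewrite zk zD eqxx.
Qed.

End Dotted.

(** * Flipping towards the Farey tessellation *)

Section Connect.
Variable R : realType.
Implicit Types (X Y Z : dotted_tessellation R) (a b c d s t u v w p q : C R) (i j k : ratx)
  (l : seq (arc R)).

Definition closed_left p q v := [\/ v = p, v = q | cc p q v].

(** A descent towards [s] through the triangles to the left: as long as the apex [u] is not [s], one
    of the sides [p u] and [u q] again separates [s] from [t]. It ends because [l] lists the
    separating edges ahead and each step leaves one of them behind. *)
Lemma apex_at (E : set (arc R)) s t p q l : tessellation E -> circle s -> circle t ->
  edge E p q -> cc p q s -> cc q p t ->
  (forall a b, edge E a b -> cc a b s -> cc b a t -> closed_left p q a -> closed_left p q b ->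
     ideal_arc a b \in l) ->
  exists p' q', [/\ edge E p' q', cc q' p' t, cc p' q' s & triangles E [set p'; q'; s]].
Proof.
move=> tE cs ct; have [n] := ubnP (size l); elim: n => // n IH in l p q *.
move=> /ltnSE sl epq hps hqt hl.
have [cp cq pq _] := epq; have [u [cu hu tu]] := left_triangle tE epq.
have [e|us] := EM (u = s); first by subst u; exists p, q.
have [_ equ eup] := triangle_edges tE cp cq cu hu tu.
have [_ qu pu] := cc_neq hu; have [_ qs ps] := cc_neq hps.
have inl : ideal_arc p q \in l by apply: hl => //; [exact: Or31 | exact: Or32].
have sz : (size [seq A <- l | A != ideal_arc p q] < n)%N.
  apply: leq_trans sl; rewrite size_filter -(count_predC (pred1 (ideal_arc p q)) l).
  by rewrite -[X in (X < _)%N]add0n ltn_add2r -has_count has_pred1.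
have keep p' q' : (forall v, closed_left p' q' v -> closed_left p q v) ->
    (~ closed_left p' q' p \/ ~ closed_left p' q' q) ->
    forall a b, edge E a b -> cc a b s -> cc b a t -> closed_left p' q' a -> closed_left p'
      q' b ->
     ideal_arc a b \in [seq A <- l | A != ideal_arc p q].
  move=> sub nn a b eab h1 h2 la lb; rewrite mem_filter hl ?andbT; try exact: sub; try by [].
  apply/eqP => e; have [ca cb ab _] := eab.
  by case: (ideal_arc_inj ca cb ab cp cq pq e) => -[ea eb]; subst a b; case: nn.
case: (cc_total cq cu cs qu us qs) => h.
- (* s is between u and p *)
  apply: (IH _ p u sz) => //; [exact: edgeC | | | apply: keep].
  + by clear -hu hps h; cyc_lra.
  + by clear -hu hqt; cyc_lra.
  + move=> v [->|->|hv]; [exact: Or31 | exact: Or33 | apply: Or33].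
    by clear -hu hv; cyc_lra.
  + right => -[|//|hv]; first exact: nesym.
    by clear -hu hv; cyc_lra.
- apply: (IH _ u q sz) => //; [exact: edgeC | | | apply: keep].
  + by clear -hu hps h; cyc_lra.
  + by clear -hu hqt; cyc_lra.
  + move=> v [->|->|hv]; [exact: Or33 | exact: Or32 | apply: Or33].
    by clear -hu hv; cyc_lra.
  + left => -[//|//|hv].
    by clear -hu hv; cyc_lra.
Qed.

Definition covers (E : set (arc R)) l := forall A, E A -> ~ @farey_edges R A -> A \in l.

Lemma tess_rational (E : set (arc R)) a b : tessellation E -> edge E a b -> rational_points a.
Proof.
move=> tE [ca cb ab Eab]; rewrite -(tess_vertices tE); exists (ideal_arc a b) => //.
by rewrite endpointsE //; left.
Qed.

(** Two lists are needed: [l] contains the edges that are not Farey, whose number must drop in the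
    end, and [l'] the edges crossing [s t], which drives the induction. The flip puts in an edge
    with end [s], and such an edge does not cross [s t]. *)
Lemma reach_farey_pair X s t l l' : farey_pair s t -> ~ dt_edges X (ideal_arc s t) ->
  covers (dt_edges X) l ->
  (forall a b, edge (dt_edges X) a b -> cc a b s -> cc b a t -> ideal_arc a b \in l') ->
  exists2 Y, reach X Y & exists2 l2, covers (dt_edges Y) l2 & (size l2 < size l)%N.
Proof.
move=> st; have [cs ct nst] := farey_pair_circle st.
have [n] := ubnP (size l'); elim: n => // n IH in X l l' * => /ltnSE sl' nE cl hl'.
have tE := dt_tess X; set E := dt_edges X in nE cl hl' tE.
have [a [b [eab h1 h2]]] := tess_maximal tE cs ct nst nE.
have [p [q [epq hqt hps tpqs]]] : exists p q, [/\ edge E p q, cc q p t, cc p q s & triangles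
  E [set p; q; s]].
  by apply: (@apex_at E s t b a l') => //; [exact: edgeC | move=> ? ? ? ? ? _ _; exact: hl'].
have [cp cq pq Epq] := epq; have [w [cw hw tw]] := left_triangle tE (edgeC epq).
have nf : ~ @farey_edges R (ideal_arc p q).
  by move/(farey_edgeP cp cq pq).1 => f; apply: (farey_pair_nocross f (farey_pairC st)).
have [||||Y rXY eY] := @reach_flip R X p w q s cp cw cq cs.
- by rewrite -ccC.
- by [].
- by rewrite -set3C.
- by [].
have hpws : cc p w s by clear -hps hw; cyc_lra.
have [pw ws ps] := cc_neq hpws.
have drop l0 : ideal_arc p q \in l0 -> (size [seq A <- l0 | A != ideal_arc p q] < size l0)%N.
  move=> inl; rewrite size_filter -[X in (_ < X)%N](count_predC (pred1 (ideal_arc p q)) l0).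
  by rewrite -[X in (X < _)%N]add0n ltn_add2r -has_count has_pred1.
have inl : ideal_arc p q \in l by exact: cl.
have inl' : ideal_arc p q \in l' by exact: hl'.
have EY A : dt_edges Y A -> A = ideal_arc w s \/ (E A /\ A != ideal_arc p q).
  by rewrite eY => -[[EA /eqP nA]|->]; [right | left].
have [wt|wt] := EM (w = t).
  exists Y => //; exists [seq A <- l | A != ideal_arc p q]; last exact: drop.
  move=> A /EY[->|[EA nA]] fA; last by rewrite mem_filter nA cl.
  by case: fA; rewrite wt; apply/farey_edgeP => //; [exact: nesym | exact: farey_pairC].
(* The new edge [w s] may fail to be Farey, but it takes the place of [p q] in the first list, which
   therefore does not grow. *)
have [||||Z rYZ [l3 c3 s3]] := IH Y (ideal_arc w s :: [seq A <- l | A != ideal_arc p q]) [seq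
  A <- l' | A != ideal_arc p q].
- exact: leq_trans (drop _ inl') sl'.
- move=> /EY[/ideal_arc_inj h|[EA _]]; last exact: nE.
  by case: (h cs ct nst cw cs ws) => -[? ?]; congruence.
- move=> A /EY[->|[EA nA]] fA; first exact: mem_head.
  by rewrite in_cons mem_filter nA cl ?orbT.
- move=> a' b' [ca cb ab /EY[e|[EA nA]]] k1 k2; last by rewrite mem_filter nA hl'.
  have [_ bs as'] := cc_neq k1.
  by case: (ideal_arc_inj ca cb ab cw cs ws e) => -[? ?]; congruence.
exists Z; first exact: reach_trans rYZ.
exists l3 => //; apply: leq_trans s3 _; exact: drop.
Qed.

Lemma reach_farey X : exists2 Y, reach X Y & dt_edges Y = @farey_edges R.
Proof.
have [l hl] : exists l, covers (dt_edges X) l.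
  have /finite_seqP[l el] := tess_farey (dt_tess X).
  exists l => A EA fA; have : (dt_edges X `\` @farey_edges R) A by [].
  by rewrite el.
have [n] := ubnP (size l); elim: n => // n IH in X l hl * => /ltnSE sl.
have tE := dt_tess X.
have [sub|/existsNP[A /not_implyP[EA fA]]] := EM (forall A, dt_edges X A -> @farey_edges R A).
  exists X; first exact: reach_refl.
  (* If all edges are Farey, none is missing: a missing one would be crossed by an edge of [X],
     itself Farey. *)
  apply/seteqP; split => A; [exact: sub | move=> fA; apply: contrapT => nE].
  move: (fA) => [a [b [c [d [ra rc h eA]]]]].
  have F : farey_pair (mu_frac R a b) (mu_frac R c d) by exists a, b, c, d.
  have [cx cy xy] := farey_pair_circle F; rewrite eA in nE.
  have [u [v [[cu cv uv Euv] h1 h2]]] := tess_maximal tE cx cy xy nE.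
  have f := (farey_edgeP cu cv uv).1 (sub _ Euv).
  exact: (farey_pair_nocross f F).
have [a [b [ca cb ab eA]]] := is_ideal_arcP (tess_arcs tE EA).
have eab : edge (dt_edges X) a b by split => //; rewrite -eA.
have nf : ~ farey_pair a b by move=> f; apply: fA; rewrite eA; apply/farey_edgeP.
have [p [q [F h1 h2]]] := farey_pair_separates (tess_rational tE eab) (tess_rational tE
  (edgeC eab)) ab nf.
have [cp cq pq] := farey_pair_circle F.
have nE : ~ dt_edges X (ideal_arc p q).
  by move=> Epq; apply: (@edges_nocross _ _ tE p q a b).
(* One list serves for both: an edge crossing the Farey edge [p q] is not Farey, hence already in
   [l]. *)
have [|Y rXY [l2 c2 s2]] := @reach_farey_pair X p q l l F nE hl.
  move=> a' b' [ca' cb' ab' E'] k1 k2; apply: hl => // /(farey_edgeP ca' cb' ab').1 f.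
  exact: (farey_pair_nocross f (farey_pairC F)).
have [|Z rYZ eZ] := IH Y l2 c2; first exact: leq_trans s2 sl.
by exists Z => //; exact: reach_trans rYZ.
Qed.

Lemma reach_same_tri X Y : dt_edges X = dt_edges Y -> dt_tri X = dt_tri Y -> reach X Y.
Proof.
move=> eE eT.
have [l hl] : exists l : seq ratx, forall j, dt_dot X j <> dt_dot Y j -> j \in l.
  have : finite_set ([set j | ~ farey_middle (dt_tri X j) (dt_dot X j)] `|` [set j | ~
    farey_middle (dt_tri Y j) (dt_dot Y j)]).
    by rewrite finite_setU; split; exact: dt_farey.
  move=> /finite_seqP[l el]; exists l => j n.
  suff : [set` l] j by [].
  rewrite -el; have [m1|m1] := EM (farey_middle (dt_tri X j) (dt_dot X j)); last by left.
  right => /=; rewrite -eT => m2; apply: n; exact: farey_middle_uniq m1 m2.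
elim: l X hl eE eT => [|j l IH] X hl eE eT.
  suff -> : X = Y by exact: reach_refl.
  by apply: dotted_eq => //; apply/funext => j; apply: contrapT => /hl.
have [|Z [zE zT zD]] := @set_dot R X j (dt_dot Y j); first by rewrite eT; exact: dt_dot_in.
apply: (@reach_trans _ Z).
  by apply: (@reach_dot _ X Z j) => // i /eqP/negbTE n; rewrite zD n.
apply: IH; [|by rewrite zE | by rewrite zT].
move=> i; rewrite zD; case: eqP => [-> //|n h].
by have := hl i h; rewrite in_cons => /orP[/eqP|].
Qed.

Lemma reach_same_edges X Y : dt_edges X = dt_edges Y -> reach X Y.
Proof.
move=> eE.
have hg j : exists i, dt_tri Y i = dt_tri X j by apply: dt_label; rewrite -eE; exact:
  dt_triangle.
have hf j : exists i, dt_tri X i = dt_tri Y j by apply: dt_label; rewrite eE; exact: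
  dt_triangle.
pose g j := sval (cid (hg j)); pose f j := sval (cid (hf j)).
have gE j : dt_tri Y (g j) = dt_tri X j := svalP (cid (hg j)).
have fE j : dt_tri X (f j) = dt_tri Y j := svalP (cid (hf j)).
have gb : bijective g.
  by exists f => j; [apply: (@dt_tri_inj _ X); rewrite fE gE | apply: (@dt_tri_inj _ Y);
    rewrite gE fE].
pose s : ratx_perm := exist _ g gb.
have [Z [zE zP]] := relabel X s.
apply: (@reach_trans _ Z); first by apply: (@reach_step _ (K_P s)).
apply: reach_same_tri; first by rewrite zE.
apply/funext => i; have [f' gK fK] := gb.
by rewrite -(fK i) gE; have [] := zP (f' i).
Qed.

Theorem dotted_connected X Y : reach X Y.
Proof.
have [X' rX eX] := reach_farey X; have [Y' rY eY] := reach_farey Y.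
apply: reach_trans rX (reach_trans _ (reach_sym rY)).
by apply: reach_same_edges; rewrite eX eY.
Qed.

End Connect.

(** * The action of M *)

Section MAction.
Variable R : realType.
Implicit Types (X Y Z : dotted_tessellation R) (x y z a b c d u v : C R) (i j k : ratx).

Definition M_class (phi : C R -> C R) : set (C R -> C R) :=
  [set psi | M_homeo psi /\ disc_homotopic phi psi].

Variable phi : C R -> C R.
Hypothesis phiM : M_homeo phi.
Hypothesis phi_cc : forall x y z, circle x -> circle y -> circle z ->
  cc x y z -> cc (phi x) (phi y) (phi z).

Local Notation m := (M_class phi).

Lemma M_class_group : M_group m.
Proof. by exists phi. Qed.

Lemma homeo_circle psi z : M_homeo psi -> circle z -> circle (psi z).
Proof.
move=> [_ _ _ [s [h1 h2]]] /circleP[r ->].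
by have [pc pcs hr] := h1 r; have [_ ->] := h2 pc pcs; first exact: circle_mu.
Qed.

Lemma homeo_disc psi z : M_homeo psi -> disc z -> disc (psi z).
Proof. by move=> [_ [h _ _] _ _]; exact: h. Qed.

Lemma circle_closed z : circle z -> closed_disc z.
Proof. by rewrite /circle /closed_disc /= => ->. Qed.

Lemma phi_in_class : m phi.
Proof.
split => //; exists (fun sz => phi sz.2); have [pc _ _ _] := phiM; split => //.
- apply: (@within_comp (R * C R)%type (C R) (C R) (`[0, 1] `*` @closed_disc R)%classic
    (@closed_disc R) snd phi _ pc).
    by apply: continuous_subspaceT => v; exact: cvg_snd.
  by move=> v [].
- by move=> s z _ dz; exact: homeo_disc.
Qed.

(** Homotopies are constant on the circle, so the action of a class on vertices can be computed with
    the representative [phi]. *)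
Lemma class_circle psi z : m psi -> circle z -> psi z = phi z.
Proof.
move=> [_ [H [_ H0 _ H1]]] cz; have o01 : 0 <= (1 : R) <= 1 by apply/andP; split; lra.
by have [_ <-] := H0 z (circle_closed cz); rewrite H1.
Qed.

Lemma phi_inj x y : circle x -> circle y -> phi x = phi y -> x = y.
Proof.
move=> cx cy e; apply: contrapT => xy; have [u cu h] := exists_left cx cy xy.
by have [+ _ _] := cc_neq (phi_cc cx cy cu h); rewrite e.
Qed.

Lemma phi_circle x : circle x -> circle (phi x).
Proof. exact: homeo_circle. Qed.

Lemma M_pointE x y : circle x -> M_point m x y <-> y = phi x.
Proof.
move=> cx; split; first by move=> [psi ps ->]; exact: class_circle.
by move=> ->; exists phi => //; exact: phi_in_class.
Qed.

Lemma M_triangleE (t : set (C R)) : t `<=` @circle R -> M_triangle m t = phi @` t.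
Proof.
move=> tc; apply/seteqP; split => y; first by move=> [x tx /M_pointE ->]; [exists x | exact:
  tc].
by move=> [x tx <-]; exists x => //; apply/M_pointE => //; exact: tc.
Qed.

Lemma M_triangle3 x y z : circle x -> circle y -> circle z ->
  M_triangle m [set x; y; z] = [set phi x; phi y; phi z].
Proof.
move=> cx cy cz; rewrite M_triangleE; last by move=> w /= [[]|] ->.
apply/seteqP; split => w /=; first by move=> [v [[]|] -> <-]; auto.
by case=> [[]|] ->; [exists x | exists y | exists z]; auto.
Qed.

Lemma M_arcE x y : circle x -> circle y -> x <> y ->
  M_arc m (ideal_arc x y) = ideal_arc (phi x) (phi y).
Proof.
move=> cx cy xy; have pxy : phi x <> phi y by move/phi_inj => h; apply: xy; exact: h.
have [cpx cpy] := (phi_circle cx, phi_circle cy).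
have key psi p : m psi -> arc_of x y p -> arc_class (psi \o p) = arc_of (phi x) (phi y).
  move=> mpsi [[pc p0 p1 p01 pd] e].
  have e0 : psi (p 0) = phi (p 0) by exact: class_circle.
  have e1 : psi (p 1) = phi (p 1) by exact: class_circle.
  have [hpsi _] := mpsi; have [cpsi _ _ _] := hpsi.
  rewrite arc_classE.
    by rewrite /= e0 e1; case: e => -[-> ->] //; rewrite arc_ofC.
  split => /=; rewrite ?e0 ?e1.
  - apply: (@within_comp R (C R) (C R) (`[0, 1]%classic) (@closed_disc R) p psi pc cpsi).
    move=> t; rewrite itv01 => /andP[t0 t1].
    have [->|n0] := eqVneq t 0; first exact: circle_closed.
    have [->|n1] := eqVneq t 1; first exact: circle_closed.
    by rewrite /closed_disc /=; apply/ltW/pd; rewrite !lt_neqAle t0 t1 n1 eq_sym n0.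
  - exact: phi_circle.
  - exact: phi_circle.
  - by move=> h; apply: p01; exact: phi_inj h.
  - by move=> t /pd; exact: homeo_disc.
rewrite ideal_arcE // ideal_arcE //; apply/seteqP; split => q.
  by move=> [psi [p [mpsi ap]]]; rewrite (key psi p).
have al : arc_of x y (line_path x y).
  by split; [exact: disc_path_line | rewrite line_path0 line_path1; left].
by move=> aq; exists phi, (line_path x y); split => //; [exact: phi_in_class | rewrite (key _
  _ phi_in_class al)].
Qed.

Definition M_edges (E : set (arc R)) : set (arc R) := M_arc m @` E.

Lemma dt_tri_circle X j : dt_tri X j `<=` @circle R.
Proof.
by have [a [b [c [[ca cb ccc] [-> _ _]]]]] := dt_dotP X j; move=> v [[]|] /= ->.
Qed.

Lemma dt_dot_circle X j : circle (dt_dot X j).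
Proof. exact: dt_tri_circle (dt_dot_in X j). Qed.

Lemma M_dottedE X X' : M_dotted m X X' <->
  [/\ dt_edges X' = M_edges (dt_edges X), forall j, dt_tri X' j = M_triangle m (dt_tri X j)
     & forall j, dt_dot X' j = phi (dt_dot X j)].
Proof.
split=> [[h1 h2]|[h1 h2 h3]].
  split => // j; have [? ] := h2 j; first by [].
  by move=> /M_pointE; apply; exact: dt_dot_circle.
by split => // j; split => //; apply/M_pointE => //; exact: dt_dot_circle.
Qed.

Lemma M_dotted_uniq X Y Z : M_dotted m X Y -> M_dotted m X Z -> Y = Z.
Proof.
move=> /M_dottedE[a1 a2 a3] /M_dottedE[b1 b2 b3]; apply: dotted_eq; first by rewrite a1 b1.
  by apply/funext => j; rewrite a2 b2.
by apply/funext => j; rewrite a3 b3.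
Qed.

Lemma M_edges_flip (E : set (arc R)) v1 v2 v3 v4 : E `<=` @is_ideal_arc R ->
  circle v1 -> circle v2 -> circle v3 -> circle v4 -> v1 <> v3 -> v2 <> v4 ->
  M_edges (flip_edges E v1 v2 v3 v4) = flip_edges (M_edges E) (phi v1) (phi v2) (phi v3) (phi
    v4).
Proof.
move=> EI c1 c2 c3 c4 v13 v24.
have p13 : phi v1 <> phi v3 by move/phi_inj => h; apply: v13; exact: h.
apply/seteqP; split => A.
  move=> [B [[EB nB]|->] <-]; last by right; rewrite /= M_arcE.
  left; split; first by exists B.
  have [a [b [ca cb ab eB]]] := is_ideal_arcP (EI _ EB).
  rewrite /= eB M_arcE // => /ideal_arc_inj h; apply: nB => /=.
  have pab : phi a <> phi b by move/phi_inj => h'; apply: ab; exact: h'.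
  case: (h (phi_circle ca) (phi_circle cb) pab (phi_circle c1) (phi_circle c3) p13) =>
    -[/phi_inj e1 /phi_inj e2]; rewrite eB e1 // e2 //.
  by rewrite ideal_arcC //; exact: nesym.
move=> [[[B EB <-] n]|->].
  exists B => //; left; split => // eB; apply: n; rewrite /= eB M_arcE //.
by exists (ideal_arc v2 v4); [right | rewrite M_arcE].
Qed.

(** The second flip is the first one for the quadrilateral rotated by one vertex, where the new
    diagonal takes the role of the old. *)
Lemma flipK (E : set (arc R)) v1 v2 v3 v4 : circle v1 -> circle v3 -> v1 <> v3 ->
  E (ideal_arc v1 v3) -> ~ E (ideal_arc v2 v4) ->
  flip_edges (flip_edges E v1 v2 v3 v4) v2 v3 v4 v1 = E.
Proof.
move=> c1 c3 v13 E13 n24; apply/seteqP; split => A.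
  move=> [[[[EA _] //|/= ->] /= []] //|/= ->].
  by rewrite ideal_arcC //; exact: nesym.
move=> EA; have [e|n] := EM (A = ideal_arc v1 v3); first by right; rewrite /= e ideal_arcC.
by left; split; [left | move=> /= e; apply: n24; rewrite -e].
Qed.

End MAction.

(** * Transport of moves by M *)

Section MMoves.
Variable R : realType.
Implicit Types (X Y Z : dotted_tessellation R) (x y z a b c d u v : C R) (i j k : ratx).
Variable phi : C R -> C R.
Hypothesis phiM : M_homeo phi.
Hypothesis phi_cc : forall x y z, circle x -> circle y -> circle z ->
  cc x y z -> cc (phi x) (phi y) (phi z).

Local Notation m := (M_class phi).
Let M3 := M_triangle3 phiM.
Let pcirc := phi_circle phiM.

Lemma phi_ccw x y z : circle x -> circle y -> circle z ->
  ccw x y z -> ccw (phi x) (phi y) (phi z).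
Proof.
move=> cx cy cz; rewrite !ccwcc //; try exact: pcirc.
exact: phi_cc.
Qed.

Lemma dt_tri3 X j a b c : dt_tri X j = [set a; b; c] -> [/\ circle a, circle b & circle c].
Proof. by move=> e; split; apply: (@dt_tri_circle _ X j); rewrite e /=; auto. Qed.

(** Moves are described by vertices, ideal arcs and orientations only, and [phi] respects all
    three. *)
Lemma M_step g X Y X' Y' : dot_move g X Y -> M_dotted m X X' -> M_dotted m Y Y' ->
  dot_move g X' Y'.
Proof.
move=> st /(M_dottedE phiM)[x1 x2 x3] /(M_dottedE phiM)[y1 y2 y3]; case: g st => [j|j k jk|s]
  /=.
- move=> [eE eT eD [a [b [c [eabc h da db]]]]].
  have [ca cb ccc] := dt_tri3 eabc; split.
  + by rewrite x1 y1 eE.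
  + by apply/funext => i; rewrite x2 y2 eT.
  + by move=> i n; rewrite x3 y3 eD.
  + exists (phi a), (phi b), (phi c); rewrite x2 x3 y3 eabc da db M3 //; split => //.
    exact: phi_ccw.
- move=> [v1 [v2 [v3 [v4 [[h1 h2] [tj dj] [tk dk] [eE [tj' dj'] [tk' dk'] ei]]]]]].
  have [c1 c2 c3] := dt_tri3 tj; have [_ _ c4] := dt_tri3 tk.
  have [k1 k2] : cc v1 v2 v3 /\ cc v1 v3 v4 by rewrite -!ccwcc.
  have [h3 h4] := cc_trans k1 k2; have [_ v24 _] := cc_neq h3; have [_ _ v13] := cc_neq k1.
  exists (phi v1), (phi v2), (phi v3), (phi v4).
  rewrite !x2 !y2 !x3 !y3 tj dj tk dk tj' dj' tk' dk' !M3 //; split => //.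
    by split; exact: phi_ccw.
  split => //; last by move=> i n1 n2; rewrite x2 x3 y2 y3; have [-> ->] := ei i n1 n2.
  rewrite y1 eE x1; apply: M_edges_flip => //; exact: tess_arcs (dt_tess X).
- move=> [eE h]; split; first by rewrite y1 eE x1.
  by move=> j; rewrite y2 x2 y3 x3; have [-> ->] := h j.
Qed.

Lemma M_relabel X Y X' (s : ratx_perm) : dt_edges Y = dt_edges X ->
  (forall j, dt_tri Y (s j) = dt_tri X j /\ dt_dot Y (s j) = dt_dot X j) ->
  M_dotted m X X' -> exists Y', M_dotted m Y Y'.
Proof.
move=> eE h /(M_dottedE phiM)[x1 x2 x3]; have [Y' [e' h']] := relabel X' s.
have [g sK gK] := proj2_sig s.
exists Y'; apply/(M_dottedE phiM); split; first by rewrite e' x1 eE.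
  move=> j; rewrite -(gK j); have [-> _] := h' (g j); have [-> _] := h (g j); exact: x2.
move=> j; rewrite -(gK j); have [_ ->] := h' (g j); have [_ ->] := h (g j); exact: x3.
Qed.

Lemma M_redot X Y X' j : dt_edges Y = dt_edges X -> dt_tri Y = dt_tri X ->
  (forall i, i <> j -> dt_dot Y i = dt_dot X i) ->
  M_dotted m X X' -> exists Y', M_dotted m Y Y'.
Proof.
move=> eE eT eD /(M_dottedE phiM)[x1 x2 x3].
have [|Y' [e' t' d']] := @set_dot _ X' j (phi (dt_dot Y j)).
  rewrite x2 (M_triangleE phiM); last exact: dt_tri_circle.
  by exists (dt_dot Y j) => //; rewrite -eT; exact: dt_dot_in.
exists Y'; apply/(M_dottedE phiM); split; first by rewrite e' x1 eE.
  by move=> i; rewrite t' x2 eT.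
by move=> i; rewrite d'; case: eqP => [->|n] //; rewrite x3 eD.
Qed.

Lemma M_flip X Y X' j k v1 v2 v3 v4 : 
  cc v1 v2 v3 -> cc v1 v3 v4 ->
  dt_tri X j = [set v1; v2; v3] -> dt_tri X k = [set v1; v3; v4] ->
  dt_edges Y = flip_edges (dt_edges X) v1 v2 v3 v4 ->
  dt_tri Y j = [set v1; v2; v4] -> dt_tri Y k = [set v2; v3; v4] ->
  (forall i, i <> j -> i <> k -> dt_tri Y i = dt_tri X i /\ dt_dot Y i = dt_dot X i) ->
  M_dotted m X X' -> exists Y', M_dotted m Y Y'.
Proof.
move=> h1 h2 tj tk eE tj' tk' ei /(M_dottedE phiM)[x1 x2 x3].
have [c1 c2 c3] := dt_tri3 tj; have [_ _ c4] := dt_tri3 tk.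
have [h3 h4] := cc_trans h1 h2; have [_ v24 _] := cc_neq h3; have [_ _ v13] := cc_neq h1.
have uj : dt_tri X' j = [set phi v1; phi v2; phi v3] by rewrite x2 tj M3.
have uk : dt_tri X' k = [set phi v1; phi v3; phi v4] by rewrite x2 tk M3.
have inM (Z : dotted_tessellation R) i a b c : dt_tri Z i = [set a; b; c] -> [set phi a; phi
  b; phi c] (phi (dt_dot Z i)).
  by move=> e; have := dt_dot_in Z i; rewrite e => -[[]|] /= ->; auto.
have [Y' [e' [t1 d1] [t2 d2] ti]] := flip_dotted (pcirc c1) (pcirc c2) (pcirc c3) (pcirc c4)
  (phi_cc c1 c2 c3 h1) (phi_cc c1 c3 c4 h2) uj uk (inM _ _ _ _ _ tj') (inM _ _ _ _ _ tk').
exists Y'; apply/(M_dottedE phiM); split.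
- by rewrite e' x1 eE M_edges_flip //; exact: tess_arcs (dt_tess X).
- move=> i; have [->|nj] := EM (i = j); first by rewrite t1 tj' M3.
  have [->|nk] := EM (i = k); first by rewrite t2 tk' M3.
  by have [-> _] := ti i nj nk; have [-> _] := ei i nj nk.
- move=> i; have [->|nj] := EM (i = j); first by rewrite d1.
  have [->|nk] := EM (i = k); first by rewrite d2.
  by have [_ ->] := ti i nj nk; have [_ ->] := ei i nj nk.
Qed.

(** As [m . X] is only a relation, the image of a neighbour of [X] has to be built as a
    tessellation: by performing on [X'] the corresponding change of dots, labels or diagonal. Both
    directions occur because words contain inverse letters. *)
Lemma M_exists g X Y X' : dot_move g X Y \/ dot_move g Y X -> M_dotted m X X' ->
  exists Y', M_dotted m Y Y'.
Proof.
move=> st hX; case: g st => [j|j k jk|s] /=.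
- case=> -[eE eT eD _]; apply: (@M_redot X Y X' j) => // i n.
  by rewrite eD.
- case.
    move=> [v1 [v2 [v3 [v4 [[h1 h2] [tj dj] [tk dk] [eE [tj' dj'] [tk' dk'] ei]]]]]].
    have [c1 c2 c3] := dt_tri3 tj; have [_ _ c4] := dt_tri3 tk.
    rewrite !ccwcc // in h1 h2.
    exact: (@M_flip X Y X' j k v1 v2 v3 v4).
  move=> [v1 [v2 [v3 [v4 [[h1 h2] [tj dj] [tk dk] [eE [tj' dj'] [tk' dk'] ei]]]]]].
  have [c1 c2 c3] := dt_tri3 tj; have [_ _ c4] := dt_tri3 tk.
  rewrite !ccwcc // in h1 h2.
  have [h3 h4] := cc_trans h1 h2; have [_ v24 _] := cc_neq h3; have [_ _ v13] := cc_neq h1.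
  have tT1 := dt_triangle Y j; rewrite tj in tT1.
  have e13 : edge (dt_edges Y) v1 v3.
    by apply: edgeC; have [] := triangle_edges (dt_tess Y) c1 c2 c3 h1 tT1.
  have n24 : ~ dt_edges Y (ideal_arc v2 v4).
    move=> e24; apply: (edges_nocross (dt_tess Y) e13 (_ : edge _ v2 v4)) => //; by rewrite ccC.
  (* Undoing the flip exchanges the labels of the two triangles. *)
  have [Z [zE zP]] := relabel Y (perm_swap j k).
  have zj : dt_tri Z j = dt_tri Y k.
    by have [<- _] := zP k; rewrite /= /swap eqxx eq_sym (negbTE jk).
  have zk : dt_tri Z k = dt_tri Y j.
    by have [<- _] := zP j; rewrite /= /swap eqxx.
  have zi i : i <> j -> i <> k -> dt_tri Z i = dt_tri Y i /\ dt_dot Z i = dt_dot Y i.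
    by move=> /eqP/negbTE n1 /eqP/negbTE n2; have := zP i; rewrite /= /swap n1 n2.
  have [||||||||Z' hZ'] := @M_flip X Z X' k j v2 v3 v4 v1 _ _ _ _ _ _ _ _ hX.
  + by [].
  + by rewrite -ccC.
  + by [].
  + by rewrite -set3C.
  + rewrite zE eE flipK //; by case: e13.
  + by rewrite zk tj set3C.
  + by rewrite zj tk set3C.
  + move=> i n1 n2; have [-> ->] := zi i n2 n1; by have [-> ->] := ei i n2 n1.
  apply: (@M_relabel Z Y Z' (perm_swap j k)) => // i.
  by have := zP (swap j k i); rewrite /= swapK => -[-> ->].
- case=> -[eE h]; first exact: (@M_relabel X Y X' s).
  have [g sK gK] := proj2_sig s.
  have gb : bijective g by exists s.
  apply: (@M_relabel X Y X' (exist _ g gb)) => // j.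
  by have := h (g j); rewrite /perm_fun /= gK => -[-> ->].
Qed.

Lemma M_applies_ex w X Y X' : applies (@dot_move R) w X Y -> M_dotted m X X' ->
  exists2 Y', M_dotted m Y Y' & applies (@dot_move R) w X' Y'.
Proof.
elim: w Y => [|[g b] w IH] Y /=; first by move=> <- hX; exists X'.
move=> [Z h st] hX; have [Z' hZ hw] := IH Z h hX.
have [|Y' hY] := @M_exists g Z Y Z' _ hZ; first by case: b st; auto.
exists Y' => //; exists Z' => //; case: b st => st; [exact: (M_step st hZ hY) | exact:
  (M_step st hY hZ)].
Qed.

Lemma M_applies w X Y X' Y' : applies (@dot_move R) w X Y -> M_dotted m X X' -> M_dotted m Y
  Y' ->
  applies (@dot_move R) w X' Y'.
Proof.
move=> h hX hY; have [Y'' hY'' hw] := M_applies_ex h hX.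
by rewrite (M_dotted_uniq phiM hY hY'').
Qed.

End MMoves.

(** * Radial extensions of homographies *)

Section Moebius.
Variable R : realType.
Implicit Types (z w : C R) (a b r s : R).
Local Notation Re := (@complex.Re R).
Local Notation Im := (@complex.Im R).

Lemma near_dist (u : C R) (e : R[i]) : 0 < e -> \forall v \near u, `|u - v| < e.
Proof. by move=> e0; apply/nbhs_ballP; exists e. Qed.

Lemma Re_continuous : continuous (fun z : C R => Re z).
Proof.
move=> u; apply: (iffRL (@cvgrPdist_lt _ _ _ (nbhs u) (nbhs_filter u) (fun z => Re z) (Re
  u))) => e e0.
have h : \forall v \near u, `|u - v| < e%:C%C by apply: near_dist; rewrite ltcR.
apply: filterS h => v h.
have := le_lt_trans (normc_ge_Re (u - v)) h; rewrite ltcR.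
by case: (u) (v) => ? ? [? ?].
Qed.

Lemma cvg_scale (T : Type) (F : set_system T) (FF : Filter F) (f : T -> C R) (k z : C R) :
  f @ F --> z -> (fun v => k * f v) @ F --> k * z.
Proof. by move=> cf; apply: (@cvgM _ T F FF (fun=> k) f _ _ _ cf); exact: cvg_cst. Qed.

Lemma Im_continuous : continuous (fun z : C R => Im z).
Proof.
have -> : (fun z : C R => Im z) = (fun z : C R => Re z) \o (fun z : C R => (0 -i* 1)%C * z).
  by apply/funext => -[x y] /=; ring.
move=> u; apply: (@continuous_comp (C R) (C R) R (fun z : C R => (0 -i* 1)%C * z) (fun z =>
  Re z) u).
  exact: (@cvg_scale _ (nbhs u) (nbhs_filter u) id _ _ (@cvg_id _ (nbhs u))).
exact: Re_continuous.
Qed.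

Lemma cplx_norm r : 0 <= r -> `|cplx r| = cplx r :> C R.
Proof. by move=> r0; rewrite /cplx normc_def /= expr0n addr0 sqrtr_sqr ger0_norm. Qed.

Lemma circle_mu_homP z : circle z -> exists a b, ((a != 0) || (b != 0)) /\ z = mu_hom a b.
Proof.
move=> /circleP[r ->]; rewrite mu_hom_mu; case: r => [s|]; [exists s, 1 | exists 1, 0];
by rewrite oner_eq0 ?orbT.
Qed.

Lemma normC_real z : exists2 r, 0 <= r & `|z| = cplx r.
Proof. by exists (Num.sqrt (Re z ^+ 2 + Im z ^+ 2)); rewrite ?sqrtr_ge0 // normc_def. Qed.

Lemma cplx_neq0 r : r != 0 -> cplx r != 0 :> C R.
Proof. by rewrite eq_complex /= eqxx andbT. Qed.

Lemma polarP z : exists r a b, [/\ 0 <= r, (a != 0) || (b != 0) & z = cplx r * mu_hom a b].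
Proof.
have [r r0 nz] := normC_real z; have [r00|rn0] := eqVneq r 0.
  exists 0, 1, 0; rewrite oner_eq0; split => //.
  have -> : cplx 0 = 0 :> C R by [].
  by rewrite mul0r; apply/eqP; rewrite -normr_eq0 nz r00.
have cn0 := cplx_neq0 rn0.
have [|a [b [ab e]]] := @circle_mu_homP (z / cplx r).
  by rewrite /circle /= normrM normfV (cplx_norm r0) nz divff.
by exists r, a, b; split => //; rewrite -e mulrC divfK.
Qed.

Lemma norm_polar r a b : 0 <= r -> (a != 0) || (b != 0) -> `|cplx r * mu_hom a b| = cplx r.
Proof.
by move=> r0 ab; rewrite normrM cplx_norm // (_ : `|mu_hom a b| = 1) ?mulr1 //; exact:
  circle_mu_hom.
Qed.

(** With [zeta = a + i b], the point [mu_hom a b] is the conjugate of [zeta] divided by [zeta]. *)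
Lemma mu_hom_zeta a b : (a != 0) || (b != 0) -> mu_hom a b * Complex a b = Complex a (- b).
Proof.
move=> /sqD_neq0 n; apply/eqP; rewrite /mu_hom eq_complex /=; apply/andP; split; apply/eqP;
  field; exact: n.
Qed.

(* The projective action of the matrix [[al, be], [ga, de]] of determinant [1] in
   the disc model, extended radially: it preserves the norm. *)
Definition radial_moebius (al be ga de : R) (z : C R) : C R :=
  `|z| * ((Complex (al + de) (be - ga) * z + Complex (al - de) (- (be + ga)) * `|z|) /
          (Complex (al - de) (be + ga) * z + Complex (al + de) (ga - be) * `|z|)).

(** The square norms of the two coefficients differ by four times the determinant, so the two terms
    cannot cancel. *)
Lemma radial_moebius_den (al be ga de : R) z : al * de - be * ga = 1 -> z != 0 ->
  Complex (al - de) (be + ga) * z + Complex (al + de) (ga - be) * `|z| != 0.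
Proof.
move=> D z0; rewrite addr_eq0; apply/eqP => /(congr1 Num.norm).
have nz : `|z| != 0 by rewrite normr_eq0.
rewrite normrN !normrM normr_id => /(mulIf nz) /(congr1 (fun w : R[i] => w ^+ 2)).
rewrite !normsqE => /(congr1 (@complex.Re R)) /= h.
have : (al * de - be * ga) * 4 = 0.
  have -> : (al * de - be * ga) * 4 =
    ((al + de) ^+ 2 + (ga - be) ^+ 2) - ((al - de) ^+ 2 + (be + ga) ^+ 2) by ring.
  by rewrite h subrr.
by rewrite D mul1r => /eqP; rewrite pnatr_eq0.
Qed.

Lemma nz_mat (al be ga de a b : R) : al * de - be * ga = 1 -> (a != 0) || (b != 0) ->
  (al * a + be * b != 0) || (ga * a + de * b != 0).
Proof.
move=> D; rewrite -!negb_and; apply: contra => /andP[/eqP e1 /eqP e2].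
have ea : de * (al * a + be * b) - be * (ga * a + de * b) = a by rewrite -[RHS]mul1r -D; ring.
have eb : al * (ga * a + de * b) - ga * (al * a + be * b) = b by rewrite -[RHS]mul1r -D; ring.
by move: ea eb; rewrite e1 e2 !mulr0 subrr => <- <-; rewrite eqxx.
Qed.

(** This explains the coefficients: if [zeta = a + i b] and [zeta'] is its image under the matrix,
    [2 * zeta'] is a complex combination of [zeta] and its conjugate with the coefficients of the
    denominator, and the numerator is treated likewise for the conjugate of [zeta']. *)
Lemma radial_moebius_polar (al be ga de r a b : R) : al * de - be * ga = 1 -> 0 <= r -> (a !=
  0) || (b != 0) ->
  radial_moebius al be ga de (cplx r * mu_hom a b) = cplx r * mu_hom (al * a + be * b) (ga *
    a + de * b).
Proof.
move=> D r0 ab; rewrite /radial_moebius norm_polar //; have [->|rn0] := eqVneq r 0.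
  by have -> : cplx 0 = 0 :> C R by []; rewrite !mul0r.
congr (_ * _); have z0 : cplx r * mu_hom a b != 0.
  by rewrite -normr_eq0 norm_polar // cplx_neq0.
have := radial_moebius_den D z0; rewrite norm_polar // => dn; apply: (mulIf dn); rewrite
  divfK //.
have cn0 := cplx_neq0 rn0.
have ab' : Complex a b != 0 :> C R by rewrite eq_complex /= negb_and.
have ab'' := nz_mat D ab.
apply: (mulfI cn0); apply: (mulIf ab').
have h := mu_hom_zeta ab; have h' := mu_hom_zeta ab''.
move: h h'; set u := mu_hom a b; set u' := mu_hom (_ + _) _ => h h'.
have -> : cplx r * (Complex (al + de) (be - ga) * (cplx r * u) + Complex (al - de) (- (be +
  ga)) * cplx r) * Complex a b
  = cplx r ^+ 2 * (Complex (al + de) (be - ga) * (u * Complex a b) + Complex (al - de) (- (be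
    + ga)) * Complex a b) by ring.
have -> : cplx r * (u' * (Complex (al - de) (be + ga) * (cplx r * u) + Complex (al + de) (ga
  - be) * cplx r)) * Complex a b
  = cplx r ^+ 2 * (u' * (Complex (al - de) (be + ga) * (u * Complex a b) + Complex (al + de)
    (ga - be) * Complex a b)) by ring.
rewrite h; congr (_ * _).
have -> : Complex (al - de) (be + ga) * Complex a (- b) + Complex (al + de) (ga - be) *
  Complex a b = 2 * Complex (al * a + be * b) (ga * a + de * b).
  by apply/eqP; rewrite eq_complex /=; apply/andP; split; apply/eqP; ring.
rewrite mulrCA h'.
by apply/eqP; rewrite eq_complex /=; apply/andP; split; apply/eqP; ring.
Qed.

Lemma radial_moebius_norm (al be ga de : R) z : al * de - be * ga = 1 -> `|radial_moebius al
  be ga de z| = `|z|.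
Proof.
move=> D; have [r [a [b [r0 ab ->]]]] := polarP z.
by rewrite radial_moebius_polar // !norm_polar // nz_mat.
Qed.

Lemma radial_moebius_cvg (T : Type) (F : set_system T) (FF : Filter F) (f : T -> C R) (al be
  ga de : R) z :
  al * de - be * ga = 1 -> z != 0 -> f @ F --> z ->
  (fun v => radial_moebius al be ga de (f v)) @ F --> radial_moebius al be ga de z.
Proof.
move=> D z0 cf.
have cn : (fun v => `|f v| : C R) @ F --> (`|z| : C R) by exact: cvg_norm.
have cl (k l : C R) : (fun v => k * f v + l * `|f v| : C R) @ F --> (k * z + l * `|z| : C R).
  by apply: (@cvgD _ (C R) T F FF (fun v => k * f v) (fun v => l * `|f v|)); exact: cvg_scale.
have cv := @cvgV _ T F FF _ _ (radial_moebius_den D z0) (cl _ _).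
exact: (@cvgM _ T F FF (fun v => `|f v|) _ _ _ cn (@cvgM _ T F FF _ _ _ _ (cl _ _) cv)).
Qed.

Lemma radial_moebius_continuous (al be ga de : R) : al * de - be * ga = 1 -> continuous
  (radial_moebius al be ga de).
Proof.
(* At [0] the quotient is [0 / 0]; continuity there comes from the invariance of the norm. *)
move=> D z; have [->|z0] := eqVneq z 0.
  have m0 : radial_moebius al be ga de 0 = 0 by apply/eqP; rewrite -normr_eq0
    radial_moebius_norm // normr0.
  apply: (iffRL (@cvgrPdist_lt _ _ _ (nbhs (0 : C R)) (nbhs_filter _) (radial_moebius al be
    ga de) _)) => e e0.
  rewrite m0; have h : \forall v \near (0 : C R), `|0 - v| < e by exact: near_dist.
  by apply: filterS h => v; rewrite !sub0r !normrN radial_moebius_norm.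
exact: (@radial_moebius_cvg _ (nbhs z) (nbhs_filter z) id _ _ _ _ _ D z0 (@cvg_id _ (nbhs z))).
Unshelve. all: by end_near. Qed.

End Moebius.

(** * The homeomorphism attached to alpha *)

Section Alpha.
Variable R : realType.
Implicit Types (z w : C R) (a b r s : R).
Local Notation Re := (@complex.Re R).
Local Notation Im := (@complex.Im R).

Lemma mu_homN a b : mu_hom (- a) (- b) = mu_hom a b.
Proof. by rewrite -[RHS](@mu_homZ R (-1)) ?mulN1r // oppr_eq0 oner_eq0. Qed.

Lemma polar_nonneg z : exists r a b, [/\ 0 <= r, 0 <= b, (a != 0) || (b != 0) & z = cplx r *
  mu_hom a b].
Proof.
have [r [a [b [r0 ab ->]]]] := polarP z.
case: (lerP 0 b) => b0; first by exists r, a, b.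
exists r, (- a), (- b); rewrite mu_homN !oppr_eq0; split => //.
by rewrite oppr_ge0 ltW.
Qed.

Lemma polar_sign r a b : 0 < r -> (a != 0) || (b != 0) ->
  exists2 k, 0 < k & Re (cplx r * mu_hom a b) = k * (a ^+ 2 - b ^+ 2) /\ Im (cplx r * mu_hom
    a b) = - (k * (2 * (a * b))).
Proof.
move=> r0 /sqD_gt0 n; exists (r / (a ^+ 2 + b ^+ 2)); first by rewrite divr_gt0.
by rewrite /cplx /mu_hom /=; split; field; rewrite gt_eqF.
Qed.

Lemma radial_moebius0 (al be ga de : R) : radial_moebius al be ga de 0 = 0.
Proof. by rewrite /radial_moebius normr0 mul0r. Qed.

Lemma polar0 a b : cplx 0 * mu_hom a b = 0.
Proof. by have -> : cplx 0 = 0 :> C R by []; rewrite mul0r. Qed.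

(* The quadrants of the disc correspond to the arcs [0, 1], [1, oo], [oo, -1] and
   [-1, 0] of [RP^1]. *)
Lemma quadrant1P z : Re z <= 0 -> Im z <= 0 ->
  exists r a b, [/\ 0 <= r, (a != 0) || (b != 0), 0 <= a <= b & z = cplx r * mu_hom a b].
Proof.
have [r [a [b [r0 b0 ab ->]]]] := polar_nonneg z; have [->|rn] := eqVneq r 0.
  by exists 0, 0, 1; rewrite !polar0 oner_eq0 orbT lexx ler01.
have [|k k0 [-> ->]] := @polar_sign r a b _ ab; first by rewrite lt_neqAle eq_sym rn.
rewrite pmulr_rle0 // oppr_le0 pmulr_rge0 // pmulr_rge0 // subr_le0 => h1 h2.
have a0 : 0 <= a.
  have [b00|bn] := eqVneq b 0; last by rewrite pmulr_lge0 // lt_neqAle eq_sym bn in h2.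
  move: h1; rewrite b00 expr0n /= => h1; have /eqP : a ^+ 2 = 0 by apply/le_anti; rewrite h1
    sqr_ge0.
  by rewrite sqrf_eq0 => /eqP ->.
by exists r, a, b; split => //; rewrite a0 /= -(@ler_pXn2r _ 2) ?nnegrE.
Qed.

Lemma quadrant2P z : 0 <= Re z -> Im z <= 0 ->
  exists r a b, [/\ 0 <= r, (a != 0) || (b != 0), 0 <= b <= a & z = cplx r * mu_hom a b].
Proof.
have [r [a [b [r0 b0 ab ->]]]] := polar_nonneg z; have [->|rn] := eqVneq r 0.
  by exists 0, 1, 0; rewrite !polar0 oner_eq0 lexx ler01.
have [|k k0 [-> ->]] := @polar_sign r a b _ ab; first by rewrite lt_neqAle eq_sym rn.
rewrite pmulr_rge0 // oppr_le0 pmulr_rge0 // pmulr_rge0 // subr_ge0 => h1 h2.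
have [b00|bn] := eqVneq b 0.
  subst b; case: (lerP 0 a) => a0; first by exists r, a, 0; split => //; rewrite lexx.
  exists r, (- a), 0; split => //; first by rewrite oppr_eq0.
    by rewrite lexx oppr_ge0 ltW.
  by rewrite -[mu_hom (- a) 0]mu_homN opprK oppr0.
have a0 : 0 <= a by rewrite pmulr_lge0 // lt_neqAle eq_sym bn in h2.
by exists r, a, b; split => //; rewrite b0 /= -(@ler_pXn2r _ 2) ?nnegrE.
Qed.

(** Complex conjugation is [x |-> - x] on the real projective line; it reduces the quadrants with
    nonnegative imaginary part to the other two. *)
Lemma conj_polar r a b : Complex (Re (cplx r * mu_hom a b)) (- Im (cplx r * mu_hom a b)) =
  cplx r * mu_hom (- a) b.
Proof.
apply: complex_ext; rewrite /cplx /mu_hom /= sqrrN ?mulrN ?mulNr ?oppr0; ring.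
Qed.

Lemma quadrant4P z : Re z <= 0 -> 0 <= Im z ->
  exists r a b, [/\ 0 <= r, (a != 0) || (b != 0), 0 <= - a <= b & z = cplx r * mu_hom a b].
Proof.
case: z => x y /= hx hy; have [||r [a [b [r0 ab h e]]]] := @quadrant1P (Complex x (- y)) => //=.
  by rewrite oppr_le0.
exists r, (- a), b; rewrite opprK oppr_eq0; split => //.
by rewrite -conj_polar -e /= opprK.
Qed.

Lemma quadrant3P z : 0 <= Re z -> 0 <= Im z ->
  exists r a b, [/\ 0 <= r, (a != 0) || (b != 0), 0 <= b <= - a & z = cplx r * mu_hom a b].
Proof.
case: z => x y /= hx hy; have [||r [a [b [r0 ab h e]]]] := @quadrant2P (Complex x (- y)) => //=.
  by rewrite oppr_le0.
exists r, (- a), b; rewrite opprK oppr_eq0; split => //.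
by rewrite -conj_polar -e /= opprK.
Qed.

(** In the order of the branches, the homographies [1 / (1 - x)], [x / (1 - x)], [- (x + 1) / x] and
    [x + 1]. *)
Definition phi_alpha z : C R :=
  if Im z <= 0 then
    if Re z <= 0 then radial_moebius 0 1 (-1) 1 z else radial_moebius (-1) 0 1 (-1) z
  else if 0 <= Re z then radial_moebius 1 1 (-1) 0 z else radial_moebius 1 1 0 1 z.

Lemma phi_alpha1 r a b : 0 <= r -> (a != 0) || (b != 0) -> 0 <= a <= b ->
  phi_alpha (cplx r * mu_hom a b) = cplx r * mu_hom b (b - a).
Proof.
rewrite le0r => /orP[/eqP ->|r0] ab /andP[a0 b0].
  by rewrite !polar0 /phi_alpha /= lexx radial_moebius0.
have [k k0 [er ei]] := polar_sign r0 ab.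
have b0' : 0 <= b by exact: le_trans b0.
rewrite /phi_alpha er ei oppr_le0 pmulr_rge0 // mulr_ge0 ?mulr_ge0 // pmulr_rle0 // subr_le0.
rewrite (ler_pXn2r _ a0 b0') // b0 radial_moebius_polar ?ltW //; last by ring.
by congr (_ * mu_hom _ _); ring.
Qed.

Lemma phi_alpha2 r a b : 0 <= r -> (a != 0) || (b != 0) -> 0 <= b <= a ->
  phi_alpha (cplx r * mu_hom a b) = cplx r * mu_hom (- a) (a - b).
Proof.
rewrite le0r => /orP[/eqP ->|r0] ab /andP[b0 a0].
  by rewrite !polar0 /phi_alpha /= lexx radial_moebius0.
have [k k0 [er ei]] := polar_sign r0 ab.
have a0' : 0 <= a by exact: le_trans a0.
rewrite /phi_alpha er ei oppr_le0 pmulr_rge0 // mulr_ge0 ?mulr_ge0 // pmulr_rle0 // subr_le0.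
(* On the common boundary [a = b] the definition selects the first homography, which agrees there
   with the second. *)
rewrite (ler_pXn2r _ a0' b0) //; case: ifP => h.
  have e : a = b by apply/le_anti; rewrite h.
  subst b; rewrite radial_moebius_polar ?ltW //; last by ring.
  by rewrite -mu_homN; congr (_ * mu_hom _ _); ring.
rewrite radial_moebius_polar ?ltW //; last by ring.
by congr (_ * mu_hom _ _); ring.
Qed.

Lemma phi_alpha3 r a b : 0 <= r -> (a != 0) || (b != 0) -> 0 <= b <= - a ->
  phi_alpha (cplx r * mu_hom a b) = cplx r * mu_hom (a + b) (- a).
Proof.
rewrite le0r => /orP[/eqP ->|r0] ab /andP[b0 a0].
  by rewrite !polar0 /phi_alpha /= lexx radial_moebius0.
have [k k0 [er ei]] := polar_sign r0 ab.
have a0' : 0 <= - a by exact: le_trans a0.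
rewrite /phi_alpha er ei oppr_le0 !(pmulr_rge0 _ k0) (pmulr_rge0 _ (ltr0Sn R 1)) (pmulr_rle0
  _ k0) subr_ge0 subr_le0 -[a ^+ 2]sqrrN.
rewrite (ler_pXn2r _ b0 a0') // a0; case: ifP => h.
  have ab0 : a * b = 0 by apply/le_anti; rewrite h andbT -oppr_ge0 -mulNr mulr_ge0.
  have an : a != 0.
    by apply: contraTneq ab => a00; subst a; move: a0; rewrite oppr0 eqxx negbK => h';
      apply/eqP/le_anti; rewrite h' b0.
  have b00 : b = 0 by apply: (mulfI an); rewrite mulr0.
  subst b; rewrite (ler_pXn2r _ a0' (lexx 0)) // ifN; last first.
    by rewrite oppr_le0 -ltNge lt_neqAle an -oppr_ge0.
  rewrite radial_moebius_polar ?ltW //; last by ring.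
  by rewrite -mu_homN; congr (_ * mu_hom _ _); ring.
rewrite radial_moebius_polar ?ltW //; last by ring.
by congr (_ * mu_hom _ _); ring.
Qed.

Lemma phi_alpha4 r a b : 0 <= r -> (a != 0) || (b != 0) -> 0 <= - a <= b ->
  phi_alpha (cplx r * mu_hom a b) = cplx r * mu_hom (a + b) b.
Proof.
rewrite le0r => /orP[/eqP ->|r0] ab /andP[a0 b0].
  by rewrite !polar0 /phi_alpha /= lexx radial_moebius0.
have [k k0 [er ei]] := polar_sign r0 ab.
have b0' : 0 <= b by exact: le_trans b0.
rewrite /phi_alpha er ei oppr_le0 !(pmulr_rge0 _ k0) (pmulr_rge0 _ (ltr0Sn R 1)) (pmulr_rle0
  _ k0) subr_ge0 subr_le0 -[a ^+ 2]sqrrN.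
rewrite (ler_pXn2r _ a0 b0') // b0; case: ifP => h.
  have ab0 : a * b = 0 by apply/le_anti; rewrite h andbT -oppr_ge0 -mulNr mulr_ge0.
  have bn : b != 0.
    by apply: contraTneq ab => b00; subst b; rewrite eqxx orbF negbK -oppr_eq0;
      apply/eqP/le_anti; rewrite a0 b0.
  have a00 : a = 0 by apply: (mulIf bn); rewrite mul0r.
  subst a; rewrite radial_moebius_polar ?ltW //; last by ring.
  by congr (_ * mu_hom _ _); ring.
rewrite (ler_pXn2r _ b0' a0) //; case: ifP => h2.
  have e : - a = b by apply/le_anti; rewrite h2 b0.
  subst b; rewrite radial_moebius_polar ?ltW //; last by ring.
  by congr (_ * mu_hom _ _); ring.
rewrite radial_moebius_polar ?ltW //; last by ring.
by congr (_ * mu_hom _ _); ring.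
Qed.

End Alpha.

(** * The two maps as elements of M *)

Section Homeos.
Variable R : realType.
Implicit Types (z w x y : C R) (a b c r s : R).
Local Notation Re := (@complex.Re R).
Local Notation Im := (@complex.Im R).
Local Notation phi_alpha := (@phi_alpha R).

Definition phi_beta : C R -> C R := radial_moebius (-1) (-1) 1 0.

Lemma disc_norm z w : `|z| = `|w| -> disc w -> disc z.
Proof. by rewrite /disc /= => ->. Qed.

(** Meant for maps of finite order, where [psi] is an iterate of [phi]; invariance of the norm keeps
    both inside the disc. *)
Lemma homeo_of_iter (phi psi : C R -> C R) : continuous phi -> continuous psi ->
  (forall z, `|phi z| = `|z|) -> (forall z, `|psi z| = `|z|) ->
  cancel phi psi -> cancel psi phi -> piecewise_PSL2Z phi -> M_homeo phi.
Proof.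
move=> cphi cpsi nphi npsi k1 k2 pw; split; [exact: (continuous_subspaceT cphi) | split | |
  exact: pw].
- by move=> z; apply: disc_norm.
- by move=> z w _ _ /(congr1 psi); rewrite !k1.
- by move=> z dz; exists (psi z); [exact: disc_norm dz | exact: k2].
- by exists psi; [exact: (continuous_subspaceT cpsi) | move=> z _; exact: k1].
Qed.

Lemma nz_lin a b c r : (c = 0 -> r = 0 -> a = 0 /\ b = 0) -> (a != 0) || (b != 0) -> (c != 0)
  || (r != 0).
Proof.
move=> h; rewrite -!negb_and; apply: contra => /andP[/eqP c0 /eqP r0].
by have [-> ->] := h c0 r0; rewrite eqxx.
Qed.

Lemma phi_alpha_norm z : `|phi_alpha z| = `|z|.
Proof.
by rewrite /phi_alpha; do !case: ifP => _; rewrite radial_moebius_norm //; ring.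
Qed.

(** Each branch maps its quadrant to the next one, and its lift to vectors is signed so that four
    steps bring [(a, b)] back to itself. *)
Lemma phi_alpha4K z : phi_alpha (phi_alpha (phi_alpha (phi_alpha z))) = z.
Proof.
case: (lerP (Re z) 0) => [h|/ltW h]; case: (lerP (Im z) 0) => [h'|/ltW h'].
- have [r [a [b [r0 ab /andP[h1 h2] ->]]]] := quadrant1P h h'.
  rewrite phi_alpha1 ?h1 // phi_alpha2 //; [|by apply: nz_lin ab => ? ?; split; lra|by
    apply/andP; split; lra].
  rewrite phi_alpha3 //; [|by apply: nz_lin ab => ? ?; split; lra|by apply/andP; split; lra].
  rewrite phi_alpha4 //; [|by apply: nz_lin ab => ? ?; split; lra|by apply/andP; split; lra].
  by congr (_ * mu_hom _ _); ring.
- have [r [a [b [r0 ab /andP[h1 h2] ->]]]] := quadrant4P h h'.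
  rewrite phi_alpha4 ?h1 // phi_alpha1 //; [|by apply: nz_lin ab => ? ?; split; lra|by
    apply/andP; split; lra].
  rewrite phi_alpha2 //; [|by apply: nz_lin ab => ? ?; split; lra|by apply/andP; split; lra].
  rewrite phi_alpha3 //; [|by apply: nz_lin ab => ? ?; split; lra|by apply/andP; split; lra].
  by congr (_ * mu_hom _ _); ring.
- have [r [a [b [r0 ab /andP[h1 h2] ->]]]] := quadrant2P h h'.
  rewrite phi_alpha2 ?h1 // phi_alpha3 //; [|by apply: nz_lin ab => ? ?; split; lra|by
    apply/andP; split; lra].
  rewrite phi_alpha4 //; [|by apply: nz_lin ab => ? ?; split; lra|by apply/andP; split; lra].
  rewrite phi_alpha1 //; [|by apply: nz_lin ab => ? ?; split; lra|by apply/andP; split; lra].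
  by congr (_ * mu_hom _ _); ring.
- have [r [a [b [r0 ab /andP[h1 h2] ->]]]] := quadrant3P h h'.
  rewrite phi_alpha3 ?h1 // phi_alpha4 //; [|by apply: nz_lin ab => ? ?; split; lra|by
    apply/andP; split; lra].
  rewrite phi_alpha1 //; [|by apply: nz_lin ab => ? ?; split; lra|by apply/andP; split; lra].
  rewrite phi_alpha2 //; [|by apply: nz_lin ab => ? ?; split; lra|by apply/andP; split; lra].
  by congr (_ * mu_hom _ _); ring.
Qed.

(** Pasting over the four closed quadrants, on each of which a single homography describes the map,
    boundary included. *)
Lemma phi_alpha_continuous : continuous phi_alpha.
Proof.
have cRl : closed [set z : C R | Re z <= 0].
  exact: (proj1 (continuous_closedP _) (@Re_continuous R) _ (@closed_le _ 0)).
have cRg : closed [set z : C R | 0 <= Re z].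
  exact: (proj1 (continuous_closedP _) (@Re_continuous R) _ (@closed_ge _ 0)).
have cIl : closed [set z : C R | Im z <= 0].
  exact: (proj1 (continuous_closedP _) (@Im_continuous R) _ (@closed_le _ 0)).
have cIg : closed [set z : C R | 0 <= Im z].
  exact: (proj1 (continuous_closedP _) (@Im_continuous R) _ (@closed_ge _ 0)).
have key (Q : set (C R)) (al be ga de : R) : al * de - be * ga = 1 ->
    (forall z, Q z -> radial_moebius al be ga de z = phi_alpha z) -> {within Q, continuous
      phi_alpha}.
  move=> D h; apply: (@subspace_eq_continuous _ Q _ (radial_moebius al be ga de)).
    by move=> z; rewrite inE; exact: h.
  exact: (continuous_subspaceT (radial_moebius_continuous D)).
have Q1 : {within [set z : C R | Re z <= 0] `&` [set z | Im z <= 0], continuous phi_alpha}.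
  apply: (key _ 0 1 (-1) 1); first by ring.
  move=> z [/= h h']; have [r [a [b [r0 ab h1 ->]]]] := quadrant1P h h'.
  by rewrite phi_alpha1 // radial_moebius_polar //; [congr (_ * mu_hom _ _); ring | ring].
have Q2 : {within [set z : C R | 0 <= Re z] `&` [set z | Im z <= 0], continuous phi_alpha}.
  apply: (key _ (-1) 0 1 (-1)); first by ring.
  move=> z [/= h h']; have [r [a [b [r0 ab h1 ->]]]] := quadrant2P h h'.
  by rewrite phi_alpha2 // radial_moebius_polar //; [congr (_ * mu_hom _ _); ring | ring].
have Q3 : {within [set z : C R | 0 <= Re z] `&` [set z | 0 <= Im z], continuous phi_alpha}.
  apply: (key _ 1 1 (-1) 0); first by ring.
  move=> z [/= h h']; have [r [a [b [r0 ab h1 ->]]]] := quadrant3P h h'.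
  by rewrite phi_alpha3 // radial_moebius_polar //; [congr (_ * mu_hom _ _); ring | ring].
have Q4 : {within [set z : C R | Re z <= 0] `&` [set z | 0 <= Im z], continuous phi_alpha}.
  apply: (key _ 1 1 0 1); first by ring.
  move=> z [/= h h']; have [r [a [b [r0 ab h1 ->]]]] := quadrant4P h h'.
  by rewrite phi_alpha4 // radial_moebius_polar //; [congr (_ * mu_hom _ _); ring | ring].
apply/continuous_subspace_setT.
have -> : [set: C R] = ([set z | Re z <= 0] `&` [set z | Im z <= 0] `|` [set z | 0 <= Re z]
  `&` [set z | Im z <= 0]) `|`
   ([set z | 0 <= Re z] `&` [set z | 0 <= Im z] `|` [set z | Re z <= 0] `&` [set z | 0 <= Im
     z]).
  apply/esym/seteqP; split => // z _ /=.
  by case: (lerP (Re z) 0) => [h|/ltW h]; case: (lerP (Im z) 0) => [h'|/ltW h'];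
    [left; left | right; right | left; right | right; left].
by apply: withinU_continuous; [apply: closedU; exact: closedI | apply: closedU; exact: closedI
  | apply: withinU_continuous => //; exact: closedI | apply: withinU_continuous => //; exact:
    closedI].
Qed.

Lemma phi_beta3K z : phi_beta (phi_beta (phi_beta z)) = z.
Proof.
have D : (-1) * 0 - (-1) * 1 = 1 :> R by ring.
have [r [a [b [r0 ab ->]]]] := polarP z.
rewrite /phi_beta radial_moebius_polar // radial_moebius_polar //; last by apply: nz_lin ab
  => ? ?; split; lra.
rewrite radial_moebius_polar //; last by apply: nz_lin ab => ? ?; split; lra.
by congr (_ * mu_hom _ _); ring.
Qed.

Lemma mu_hom_cplx1 a b : mu_hom a b = cplx 1 * mu_hom a b.
Proof. by have -> : cplx 1 = 1 :> C R by []; rewrite mul1r. Qed.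

Definition mat (a b c d : int) : 'M[int]_2 :=
  \matrix_(i, j) if i == 0 then (if j == 0 then a else b) else (if j == 0 then c else d).

Lemma det_mat (a b c d : int) : \det (mat a b c d) = a * d - b * c.
Proof.
rewrite (expand_det_row _ 0) !big_ord_recl big_ord0 /cofactor !det_mx11 !mxE /=.
by rewrite addr0 expr0 expr1 mul1r mulN1r mulrN.
Qed.

(** In homogeneous coordinates the case distinctions of [moebius] at infinity disappear. *)
Lemma mu_moebius (al be ga de : int) (t : RP1 R) (a b : R) : al * de - be * ga = 1 ->
  (a != 0) || (b != 0) -> mu t = mu_hom a b ->
  mu (moebius (mat al be ga de) t) = mu_hom (al%:~R * a + be%:~R * b) (ga%:~R * a + de%:~R * b).
Proof.
move=> D ab e.
have D' : (al%:~R * de%:~R - be%:~R * ga%:~R : R) = 1 by rewrite -!intrM -intrB D.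
have -> : mu_hom (al%:~R * a + be%:~R * b) (ga%:~R * a + de%:~R * b) =
   radial_moebius al%:~R be%:~R ga%:~R de%:~R (mu_hom a b) by rewrite (mu_hom_cplx1 a b)
     radial_moebius_polar // -mu_hom_cplx1.
rewrite -e; case: t e => [s|] _.
  have s1 : (s != 0) || ((1 : R) != 0) by rewrite oner_eq0 orbT.
  rewrite (mu_hom_mu (Some s)) (mu_hom_cplx1 s 1) radial_moebius_polar // -mu_hom_cplx1 !mulr1.
  rewrite mu_hom_mu /moebius !mxE /=.
  have := nz_mat D' s1; rewrite !mulr1; case: (eqVneq (ga%:~R * s + de%:~R) 0) => [->|n] /=.
    by rewrite ?eqxx ?orbF => n; rewrite mu_hom_inf.
  by move=> _; rewrite [RHS]mu_hom_frac.
have s1 : ((1 : R) != 0) || ((0 : R) != 0) by rewrite oner_eq0.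
rewrite (mu_hom_mu None) (mu_hom_cplx1 1 0) radial_moebius_polar // -mu_hom_cplx1 !mulr1
  !mulr0 !addr0.
rewrite mu_hom_mu /moebius !mxE /=.
have := nz_mat D' s1; rewrite !mulr1 !mulr0 !addr0; case: (eqVneq (ga%:~R : R) 0) => [->|n] /=.
  by rewrite ?eqxx ?orbF => n; rewrite mu_hom_inf.
by move=> _; rewrite [RHS]mu_hom_frac.
Qed.

Lemma cc_mu_hom1 a b c : cc (mu_hom a 1) (mu_hom b 1) (mu_hom c 1) = cyc a b c.
Proof.
by rewrite cc_mu_hom ?oner_eq0 ?orbT // -prod_cyc !mulr1 !mul1r.
Qed.

Lemma cc_mu_hom_inf b c : cc (mu_hom 1 0) (mu_hom b 1) (mu_hom c 1) = (b < c).
Proof.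
rewrite cc_mu_hom ?oner_eq0 ?orbT // !mulr1 !mul1r !mul0r mulr0 subr0 mul1r sub0r mulrN1
  oppr_gt0.
by rewrite subr_lt0.
Qed.

End Homeos.

Local Arguments mu : simpl never.

Section Homeos2.
Variable R : realType.
Implicit Types (z w x y : C R) (a b c r s p q : R).
Local Notation phi_alpha := (@phi_alpha R).
Local Notation phi_beta := (@phi_beta R).

Lemma nz_1r a : (a != 0) || ((1 : R) != 0). Proof. by rewrite oner_eq0 orbT. Qed.
Lemma nz_1l a : ((1 : R) != 0) || (a != 0). Proof. by rewrite oner_eq0. Qed.

Lemma mu_inj : injective (@mu R).
Proof.
move=> [s|] [t|]; rewrite !mu_hom_mu // => /mu_hom_inj; rewrite ?nz_1r ?nz_1l => /(_ isT isT).
- by rewrite mulr1 mul1r => /eqP; rewrite subr_eq0 => /eqP ->.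
- by rewrite mulr0 mul1r sub0r => /eqP; rewrite oppr_eq0 oner_eq0.
- by rewrite mul1r mul0r subr0 => /eqP; rewrite oner_eq0.
Qed.

Lemma arc_cc x y z : circle x -> circle y -> circle z -> circle_arc x y z <-> [\/ z = x, z =
  y | cc x z y].
Proof. by move=> cx cy cz; rewrite /circle_arc /= ccwcc. Qed.

Lemma arc_fin p q (t : RP1 R) : p < q ->
  circle_arc (mu_hom p 1) (mu_hom q 1) (mu t) <-> exists2 s, t = Some s & p <= s <= q.
Proof.
move=> pq; have cp := circle_mu_hom (nz_1r p); have cq := circle_mu_hom (nz_1r q).
rewrite arc_cc //; last exact: circle_mu.
have eS s : mu_hom s 1 = mu (Some s) by rewrite mu_hom_mu.
split.
  case; rewrite ?eS.
  - by move/mu_inj => ->; exists p; rewrite // lexx ltW.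
  - by move/mu_inj => ->; exists q; rewrite // lexx ltW.
  - rewrite -!eS mu_hom_mu; case: t => [s|]; last by rewrite ccC cc_mu_hom_inf lt_gtF.
    by rewrite cc_mu_hom1 => /or3P[]/andP[h1 h2]; exists s => //; apply/andP; split; lra.
move=> [s -> /andP[]]; rewrite mu_hom_mu !le_eqVlt.
move=> /orP[/eqP -> _|h1 /orP[/eqP ->|h2]]; [exact: Or31 | exact: Or32 | apply: Or33].
by rewrite cc_mu_hom1 /cyc h1 h2.
Qed.

Lemma arc_infr p (t : RP1 R) :
  circle_arc (mu_hom p 1) (mu_hom 1 0) (mu t) <-> (forall s, t = Some s -> p <= s).
Proof.
have cp := circle_mu_hom (nz_1r p); have cq := circle_mu_hom (nz_1l 0).
rewrite arc_cc //; last exact: circle_mu.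
case: t => [s|]; rewrite mu_hom_mu; last by split=> // _; exact: Or32.
rewrite -ccC cc_mu_hom_inf; split.
  case=> [| |h _ [<-]]; last exact: ltW.
    have -> : mu_hom s 1 = mu (Some s) by rewrite mu_hom_mu.
    have -> : mu_hom p 1 = mu (Some p) by rewrite mu_hom_mu.
    by move=> /mu_inj[<-] _ [<-].
  have -> : mu_hom s 1 = mu (Some s) by rewrite mu_hom_mu.
  have -> : mu_hom 1 0 = @mu R None by rewrite mu_hom_mu.
  by move/mu_inj.
move/(_ s erefl); rewrite le_eqVlt => /orP[/eqP ->|h]; [exact: Or31 | exact: Or33].
Qed.

Lemma arc_infl p (t : RP1 R) :
  circle_arc (mu_hom 1 0) (mu_hom p 1) (mu t) <-> (forall s, t = Some s -> s <= p).
Proof.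
have cp := circle_mu_hom (nz_1r p); have cq := circle_mu_hom (nz_1l 0).
rewrite arc_cc //; last exact: circle_mu.
case: t => [s|]; rewrite mu_hom_mu; last by split=> // _; exact: Or31.
rewrite cc_mu_hom_inf; split.
  case=> [| |h _ [<-]]; last exact: ltW.
    have -> : mu_hom s 1 = mu (Some s) by rewrite mu_hom_mu.
    have -> : mu_hom 1 0 = @mu R None by rewrite mu_hom_mu.
    by move/mu_inj.
  have -> : mu_hom s 1 = mu (Some s) by rewrite mu_hom_mu.
  have -> : mu_hom p 1 = mu (Some p) by rewrite mu_hom_mu.
  by move=> /mu_inj[<-] _ [<-].
move/(_ s erefl); rewrite le_eqVlt => /orP[/eqP ->|h]; [exact: Or32 | exact: Or33].
Qed.

Lemma mu_ratE (q : option rat) : mu_rat R q = if q is Some k then mu_hom (ratr k) 1 else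
  mu_hom 1 0.
Proof. by case: q => [k|]; rewrite /mu_rat /omap /obind /oapp mu_hom_mu. Qed.

Lemma ratrN1 : ratr (-1) = -1 :> R.
Proof. by rewrite rmorphN rmorph1. Qed.

Lemma phi_alpha_piecewise : piecewise_PSL2Z phi_alpha.
Proof.
exists [:: (Some 0, Some 1, mat 0 1 (-1) 1); (Some 1, None, mat (-1) 0 1 (-1));
  (None, Some (-1), mat 1 1 (-1) 0); (Some (-1), Some 0, mat 1 1 0 1)]; split.
  have m1 : (-1 : R) < 0 by rewrite oppr_lt0.
  move=> [s|]; last first.
    exists (Some 1, None, mat (-1) 0 1 (-1)); first by rewrite !inE eqxx orbT.
    by rewrite !mu_ratE /= rmorph1; apply/arc_infr.
  case: (lerP s (-1)) => h1.
    exists (None, Some (-1), mat 1 1 (-1) 0); first by rewrite !inE eqxx !orbT.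
    by rewrite !mu_ratE /= ratrN1; apply/arc_infl => ? [<-].
  case: (lerP s 0) => h2.
    exists (Some (-1), Some 0, mat 1 1 0 1); first by rewrite !inE eqxx !orbT.
    by rewrite !mu_ratE /= ratrN1 rmorph0; apply/arc_fin => //; exists s; rewrite // ltW.
  case: (lerP s 1) => h3.
    exists (Some 0, Some 1, mat 0 1 (-1) 1); first by rewrite !inE eqxx.
    by rewrite !mu_ratE /= rmorph1 rmorph0; apply/arc_fin => //; exists s; rewrite // ltW.
  exists (Some 1, None, mat (-1) 0 1 (-1)); first by rewrite !inE eqxx orbT.
  by rewrite !mu_ratE /= rmorph1; apply/arc_infr => ? [<-]; exact: ltW.
have fin (al be ga de : int) (t : RP1 R) a b c r : al * de - be * ga = 1 -> mu t = mu_hom a b ->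
   (a != 0) || (b != 0) -> phi_alpha (cplx 1 * mu_hom a b) = cplx 1 * mu_hom c r ->
   c = al%:~R * a + be%:~R * b -> r = ga%:~R * a + de%:~R * b ->
   phi_alpha (mu t) = mu (moebius (mat al be ga de) t).
  move=> D e ab h ec er; rewrite (mu_moebius D ab e) e -ec -er.
  by move: h; rewrite -!mu_hom_cplx1.
move=> pc; rewrite !inE => /or4P[]/eqP -> /=; rewrite det_mat; split=> // t; rewrite !mu_ratE
  ?ratrN1 ?rmorph0 ?rmorph1.
- move/arc_fin => [//|s -> sP].
  by apply: (fin _ _ _ _ _ _ _ _ _ _ (mu_hom_mu (Some s)) (nz_1r s) (phi_alpha1 ler01 (nz_1r
    s) sP)) => //; ring.
- move/arc_infr => h.
  have [a [b [ab sP e]]] : exists a b, [/\ (a != 0) || (b != 0), 0 <= b <= a & mu t = mu_hom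
    a b].
    case: t h => [s|] h; [exists s, 1 | exists 1, 0]; rewrite mu_hom_mu ?nz_1r ?nz_1l ?lexx
      ler01 //=.
    by split => //; exact: h.
  by apply: (fin _ _ _ _ _ _ _ _ _ _ e ab (phi_alpha2 ler01 ab sP)) => //; ring.
- move/arc_infl => h.
  have [a [b [ab sP e]]] : exists a b, [/\ (a != 0) || (b != 0), 0 <= b <= - a & mu t =
    mu_hom a b].
    case: t h => [s|] h; [exists s, 1 | exists (-1), 0]; rewrite mu_hom_mu.
      by rewrite nz_1r ler01 /= lerNr; split => //; exact: h.
    by rewrite oppr_eq0 oner_eq0 opprK lexx ler01 -[mu_hom (-1) 0]mu_homN opprK oppr0.
  by apply: (fin _ _ _ _ _ _ _ _ _ _ e ab (phi_alpha3 ler01 ab sP)) => //; ring.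
- move/arc_fin => [|s -> /andP[s1 s2]]; first by rewrite oppr_lt0.
  have sP : 0 <= - s <= 1 by rewrite oppr_ge0 s2 /= lerNl.
  by apply: (fin _ _ _ _ _ _ _ _ _ _ (mu_hom_mu (Some s)) (nz_1r s) (phi_alpha4 ler01 (nz_1r
    s) sP)) => //; ring.
Qed.

Lemma phi_beta_piecewise : piecewise_PSL2Z phi_beta.
Proof.
(* A single homography listed on two half circles, since [circle_arc x x] is only a point. *)
exists [:: (Some 0, None, mat (-1) (-1) 1 0); (None, Some 0, mat (-1) (-1) 1 0)]; split.
  move=> [s|]; last first.
    exists (Some 0, None, mat (-1) (-1) 1 0); first by rewrite !inE eqxx.
    by rewrite !mu_ratE /= rmorph0; apply/arc_infr.
  case: (lerP s 0) => h.
    exists (None, Some 0, mat (-1) (-1) 1 0); first by rewrite !inE eqxx orbT.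
    by rewrite !mu_ratE /= rmorph0; apply/arc_infl => ? [<-].
  exists (Some 0, None, mat (-1) (-1) 1 0); first by rewrite !inE eqxx.
  by rewrite !mu_ratE /= rmorph0; apply/arc_infr => ? [<-]; exact: ltW.
have fin (t : RP1 R) : phi_beta (mu t) = mu (moebius (mat (-1) (-1) 1 0) t).
  have [a [b [ab e]]] := circle_mu_homP (circle_mu t).
  rewrite (@mu_moebius _ (-1) (-1) 1 0 t a b) // e mu_hom_cplx1 /phi_beta
    radial_moebius_polar //; last by ring.
  by rewrite -mu_hom_cplx1; congr mu_hom; ring.
by move=> pc; rewrite !inE => /orP[]/eqP -> /=; rewrite det_mat.
Qed.

Lemma continuous_composition (f g : C R -> C R) : continuous f -> continuous g -> continuous
  (g \o f).
Proof.
by move=> cf cg z; exact: (@continuous_comp (C R) (C R) (C R) f g z (cf z) (cg _)).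
Qed.

Lemma phi_alpha_homeo : M_homeo phi_alpha.
Proof.
have c3 : continuous (phi_alpha \o (phi_alpha \o phi_alpha)).
  by apply: continuous_composition; [apply: continuous_composition|]; exact:
    phi_alpha_continuous.
have n3 z : `|(phi_alpha \o (phi_alpha \o phi_alpha)) z| = `|z| by rewrite /comp
  !phi_alpha_norm.
exact: (homeo_of_iter (@phi_alpha_continuous R) c3 (@phi_alpha_norm R) n3 (@phi_alpha4K R)
  (@phi_alpha4K R) phi_alpha_piecewise).
Qed.

Lemma phi_beta_homeo : M_homeo phi_beta.
Proof.
have D : (-1) * 0 - (-1) * 1 = 1 :> R by ring.
have cB : continuous phi_beta by exact: radial_moebius_continuous.
have nB z : `|phi_beta z| = `|z| by rewrite /phi_beta radial_moebius_norm.
have n2 z : `|(phi_beta \o phi_beta) z| = `|z| by rewrite /comp !nB.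
exact: (homeo_of_iter cB (continuous_composition cB cB) nB n2 (@phi_beta3K R) (@phi_beta3K R)
  phi_beta_piecewise).
Qed.

Lemma phi_beta_mu_hom a b : (a != 0) || (b != 0) -> phi_beta (mu_hom a b) = mu_hom (a + b) (-
  a).
Proof.
move=> ab; rewrite (mu_hom_cplx1 a b) /phi_beta radial_moebius_polar //; last by ring.
by rewrite -mu_hom_cplx1 -mu_homN; congr mu_hom; ring.
Qed.

Lemma phi_beta_cc x y z : circle x -> circle y -> circle z -> cc x y z -> cc (phi_beta x)
  (phi_beta y) (phi_beta z).
Proof.
have nB a b : (a != 0) || (b != 0) -> (a + b != 0) || (- a != 0) by apply: nz_lin => ? ?;
  split; lra.
move=> /circle_mu_homP[a [b [h1 ->]]] /circle_mu_homP[c [d [h2 ->]]] /circle_mu_homP[e [f [h3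
  ->]]].
rewrite !phi_beta_mu_hom // !cc_mu_hom ?nB //.
have -> : (a + b) * - c - - a * (c + d) = a * d - b * c by ring.
have -> : (c + d) * - e - - c * (e + f) = c * f - d * e by ring.
by have -> : (e + f) * - a - - e * (a + b) = e * b - f * a by ring.
Qed.

(* [phi_alpha] is [phi_beta] after an increasing piecewise homographic map of the line
   fixing infinity; this makes it orientation preserving. *)
Definition line_alpha s : R :=
  if s <= -1 then s else if s <= 0 then - (s + 2)^-1
  else if s <= 1 then (s - 1) / (2 - s) else s - 1.

Lemma phi_alpha_line s : phi_alpha (mu_hom s 1) = phi_beta (mu_hom (line_alpha s) 1).
Proof.
rewrite phi_beta_mu_hom ?nz_1r // /line_alpha (mu_hom_cplx1 s 1); case: ifP => h1.
  by rewrite phi_alpha3 ?ler01 ?nz_1r // -?mu_hom_cplx1 //= lerNr.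
have h1' : -1 < s by rewrite ltNge h1.
case: ifP => h2.
  rewrite phi_alpha4 ?ler01 ?nz_1r // -?mu_hom_cplx1; last by rewrite oppr_ge0 h2 lerNl ltW.
  have n : s + 2 != 0 by apply: lt0r_neq0; lra.
  by apply: mu_hom_eq; [exact: nz_1r | rewrite opprK invr_eq0 n orbT | field].
have h2' : 0 < s by rewrite ltNge h2.
case: ifP => h3.
  rewrite phi_alpha1 ?ler01 ?nz_1r // -?mu_hom_cplx1; last by rewrite ltW.
  have n : 2 - s != 0 by apply: lt0r_neq0; lra.
  apply: mu_hom_eq; [exact: nz_1l | | by field].
  rewrite (_ : (s - 1) / (2 - s) + 1 = (2 - s)^-1); last by field.
  by rewrite invr_eq0 n.
have h3' : 1 < s by rewrite ltNge h3.
rewrite phi_alpha2 ?ler01 ?nz_1r // -?mu_hom_cplx1; last by rewrite ltW.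
by rewrite -mu_homN; congr mu_hom; ring.
Qed.

Lemma phi_alpha_inf : phi_alpha (mu_hom 1 0) = phi_beta (mu_hom 1 0).
Proof.
rewrite phi_beta_mu_hom ?nz_1l // (mu_hom_cplx1 1 0) phi_alpha2 ?ler01 ?nz_1l ?lexx //.
by rewrite -mu_hom_cplx1 -mu_homN; congr mu_hom; ring.
Qed.

(** Neighbouring pieces match at [-1], [0] and [1], with values [-1], [-1/2] and [0], and each piece
    is increasing. *)
Lemma line_alpha_mono a b : a < b -> line_alpha a < line_alpha b.
Proof.
have inv_lt (u v : R) : 0 < u -> u < v -> v^-1 < u^-1 by move=> u0 uv; rewrite ltf_pV2 //
  posrE //; exact: lt_trans uv.
have eq2 s : s < 2 -> (s - 1) / (2 - s) = (2 - s)^-1 - 1.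
  by move=> h; field; apply: lt0r_neq0; lra.
have i1 : (1 : R)^-1 = 1 by exact: invr1.
move=> ab; rewrite /line_alpha.
case: (lerP a (-1)) => a1; case: (lerP b (-1)) => b1; try lra.
- case: (lerP b 0) => b2.
    by have := inv_lt 1 (b + 2) ltr01; rewrite i1 => /(_ ltac:(lra)); lra.
  case: (lerP b 1) => b3; last lra.
  rewrite eq2; last lra.
  have : 0 < (2 - b)^-1 by rewrite invr_gt0; lra.
  lra.
- have A2 : a <= 0 -> - (a + 2)^-1 <= - 2^-1.
    by move=> h; rewrite lerN2 lef_pV2 ?posrE; lra.
  have B2 : 0 < b -> b <= 1 -> - 2^-1 < (b - 1) / (2 - b).
    move=> h h'; rewrite eq2; last lra.
    have := inv_lt (2 - b) 2; lra.
  case: (lerP a 0) => a2; case: (lerP b 0) => b2; try lra.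
  + rewrite ltrN2; apply: inv_lt; lra.
  + have := A2 a2; case: (lerP b 1) => b3; last lra.
    by have := B2 b2 b3; lra.
  + case: (lerP a 1) => a3; case: (lerP b 1) => b3; try lra.
      rewrite !eq2; try lra.
      have := inv_lt (2 - b) (2 - a); lra.
    rewrite eq2; last lra.
    have : (2 - a)^-1 <= 1 by rewrite -i1 lef_pV2 ?posrE; lra.
    lra.
Qed.

Lemma phi_alpha_cc x y z : circle x -> circle y -> circle z -> cc x y z -> cc (phi_alpha x)
  (phi_alpha y) (phi_alpha z).
Proof.
have cB s : circle (mu_hom s 1) by exact: circle_mu_hom (nz_1r s).
have c0 : circle (mu_hom (1 : R) 0) by exact: circle_mu_hom (nz_1l 0).
have mcyc a b c : cyc a b c -> cyc (line_alpha a) (line_alpha b) (line_alpha c).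
  by move=> /or3P[]/andP[h1 h2]; rewrite /cyc (line_alpha_mono h1) (line_alpha_mono h2) ?orbT.
have inf b c : cc (mu_hom 1 0) (mu_hom b 1) (mu_hom c 1) -> cc (phi_alpha (mu_hom 1 0))
  (phi_alpha (mu_hom b 1)) (phi_alpha (mu_hom c 1)).
  rewrite phi_alpha_inf !phi_alpha_line cc_mu_hom_inf => /line_alpha_mono h; apply:
    phi_beta_cc => //.
  by rewrite cc_mu_hom_inf.
move=> /circleP[r1 ->] /circleP[r2 ->] /circleP[r3 ->]; rewrite !mu_hom_mu.
case: r1 r2 r3 => [a|] [b|] [c|].
- rewrite cc_mu_hom1 => /mcyc h; rewrite !phi_alpha_line; apply: phi_beta_cc => //; by
    rewrite cc_mu_hom1.
- by rewrite -ccC => /inf; rewrite ccC.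
- by rewrite ccC => /inf; rewrite -ccC.
- by move/cc_neq => [].
- exact: inf.
- by move/cc_neq => [].
- by move/cc_neq => [].
- by move/cc_neq => [].
Qed.

End Homeos2.

(** * Images of the Farey tessellation *)

Section FareyImages.
Variable R : realType.
Implicit Types (x y z : C R) (a b c d : int).
Local Notation phi_alpha := (@phi_alpha R).
Local Notation phi_beta := (@phi_beta R).
Local Notation p0 := (mu_hom (0 : R) 1).
Local Notation p1 := (mu_hom (1 : R) 1).
Local Notation poo := (mu_hom (1 : R) 0).
Local Notation pm := (mu_hom (-1 : R) 1).

Lemma mu_hom_fracE a b : nzv a b -> mu_hom a%:~R b%:~R = mu_frac R a b.
Proof. by move=> h; rewrite mu_fracE. Qed.

Lemma farey_pair_mu_hom a b c d : `|a * d - b * c| = 1 -> farey_pair (mu_hom (a%:~R : R)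
  b%:~R) (mu_hom c%:~R d%:~R).
Proof.
by move=> h; have [n1 n2] := det_nzv h; rewrite !mu_hom_fracE //; exists a, b, c, d.
Qed.

Lemma farey_pairP x y : farey_pair x y -> exists a b c d,
  [/\ `|a * d - b * c| = 1, x = mu_hom a%:~R b%:~R & y = mu_hom c%:~R d%:~R].
Proof.
move=> [a [b [c [d [h -> ->]]]]]; have [n1 n2] := det_nzv h.
by exists a, b, c, d; rewrite !mu_hom_fracE.
Qed.

Lemma phi_beta_farey_pair x y : farey_pair x y -> farey_pair (phi_beta x) (phi_beta y).
Proof.
move=> [a [b [c [d [h -> ->]]]]]; have [n1 n2] := det_nzv h.
rewrite !mu_fracE // !phi_beta_mu_hom ?nzvR // -!intrD -!intrN; apply: farey_pair_mu_hom.
by rewrite (_ : (a + b) * - c - - a * (c + d) = a * d - b * c) //; ring.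
Qed.

Definition same_quadrant a b c d :=
  [\/ (0 <= a <= b) && (0 <= c <= d), (0 <= b <= a) && (0 <= d <= c),
   (0 <= b <= - a) && (0 <= d <= - c) | (0 <= - a <= b) && (0 <= - c <= d)].

Lemma quadrant_nonneg a b c d : 0 <= a -> 0 <= b -> 0 <= c -> 0 <= d ->
  `|a * d - b * c| = 1 ->
  (0 <= a <= b) && (0 <= c <= d) \/ (0 <= b <= a) && (0 <= d <= c) \/
  (a = 0 /\ d = 0 \/ b = 0 /\ c = 0).
Proof.
move=> a0 b0 c0 d0 h; case: (lerP a b) => ab; case: (lerP c d) => cd.
- by left; rewrite a0 c0.
- case: (eqVneq a b) => [e|n].
    by right; left; rewrite e b0 d0 lexx ltW.
  have ab' : a < b by rewrite lt_neqAle n.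
  by right; right; left; nia.
- case: (eqVneq c d) => [e|n].
    by right; left; rewrite e b0 d0 lexx ltW.
  have cd' : c < d by rewrite lt_neqAle n.
  by right; right; right; nia.
- by right; left; rewrite b0 d0 !ltW.
Qed.

Lemma norm_mul1 (k l : int) : 0 <= k -> 0 <= l -> `|k * l| = 1 -> k = 1 /\ l = 1.
Proof.
move=> k0 l0; rewrite ger0_norm ?mulr_ge0 // => h; case: (mul_eq1 h) => e; last lia.
by move: h; rewrite e mul1r.
Qed.

(** With suitable signs both ends of a Farey edge lie in one closed quadrant, unless they are 0 and
    infinity. On a quadrant [phi_alpha] is one matrix of determinant [1], so the edge from 0 to
    infinity is the only one whose image can fail to be Farey. *)
Lemma farey_pair_signs a b c d : `|a * d - b * c| = 1 -> exists a' b' c' d',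
  [/\ (a' = a /\ b' = b) \/ (a' = - a /\ b' = - b),
      (c' = c /\ d' = d) \/ (c' = - c /\ d' = - d) &
      same_quadrant a' b' c' d' \/ (a' = 0 /\ d' = 0 \/ b' = 0 /\ c' = 0)].
Proof.
suff key : forall a b c d : int, 0 <= b -> 0 <= d -> `|a * d - b * c| = 1 -> exists a' b' c' d',
  [/\ (a' = a /\ b' = b) \/ (a' = - a /\ b' = - b),
      (c' = c /\ d' = d) \/ (c' = - c /\ d' = - d) &
      same_quadrant a' b' c' d' \/ (a' = 0 /\ d' = 0 \/ b' = 0 /\ c' = 0)].
  have sgn (u v : int) : exists u' v' : int, 0 <= v' /\ ((u' = u /\ v' = v) \/ (u' = - u /\
    v' = - v)).
    by case: (lerP 0 v) => v0; [exists u, v; auto | exists (- u), (- v); rewrite oppr_ge0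
      ltW; auto].
  move=> h; have [a1 [b1 [b10 e1]]] := sgn a b; have [c1 [d1 [d10 e2]]] := sgn c d.
  have h1 : `|a1 * d1 - b1 * c1| = 1.
    by case: e1 => -[-> ->]; case: e2 => -[-> ->]; rewrite -h ?mulrNN // ?(mulNr, mulrN) //
      -opprD normrN.
  have [a' [b' [c' [d' [f1 f2 q]]]]] := key _ _ _ _ b10 d10 h1.
  exists a', b', c', d'; split=> //.
    by case: e1 f1 => -[-> ->] [] [-> ->]; rewrite ?opprK; auto.
  by case: e2 f2 => -[-> ->] [] [-> ->]; rewrite ?opprK; auto.
move=> {a b c d} a b c d b0 d0 h.
have neg : a <= 0 -> c <= 0 -> same_quadrant a b c d \/ (a = 0 /\ d = 0 \/ b = 0 /\ c = 0).
  move=> a0 c0; have h' : `|- a * d - b * - c| = 1 by rewrite mulNr mulrN -opprD normrN.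
  have [a0' c0'] : 0 <= - a /\ 0 <= - c by rewrite !oppr_ge0.
  case: (quadrant_nonneg a0' b0 c0' d0 h') => [q|[q|q]].
  - by left; apply: Or44.
  - by left; apply: Or43.
  - by right; case: q => -[e1 e2]; [left | right]; split => //; lia.
case: (lerP 0 a) => a0; case: (lerP 0 c) => c0.
- exists a, b, c, d; split; auto.
  by case: (quadrant_nonneg a0 b0 c0 d0 h) => [q|[q|]]; auto; left; [apply: Or41 | apply: Or42].
- case: (eqVneq a 0) => [e|n].
    by exists a, b, c, d; split; auto; apply: neg; rewrite ?e // ltW.
  have a0' : 0 < a by rewrite lt_neqAle eq_sym n.
  (* Infinity has the two lifts [(1, 0)] and [(-1, 0)]; the opposite one is needed to share the
     quadrant of the negative end. *)
  case: (eqVneq b 0) => [e|nb].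
    subst b; have [ea ed] : a = 1 /\ d = 1.
      by apply: norm_mul1 => //; move: h; rewrite mul0r subr0.
    exists (- a), (- 0), c, d; split; auto; left; apply: Or43; rewrite ea ed oppr0 /=; lia.
  case: (eqVneq d 0) => [e|nd].
    subst d; have [ea ed'] : b = 1 /\ - c = 1.
      by apply: norm_mul1 => //; [rewrite oppr_ge0 ltW | move: h; rewrite mulr0 sub0r mulrN].
    have ed : c = - 1 by lia.
    exists a, b, (- c), (- 0); split; auto; left; apply: Or42; rewrite ea ed oppr0 /=; lia.
  (* For finite nonzero ends of opposite signs, [a * d] and [- (b * c)] are both at least [1], so
     the determinant is at least [2]. *)
  exfalso; have b1 : 0 < b by rewrite lt_neqAle eq_sym nb.
  have d1 : 0 < d by rewrite lt_neqAle eq_sym nd.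
  have := mulr_gt0 a0' d1; have : b * c < 0 by rewrite pmulr_rlt0.
  by clear neg; lia.
- case: (eqVneq c 0) => [e|n].
    by exists a, b, c, d; split; auto; apply: neg; rewrite ?e // ltW.
  have c0' : 0 < c by rewrite lt_neqAle eq_sym n.
  case: (eqVneq b 0) => [e|nb].
    subst b; have [ea' ed] : - a = 1 /\ d = 1.
      by apply: norm_mul1 => //; [rewrite oppr_ge0 ltW | move: h; rewrite mul0r subr0 mulNr
        normrN].
    have ea : a = - 1 by lia.
    exists (- a), (- 0), c, d; split; auto; left; apply: Or42; rewrite ea ed oppr0 /=; lia.
  case: (eqVneq d 0) => [e|nd].
    subst d; have [ea ed] : b = 1 /\ c = 1.
      by apply: norm_mul1 => //; move: h; rewrite mulr0 sub0r normrN.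
    exists a, b, (- c), (- 0); split; auto; left; apply: Or43; rewrite ea ed oppr0 /=; lia.
  exfalso; have b1 : 0 < b by rewrite lt_neqAle eq_sym nb.
  have d1 : 0 < d by rewrite lt_neqAle eq_sym nd.
  have := mulr_gt0 b1 c0'; have : a * d < 0 by rewrite pmulr_llt0.
  by clear neg; lia.
- by exists a, b, c, d; split; auto; apply: neg; rewrite ltW.
Qed.

Lemma mu_hom_sign a b a' b' : (a' = a /\ b' = b) \/ (a' = - a /\ b' = - b) ->
  mu_hom (a'%:~R : R) b'%:~R = mu_hom a%:~R b%:~R.
Proof. by case=> -[-> ->] //; rewrite !intrN mu_homN. Qed.

Lemma mu_hom_0 b : b != 0 -> mu_hom (0 : R) b%:~R = p0.
Proof.
by move=> b0; apply: mu_hom_eq; rewrite ?intr_eq0 ?b0 ?oner_eq0 ?orbT // mul0r mulr0 subr0.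
Qed.

Lemma mu_hom_oo a : a != 0 -> mu_hom (a%:~R : R) 0 = poo.
Proof. by move=> a0; rewrite mu_hom_inf // intr_eq0. Qed.

Lemma phi_alpha1z a b : nzv a b -> 0 <= a <= b -> phi_alpha (mu_hom a%:~R b%:~R) = mu_hom
  b%:~R (b - a)%:~R.
Proof.
move=> n h; rewrite (mu_hom_cplx1 a%:~R) phi_alpha1 ?ler01 ?nzvR //; last by rewrite ler0z
  ler_int.
by rewrite -mu_hom_cplx1 intrB.
Qed.

Lemma phi_alpha2z a b : nzv a b -> 0 <= b <= a -> phi_alpha (mu_hom a%:~R b%:~R) = mu_hom (-
  a)%:~R (a - b)%:~R.
Proof.
move=> n h; rewrite (mu_hom_cplx1 a%:~R) phi_alpha2 ?ler01 ?nzvR //; last by rewrite ler0z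
  ler_int.
by rewrite -mu_hom_cplx1 intrB intrN.
Qed.

Lemma phi_alpha3z a b : nzv a b -> 0 <= b <= - a -> phi_alpha (mu_hom a%:~R b%:~R) = mu_hom
  (a + b)%:~R (- a)%:~R.
Proof.
move=> n h; rewrite (mu_hom_cplx1 a%:~R) phi_alpha3 ?ler01 ?nzvR //; last by rewrite -intrN
  ler0z ler_int.
by rewrite -mu_hom_cplx1 intrD intrN.
Qed.

Lemma phi_alpha4z a b : nzv a b -> 0 <= - a <= b -> phi_alpha (mu_hom a%:~R b%:~R) = mu_hom
  (a + b)%:~R b%:~R.
Proof.
move=> n h; rewrite (mu_hom_cplx1 a%:~R) phi_alpha4 ?ler01 ?nzvR //; last by rewrite -intrN
  ler0z ler_int.
by rewrite -mu_hom_cplx1 intrD.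
Qed.

Lemma phi_alpha_farey_pair x y : farey_pair x y ->
  (x = p0 /\ y = poo) \/ (x = poo /\ y = p0) \/ farey_pair (phi_alpha x) (phi_alpha y).
Proof.
move=> /farey_pairP[a0 [b0 [c0 [d0 [h -> ->]]]]].
have [a [b [c [d [e1 e2 q]]]]] := farey_pair_signs h.
rewrite -(mu_hom_sign e1) -(mu_hom_sign e2).
have {}h : `|a * d - b * c| = 1.
  by case: e1 => -[-> ->]; case: e2 => -[-> ->]; rewrite -h ?mulrNN // ?(mulNr, mulrN) //
    -opprD normrN.
have [n1 n2] := det_nzv h; clear e1 e2.
have mk (u v w k : int) : `|u * k - v * w| = 1 -> phi_alpha (mu_hom a%:~R b%:~R) = mu_hom
  u%:~R v%:~R ->
   phi_alpha (mu_hom c%:~R d%:~R) = mu_hom w%:~R k%:~R -> farey_pair (phi_alpha (mu_hom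
     (a%:~R : R) b%:~R)) (phi_alpha (mu_hom c%:~R d%:~R)).
  by move=> hh -> ->; exact: farey_pair_mu_hom.
case: q => [[]/andP[q1 q2]|[[ea ed]|[eb ec]]].
- right; right; apply: (mk b (b - a) d (d - c)); first by rewrite (_ : _ - _ = a * d - b * c)
    //; ring.
    exact: phi_alpha1z.
  exact: phi_alpha1z.
- right; right; apply: (mk (- a) (a - b) (- c) (c - d)); first by rewrite (_ : _ - _ = a * d
    - b * c) //; ring.
    exact: phi_alpha2z.
  exact: phi_alpha2z.
- right; right; apply: (mk (a + b) (- a) (c + d) (- c)); first by rewrite (_ : _ - _ = a * d
    - b * c) //; ring.
    exact: phi_alpha3z.
  exact: phi_alpha3z.
- right; right; apply: (mk (a + b) b (c + d) d); first by rewrite (_ : _ - _ = a * d - b * c)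
    //; ring.
    exact: phi_alpha4z.
  exact: phi_alpha4z.
- left; subst a d; move: n1 n2; rewrite /nzv eqxx orbF /= => n1 n2.
  by rewrite mu_hom_0 // mu_hom_oo.
- right; left; subst b c; move: n1 n2; rewrite /nzv eqxx orbF /= => n1 n2.
  by rewrite mu_hom_0 // mu_hom_oo.
Qed.

End FareyImages.

(** * Both generators on the marked Farey tessellation *)

Section FareyMoves.
Variable R : realType.
Implicit Types (x y z : C R) (a b c d : int).
Local Notation phi_alpha := (@phi_alpha R).
Local Notation phi_beta := (@phi_beta R).
Local Notation p0 := (mu_hom (0 : R) 1).
Local Notation p1 := (mu_hom (1 : R) 1).
Local Notation poo := (mu_hom (1 : R) 0).
Local Notation pm := (mu_hom (-1 : R) 1).

Lemma farey_pair_arc x y : farey_pair x y -> farey_edges (ideal_arc x y).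
Proof. by move=> f; have [cx cy xy] := farey_pair_circle f; apply/farey_edgeP. Qed.

Lemma farey_arcP (A : arc R) : farey_edges A -> exists x y, farey_pair x y /\ A = ideal_arc x y.
Proof.
move=> [a [b [c [d [_ _ h ->]]]]].
by exists (mu_frac R a b), (mu_frac R c d); split => //; exists a, b, c, d.
Qed.

Let f01 : farey_pair p0 p1. Proof. exact: (@farey_pair_mu_hom R 0 1 1 1). Qed.
Let f1o : farey_pair p1 poo. Proof. exact: (@farey_pair_mu_hom R 1 1 1 0). Qed.
Let fo0 : farey_pair poo p0. Proof. exact: (@farey_pair_mu_hom R 1 0 0 1). Qed.
Let fom : farey_pair poo pm. Proof. exact: (@farey_pair_mu_hom R 1 0 (-1) 1). Qed.
Let fm0 : farey_pair pm p0. Proof. exact: (@farey_pair_mu_hom R (-1) 1 0 1). Qed.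
Let c0 : circle p0. Proof. by have [] := farey_pair_circle f01. Qed.
Let c1 : circle p1. Proof. by have [] := farey_pair_circle f01. Qed.
Let coo : circle poo. Proof. by have [] := farey_pair_circle fo0. Qed.
Let cm : circle pm. Proof. by have [] := farey_pair_circle fm0. Qed.

Lemma not_farey_pair1m : ~ farey_pair p1 pm.
Proof.
move=> [a [b [c [d [h e1 e2]]]]]; have [n1 n2] := det_nzv h.
have ea : 1 * b - 1 * a = 0 by apply/(frac_eq R (isT : nzv 1 1) n1); rewrite -e1 -mu_hom_fracE.
have ec : -1 * d - 1 * c = 0 by apply/(frac_eq R (isT : nzv (-1) 1) n2); rewrite -e2
  -mu_hom_fracE.
have {}ea : b = a by lia.
have {}ec : d = - c by lia.
by move: h; rewrite ea ec mulrN; lia.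
Qed.

Let cc01o : cc p0 p1 poo.
Proof. by rewrite ccC ccC cc_mu_hom_inf ltr01. Qed.
Let cc0om : cc p0 poo pm.
Proof. by rewrite ccC cc_mu_hom_inf oppr_lt0. Qed.

Section Tau.
Hypothesis tF : tessellation (@farey_edges R).

Let e01 : edge (@farey_edges R) p0 p1.
Proof. by have [? ? ?] := farey_pair_circle f01; split => //; exact: farey_pair_arc. Qed.
Let e1o : edge (@farey_edges R) p1 poo.
Proof. by have [? ? ?] := farey_pair_circle f1o; split => //; exact: farey_pair_arc. Qed.
Let eo0 : edge (@farey_edges R) poo p0.
Proof. by have [? ? ?] := farey_pair_circle fo0; split => //; exact: farey_pair_arc. Qed.
Let eom : edge (@farey_edges R) poo pm.
Proof. by have [? ? ?] := farey_pair_circle fom; split => //; exact: farey_pair_arc. Qed.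
Let em0 : edge (@farey_edges R) pm p0.
Proof. by have [? ? ?] := farey_pair_circle fm0; split => //; exact: farey_pair_arc. Qed.

Let t01o : triangles (@farey_edges R) [set p0; p1; poo].
Proof. exact: (triangle_of_edges tF). Qed.
Let t0om : triangles (@farey_edges R) [set p0; poo; pm].
Proof. by apply: (triangle_of_edges tF) => //; exact: edgeC. Qed.

Let n1m : p1 <> pm.
Proof. by have [_ /cc_neq[]] := cc_trans cc01o cc0om. Qed.

Let ends0o : [/\ circle p0, circle poo & p0 <> poo].
Proof. by have [_ _ /nesym] := farey_pair_circle fo0. Qed.
Let endsom : [/\ circle poo, circle pm & poo <> pm].
Proof. exact: farey_pair_circle fom. Qed.
Let ends1m : [/\ circle p1, circle pm & p1 <> pm]. Proof. by []. Qed.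

Definition tau_std : marked_tessellation R :=
  MarkedTessellation tF ends0o (farey_pair_arc (farey_pairC fo0)).

Definition tau_beta : marked_tessellation R :=
  MarkedTessellation tF endsom (farey_pair_arc fom).

Lemma tau_alpha_doe : flip_edges (@farey_edges R) p0 p1 poo pm (ideal_arc p1 pm).
Proof. by right. Qed.

Definition tau_alpha : marked_tessellation R :=
  MarkedTessellation (flip_tess tF c0 c1 coo cm cc01o cc0om t01o t0om) ends1m tau_alpha_doe.

Lemma beta_std : beta_move tau_std tau_beta.
Proof. by exists pm; split => //=; rewrite ccwcc. Qed.

Lemma alpha_std : alpha_move tau_std tau_alpha.
Proof.
exists pm, p1; split; last by [].
split => //=; first by rewrite ccwcc.
  by rewrite set3C.
by rewrite ccwcc // ccC.
Qed.

Let A0 : phi_alpha p0 = p1.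
Proof.
have := @phi_alpha1z R 0 1 isT isT; rewrite /= subr0 => ->; done.
Qed.
Let A1 : phi_alpha p1 = poo. Proof. by have := @phi_alpha1z R 1 1 isT isT; rewrite /= subrr.
  Qed.
Let Ao : phi_alpha poo = pm. Proof. by have := @phi_alpha2z R 1 0 isT isT; rewrite /= subr0.
  Qed.
Let Am : phi_alpha pm = p0. Proof. by have := @phi_alpha4z R (-1) 1 isT isT; rewrite /=
  addNr. Qed.

Lemma phi_alpha_inj : injective phi_alpha.
Proof.
by move=> z w /(congr1 (phi_alpha \o phi_alpha \o phi_alpha)); rewrite /= !phi_alpha4K.
Qed.

Definition diag x y := (x = p0 /\ y = poo) \/ (x = poo /\ y = p0).

(** The pair sent to infinity and 0 consists of [1] and [-1], which have determinant [2]. So the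
    Farey edges other than the diagonal are mapped among themselves, as iteration requires. *)
Lemma phi_alpha_nodiag x y : farey_pair x y -> ~ diag x y -> farey_pair (phi_alpha x)
  (phi_alpha y) /\ ~ diag (phi_alpha x) (phi_alpha y).
Proof.
move=> f nd; split; first by case: (phi_alpha_farey_pair f) => [h|[h|//]]; case: nd; [left |
  right].
by rewrite /diag -Am -A1 => -[] [/phi_alpha_inj ex /phi_alpha_inj ey]; subst x y; apply:
  not_farey_pair1m => //; exact: farey_pairC.
Qed.

Lemma M_edges_alpha : M_edges phi_alpha (@farey_edges R) = flip_edges (@farey_edges R) p0 p1
  poo pm.
Proof.
have [_ _ v0o] := ends0o.
apply/seteqP; split => A.
  move=> [B /farey_arcP[x [y [f ->]]] <-]; have [cx cy xy] := farey_pair_circle f.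
  rewrite M_arcE; [|exact: phi_alpha_homeo|exact: phi_alpha_cc|by []..].
  have [[[-> ->]|[-> ->]]|nd] := EM (diag x y).
  - by right; rewrite A0 Ao.
  - by right; rewrite A0 Ao /= ideal_arcC //; exact: nesym.
  - have [f' nd'] := phi_alpha_nodiag f nd; have [cx' cy' xy'] := farey_pair_circle f'.
    left; split; first exact: farey_pair_arc.
    by move=> /= /ideal_arc_inj h; apply: nd'; exact: h.
move=> [[/farey_arcP[x [y [f ->]]] n]|->]; last first.
  exists (ideal_arc p0 poo); first exact: farey_pair_arc (farey_pairC fo0).
  by rewrite M_arcE ?A0 ?Ao //; [exact: phi_alpha_homeo | exact: phi_alpha_cc].
have nd : ~ diag x y.
  by case=> -[ex ey]; apply: n; rewrite /= ex ey //; rewrite ideal_arcC //; exact: nesym.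
(* The map has order four, so its cube provides the preimage of an edge. *)
have [f1 nd1] := phi_alpha_nodiag f nd; have [f2 nd2] := phi_alpha_nodiag f1 nd1.
have [f3 nd3] := phi_alpha_nodiag f2 nd2; have [cx cy xy] := farey_pair_circle f3.
exists (ideal_arc (phi_alpha (phi_alpha (phi_alpha x))) (phi_alpha (phi_alpha (phi_alpha
  y)))); first exact: farey_pair_arc.
by rewrite (M_arcE (@phi_alpha_homeo R) (@phi_alpha_cc R) cx cy xy) !phi_alpha4K.
Qed.

Lemma M_edges_beta : M_edges phi_beta (@farey_edges R) = @farey_edges R.
Proof.
apply/seteqP; split => A.
  move=> [B /farey_arcP[x [y [f ->]]] <-]; have [cx cy xy] := farey_pair_circle f.
  rewrite M_arcE //; [|exact: phi_beta_homeo|exact: phi_beta_cc].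
  exact/farey_pair_arc/phi_beta_farey_pair.
move=> /farey_arcP[x [y [f ->]]].
have f2 := phi_beta_farey_pair (phi_beta_farey_pair f); have [cx cy xy] := farey_pair_circle f2.
exists (ideal_arc (phi_beta (phi_beta x)) (phi_beta (phi_beta y))); first exact: farey_pair_arc.
by rewrite (M_arcE (@phi_beta_homeo R) (@phi_beta_cc R) cx cy xy) !phi_beta3K.
Qed.

Lemma M_alpha : M_marked (M_class phi_alpha) tau_std tau_alpha.
Proof.
split => /=; first by rewrite -M_edges_alpha.
- by apply/M_pointE => //; exact: phi_alpha_homeo.
- by apply/M_pointE => //; exact: phi_alpha_homeo.
Qed.

Lemma M_beta : M_marked (M_class phi_beta) tau_std tau_beta.
Proof.
split => /=; first by rewrite -[LHS]M_edges_beta.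
- by apply/M_pointE; [exact: phi_beta_homeo | done | rewrite phi_beta_mu_hom ?nz_1r // add0r
    oppr0].
- by apply/M_pointE; [exact: phi_beta_homeo | done | rewrite phi_beta_mu_hom ?nz_1l // addr0
    -mu_homN opprK].
Qed.

End Tau.
End FareyMoves.

(** * Conjugation of the two homomorphisms *)

Lemma class_mul (X : choiceType) (rels : word X -> word X -> Prop) (u v : word X) :
  (word_class rels u * word_class rels v)%g = word_class rels (u ++ v).
Proof. exact: pres_mulE. Qed.

Lemma class_inv (X : choiceType) (rels : word X -> word X -> Prop) (u : word X) :
  ((word_class rels u)^-1)%g = word_class rels (winv u).
Proof. exact: pres_invE. Qed.

Section Generators.
Variable R : realType.
Variables (F1 F2 : functor (Pt R) (Pt_dot R)) (FF1 FF2 : {multiplicative groupT -> groupK}).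
Hypotheses (F1_equiv : M_equivariant F1) (F2_equiv : M_equivariant F2).
Hypotheses (FF1_constr : constructed_from F1 FF1) (FF2_constr : constructed_from F2 FF2).

(* The word [w] commutes with the action of [M], so it also leads from
   [F2 (m . x)] to [F1 (m . x)]. *)
Lemma generator_conj (g : T_gen) (x y : marked_tessellation R) phi w :
  M_homeo phi -> (forall x y z, circle x -> circle y -> circle z -> cc x y z -> cc (phi x)
    (phi y) (phi z)) ->
  mark_move g x y -> M_marked (M_class phi) x y ->
  applies (@dot_move R) w (fob F2 x) (fob F1 x) ->
  let h : groupK := word_class K_rel w in let t : groupT := word_class T_rel (letter g) in
  FF2 t = (h^-1 * FF1 t * h)%g.
Proof.
move=> hphi cphi st My hw h t.
have m1 := F1_equiv (M_class_group hphi) My; have m2 := F2_equiv (M_class_group hphi) My.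
have hw' := M_applies hphi cphi hw m2 m1.
(* Any word between these two objects will do: [constructed_from] identifies its class with
   [FF1 t]. *)
have [w1 h1] := dotted_connected (fob F1 x) (fob F1 y).
have lT : @leadsto_T R x y (Arrow x y) t.
  by exists (letter g) => //; exists x.
have -> : FF1 t = word_class K_rel w1.
  by apply: (FF1_constr lT); exists w1.
have h2 : applies (@dot_move R) ((winv w ++ w1) ++ w) (fob F2 x) (fob F2 y).
  apply/applies_cat; exists (fob F1 x) => //.
  apply/applies_cat; exists (fob F1 y) => //.
  exact: applies_winv.
rewrite /h class_inv (class_mul K_rel (winv w) w1) (class_mul K_rel (winv w ++ w1) w).
apply: (FF2_constr lT).
by exists ((winv w ++ w1) ++ w).
Qed.

End Generators.

Theorem proposition2p47 (R : realType)
  (taum1 taum2 : marked_tessellation R)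
  (taud1 taud2 : dotted_tessellation R)
  (F1 F2 : functor (Pt R) (Pt_dot R))
  (F1_equiv : M_equivariant F1) (F2_equiv : M_equivariant F2)
  (F1_tau : fob F1 taum1 = taud1) (F2_tau : fob F2 taum2 = taud2)
  (FF1 FF2 : {multiplicative groupT -> groupK})
  (FF1_constr : constructed_from F1 FF1)
  (FF2_constr : constructed_from F2 FF2) :
  exists h : groupK, forall g : groupT, (FF2 g = h^-1 * FF1 g * h)%g.
Proof.
have [Y _ eY] := reach_farey taud1.
have tF : tessellation (@farey_edges R) by rewrite -eY; exact: dt_tess.
have [w hw] := dotted_connected (fob F2 (tau_std tF)) (fob F1 (tau_std tF)).
exists (word_class K_rel w) => g; set h := word_class K_rel w.
have gen a : let t : groupT := word_class T_rel (letter a) in FF2 t = (h^-1 * FF1 t * h)%g.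
  case: a.
  - exact: (@generator_conj R F1 F2 FF1 FF2 F1_equiv F2_equiv FF1_constr FF2_constr T_alpha _
      _ _ w (@phi_alpha_homeo R) (@phi_alpha_cc R) (alpha_std tF) (M_alpha tF) hw).
  - exact: (@generator_conj R F1 F2 FF1 FF2 F1_equiv F2_equiv FF1_constr FF2_constr T_beta _
      _ _ w (@phi_beta_homeo R) (@phi_beta_cc R) (beta_std tF) (M_beta tF) hw).
have one (f : {multiplicative groupT -> groupK}) : f 1%g = 1%g.
  by apply: (mulgI (f 1%g)); rewrite -gmulfM !mulg1.
have inv (f : {multiplicative groupT -> groupK}) t : f t^-1%g = ((f t)^-1)%g.
  by apply: (mulgI (f t)); rewrite -gmulfM !mulgV one.
rewrite -[g]repr_class; elim: (repr g) => [|[a b] v IH].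
  have -> : word_class T_rel [::] = 1%g :> groupT by [].
  by rewrite !one mulg1 mulVg.
have -> : word_class T_rel ((a, b) :: v) = (word_class T_rel [:: (a, b)] * word_class T_rel
  v)%g :> groupT.
  by rewrite (class_mul T_rel [:: (a, b)] v).
rewrite !gmulfM IH; suff -> : FF2 (word_class T_rel [:: (a, b)]) = (h^-1 * FF1 (word_class
  T_rel [:: (a, b)]) * h)%g.
  by rewrite !mulgA mulgK.
case: b; first exact: gen.
have -> : word_class T_rel [:: (a, false)] = ((word_class T_rel (letter a))^-1)%g :> groupT.
  by rewrite class_inv.
by rewrite !inv gen !invgM invgK mulgA.
Qed.
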